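(* Consider the adaptive stochastic collocation algorithm SC described in the context, driven by the profit with work, and denote by $I_\ell$ the downward-closed multi-index set chosen by the algorithm at step $\ell>0$ and by $S_{I_\ell}[u]$ the corresponding sparse grid stochastic collocation approximation of the analytic function $u:\Gamma\to V$. Then there is a constant $C>0$ independent of $\ell$ such that $$\|u-S_{I_\ell}[u]\|_{L^\infty(\Gamma,V)}\le C\,\ell^5\Big(\frac{\ell}{N}\Big)^{4N}2^{\ell\left(1-\frac1N\right)}e^{-\frac{\sigma}{2}m\left(\ell^{1/N}\right)}\qquad\forall\,\ell>0 .$$
   Context: $\mathbb N=\{1,2,\dots\}$. Problem. $d\ge 2$; $D\subset\mathbb R^d$ a bounded domain with Lipschitz boundary; $N\in\mathbb N$; $\Gamma_1,\dots,\Gamma_N\subset\mathbb R$ compact intervals of positive length $|\Gamma_n|$, $\Gamma=\Gamma_1\times\dots\times\Gamma_N$. $f\in L^2(D)$ and $a(y,x)=a_0(x)+\sum_{n=1}^N a_n(x)y_n$ with $0<a_{\min}\le a(y,x)\le a_{\max}$ for all $y\in\Gamma$, $x\in D$, and $\nabla a(y,\cdot)|_T\in L^\infty(T)$ for all elements $T$ of a coarse initial mesh $\mathcal T_{\rm init}$ of $D$. $V=H^1_0(D)$, $\|v\|_V=\|\nabla v\|_{L^2(D)}$. $u:\Gamma\to V$ is the solution of $\int_D a(y,x)\nabla u(y,x)\cdot\nabla v(x)\,dx=\int_D f v\,dx$ for all $v\in V$, $y\in\Gamma$. It is a known fact that there is $\tau\in\mathbb R_{>0}^N$ such that $u$ extends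 to a bounded holomorphic function on $\Sigma(\Gamma,\tau)=\{z\in\mathbb C^N:\mathrm{dist}(z_n,\Gamma_n)\le\tau_n\ \forall n\}$; fix such a $\tau$ and put $\sigma=\min_n\sigma_n$, $\sigma_n=\log\Big(\frac{2\tau_n}{|\Gamma_n|}+\sqrt{1+\frac{4\tau_n^2}{|\Gamma_n|^2}}\Big)$. $\nabla$ acts on $x$; $\|g\|_{L^\infty(\Gamma,X)}=\sup_{y\in\Gamma}\|g(y)\|_X$. Sparse grids. $m(0)=0$, $m(1)=1$, $m(i)=2^{i-1}+1$ for $i>1$ (the last formula also for non-integer real arguments $>1$). $\mathcal Y_n^{m}\subset\Gamma_n$ is the set of $m$ Clenshaw–Curtis nodes, i.e. $-\cos(\pi(j-1)/(m-1))$, $j=1,\dots,m$ (the point $0$ if $m=1$), mapped affinely from $[-1,1]$ to $\Gamma_n$. $\mathcal U_n^{m(i)}$ is Lagrange interpolation at $\mathcal Y_n^{m(i)}$ in the $n$-th variable, $\mathcal U_n^0=0$. For $i\in\mathbb N^N$: $\Delta^{m(i)}=\bigotimes_{n=1}^N(\mathcal U_n^{m(i_n)}-\mathcal U_n^{m(i_n-1)})$. A finite $I\subset\mathbb N^N$ is downward-closed if $i\in I$, $i_n>1$ imply $i-e_n\in I$. $S_I[v]=\sum_{i\in I}\Delta^{m(i)}v$. Margin: $\mathcal M_I=\{i\in\mathbb N^N\setminus I: i-e_n\in I\text{ for some }n\text{ with }i_n>1\}$. For $i\in\mathcal M_I$, $A_{i,I}$ is the smallest subset of $\mathcal M_I$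 containing $i$ such that $I\cup A_{i,I}$ is downward-closed. Estimators and profit. $\zeta_{i,I}=\|\Delta^{m(i)}(a\nabla S_I[u])\|_{L^\infty(\Gamma,L^2(D))}$. Profit with work: $\mathcal P_{i,I}=\big(\sum_{j\in A_{i,I}}\zeta_{j,I}\big)/\big(\sum_{j\in A_{i,I}}W_j\big)$, $W_j=\prod_{n=1}^N(m(j_n)-m(j_n-1))$. Algorithm SC (run without stopping test; exact samples $u(y)$ available). $I_0=\{(1,\dots,1)\}$; for $\ell=0,1,\dots$ let $i_\ell$ maximize $\mathcal P_{i,I_\ell}$ over $i\in\mathcal M_{I_\ell}$ (ties: lexicographically first index) and set $I_{\ell+1}=I_\ell\cup A_{i_\ell,I_\ell}$. *)

(* Defs.v *)
From HB Require Import structures.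
From mathcomp Require Import all_boot all_order all_algebra.
From mathcomp Require Import all_classical all_reals all_analysis.
From mathcomp Require Import complex.

Set Implicit Arguments.
Unset Strict Implicit.
Unset Printing Implicit Defensive.

Import Order.TTheory GRing.Theory Num.Theory.
Import numFieldNormedType.Exports.

Local Open Scope classical_set_scope.
Local Open Scope ring_scope.
Local Open Scope complex_scope.

Section measurable_row.
Context {R : realType} (n : nat).

Let coors : 'I_n -> 'rV[R]_n -> R := fun i x => x ord0 i.

Let row_set0 : g_sigma_preimage coors set0.
Proof. exact: sigma_algebra0. Qed.

Let row_setC A : g_sigma_preimage coors A -> g_sigma_preimage coors (~` A).
Proof. exact: sigma_algebraC. Qed.

Let row_bigcup (F : (set 'rV[R]_n)^nat) :
  (forall i, g_sigma_preimage coors (F i)) ->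
  g_sigma_preimage coors (\bigcup_i (F i)).
Proof. exact: sigma_algebra_bigcup. Qed.

HB.instance Definition _ := @isMeasurable.Build default_measure_display
  'rV[R]_n (g_sigma_preimage coors) row_set0 row_setC row_bigcup.

End measurable_row.

Section lebesgue_row.
Context {R : realType}.

Definition cons_row n (p : 'rV[R]_n * R) : 'rV[R]_n.+1 :=
  row_mx (const_mx p.2 : 'rV[R]_1) p.1.

Lemma measurable_row_coord n (i : 'I_n) :
  measurable_fun setT (fun x : 'rV[R]_n => x ord0 i).
Proof.
move=> _ Y mY; rewrite setTI; apply: sub_sigma_algebra => /=.
rewrite -bigcup_seq/=; exists i => /=; first by rewrite mem_index_enum.
by exists Y => //; rewrite setTI.
Qed.

Lemma measurable_cons_row n : measurable_fun setT (@cons_row n).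
Proof.
suff H : @measurable _ 'rV[R]_n.+1 `<=` [set A | measurable (@cons_row n @^-1` A)].
  by move=> _ Y mY; rewrite setTI; exact: H.
apply: smallest_sub.
  split=> /=.
  - by rewrite preimage_set0.
  - by move=> A mA; rewrite setTD preimage_setC; exact: measurableC.
  - by move=> F mF; rewrite preimage_bigcup; exact: bigcupT_measurable.
move=> A; rewrite -bigcup_seq/= => -[i _ [B mB <-]].
rewrite setTI /=.
case: (split_ordP (i : 'I_(1 + n))) => j ij.
  rewrite (_ : _ @^-1` _ = (@snd 'rV[R]_n R) @^-1` B).
    by rewrite -[X in measurable X]setTI; apply: measurable_snd.
  apply/funext => -[x t]; rewrite /preimage/= /cons_row /=. congr (B _).
  by rewrite ij; apply: (etrans (row_mxEl _ _ _ _)); rewrite mxE.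
rewrite (_ : _ @^-1` _ = (fun p : 'rV[R]_n * R => p.1 ord0 j) @^-1` B).
  rewrite -[X in measurable X]setTI.
  exact: (measurableT_comp (measurable_row_coord j) measurable_fst).
by apply/funext => -[x t]; rewrite /preimage/= /cons_row; congr (B _); rewrite ij;
  exact: row_mxEr.
Qed.

Definition lebesgue_cons n (mu : {measure set 'rV[R]_n -> \bar R}) :
    set 'rV[R]_n.+1 -> \bar R :=
  pushforward (product_measure1 mu (@lebesgue_measure R)) (@cons_row n).

HB.instance Definition _ n (mu : {measure set 'rV[R]_n -> \bar R}) :=
  Measure.copy (lebesgue_cons mu)
    (measure_function_pushforward__canonical__measure_function_Measure
      (product_measure1 mu (@lebesgue_measure R)) (@measurable_cons_row n)).

Fixpoint lebesgue_row n : {measure set 'rV[R]_n -> \bar R} :=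
  if n is n'.+1 then [the measure _ _ of lebesgue_cons (lebesgue_row n')]
  else [the measure _ _ of \d_(0 : 'rV[R]_0)].

End lebesgue_row.

Section sobolev.
Context {R : realType} (d : nat).
Local Notation E := 'rV[R]_d.
Local Notation leb := (@lebesgue_row R d).
Implicit Types (D : set E).

Definition dotrv (x y : E) : R := \sum_j x ord0 j * y ord0 j.

Definition partial (j : 'I_d) (phi : E -> R) : E -> R :=
  fun x => 'D_(delta_mx ord0 j) phi x.

Definition smooth (phi : E -> R) : Prop :=
  forall s : seq 'I_d, let psi := foldr partial phi s in
    continuous psi /\ forall j x, derivable psi x (delta_mx ord0 j).

Definition test_fun D (phi : E -> R) : Prop :=
  smooth phi /\
  exists K : set E, [/\ compact K, K `<=` D & forall x, ~ K x -> phi x = 0].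

Definition grad (phi : E -> R) (x : E) : E := \row_j partial j phi x.

Definition is_L2 D (g : E -> R) : Prop :=
  measurable_fun D g /\ (\int[leb]_(x in D) (g x ^+ 2)%:E < +oo)%E.

Definition l2norm D (g : E -> E) : \bar R :=
  ((\int[leb]_(x in D) (dotrv (g x) (g x))%:E) `^ 2^-1)%E.

(* A function of H^1 is carried together with its weak gradient, as the pair
   (v, \nabla v); both components are representatives of L^2 classes. *)
Definition h1fun : Type := ((E -> R^o) * (E -> E))%type.

HB.instance Definition _ := GRing.Lmodule.on h1fun.

Definition fval (w : h1fun) : E -> R := w.1.
Definition nabla (w : h1fun) : E -> E := w.2.

(* H^1_0(D) is the closure of C_c^\infty(D) in H^1(D). *)
Definition H10 D : set h1fun := [set w |
  [/\ is_L2 D (fval w),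
      forall j, is_L2 D (fun x => nabla w x ord0 j) &
      exists phi : nat -> E -> R,
        [/\ forall k, test_fun D (phi k),
            (\int[leb]_(x in D) ((phi k x - fval w x) ^+ 2)%:E)%E
              @[k --> \oo] --> 0%E &
            l2norm D (fun x => grad (phi k) x - nabla w x)
              @[k --> \oo] --> 0%E ]]].

Definition normV D (w : h1fun) : \bar R := l2norm D (nabla w).

Definition h1funC : Type := ((E -> R[i]^o) * (E -> 'rV[R[i]]_d))%type.

HB.instance Definition _ := GRing.Lmodule.on h1funC.

Definition re_h1 (w : h1funC) : h1fun :=
  (fun x => complex.Re (w.1 x), fun x => map_mx (@complex.Re R) (w.2 x)).

Definition im_h1 (w : h1funC) : h1fun :=
  (fun x => complex.Im (w.1 x), fun x => map_mx (@complex.Im R) (w.2 x)).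

Definition H10C D : set h1funC := [set w | H10 D (re_h1 w) /\ H10 D (im_h1 w)].

Definition normVC D (w : h1funC) : \bar R :=
  ((\int[leb]_(x in D) (\sum_j Normc.normc (w.2 x ord0 j) ^+ 2)%:E) `^ 2^-1)%E.

(* Near each boundary point, D is the part lying above the graph of a
   Lipschitz function gam over the hyperplane orthogonal to the unit vector e;
   x - <x, e> e is the projection of x on this hyperplane. *)
Definition lipschitz_boundary D : Prop :=
  forall x0, (closure D `\` D^°) x0 ->
  exists (r : R) (e : E) (gam : E -> R),
    [/\ 0 < r, dotrv e e = 1, lipschitz gam &
        forall x, `|x - x0| < r ->
          (D x <-> gam (x - dotrv x e *: e) < dotrv x e)].

Definition lipschitz_domain D : Prop :=
  [/\ D !=set0, open D, connected D, bounded_set D & lipschitz_boundary D].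

Definition mesh D (Th : set (set E)) : Prop :=
  [/\ finite_set Th,
      forall T, Th T -> exists2 G, lipschitz_domain G & T = closure G,
      forall T T', Th T -> Th T' -> T <> T' -> T^° `&` T'^° = set0 &
      \bigcup_(T in Th) T = closure D].

Definition weak_gradient (O : set E) (v : E -> R) (g : E -> E) : Prop :=
  forall phi j, test_fun O phi ->
    (\int[leb]_(x in O) (v x * partial j phi x)%:E =
     - \int[leb]_(x in O) (g x ord0 j * phi x)%:E)%E.

Definition is_Linf (O : set E) (g : E -> E) : Prop :=
  (forall j, measurable_fun O (fun x => g x ord0 j)) /\
  exists M : R, {ae leb, forall x, O x -> forall j, `|g x ord0 j| <= M}.

End sobolev.

Section parametric.
Context {R : realType} (d N : nat).
Local Notation E := 'rV[R]_d.
Local Notation leb := (@lebesgue_row R d).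
Implicit Types (D : set E) (lo hi : 'I_N -> R).

Definition box lo hi : set 'rV[R]_N :=
  [set y | forall n, lo n <= y ord0 n <= hi n].

Definition coef (a0 : E -> R) (a : 'I_N -> E -> R) (y : 'rV[R]_N) (x : E) : R :=
  a0 x + \sum_n a n x * y ord0 n.

Definition is_solution D (Gam : set 'rV[R]_N) (a : 'rV[R]_N -> E -> R)
    (f : E -> R) (u : 'rV[R]_N -> h1fun d) : Prop :=
  forall y, Gam y -> H10 D (u y) /\
  forall v, H10 D v ->
    (\int[leb]_(x in D) (a y x * dotrv (nabla (u y) x) (nabla v x))%:E =
     \int[leb]_(x in D) (f x * fval v x)%:E)%E.

Definition Sigma lo hi (tau : 'I_N -> R) : set 'rV[R[i]]_N :=
  [set z | forall n,
    inf [set Normc.normc (z ord0 n - t%:C) | t in `[lo n, hi n]%classic]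
      <= tau n].

Definition cpolydisc (z : 'rV[R[i]]_N) (r : R) : set 'rV[R[i]]_N :=
  [set z' | forall n, Normc.normc (z' ord0 n - z ord0 n) < r].

Definition copen (O : set 'rV[R[i]]_N) : Prop :=
  forall z, O z -> exists2 r : R, 0 < r & cpolydisc z r `<=` O.

(* complex Frechet differentiability at every point of the open set O, with
   values in the complexification of H^1_0(D) *)
Definition holomorphic D (O : set 'rV[R[i]]_N) (U : 'rV[R[i]]_N -> h1funC d) :
    Prop :=
  (forall z, O z -> H10C D (U z)) /\
  forall z, O z -> exists2 G : 'I_N -> h1funC d, forall n, H10C D (G n) &
    forall eps : R, 0 < eps -> exists2 r : R, 0 < r &
      forall z', O z' -> cpolydisc z r z' ->
      (normVC D (U z' - U z - \sum_n (z' ord0 n - z ord0 n) *: G n)%R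
        <= (eps * \sum_n Normc.normc (z' ord0 n - z ord0 n))%R%:E)%E.

(* As usual, a function is holomorphic on the closed set Sigma if it is so on
   an open neighbourhood of Sigma.  Agreement with u on the box is equality of
   elements of V, not of representatives. *)
Definition bounded_holomorphic_extension D lo hi (tau : 'I_N -> R)
    (u : 'rV[R]_N -> h1fun d) : Prop :=
  exists (O : set 'rV[R[i]]_N) (U : 'rV[R[i]]_N -> h1funC d),
    [/\ copen O, Sigma lo hi tau `<=` O, holomorphic D O U,
        exists M : R, forall z, Sigma lo hi tau z -> (normVC D (U z) <= M%:E)%E &
        forall y, box lo hi y ->
          let z := map_mx (real_complex R) y in
          normV D (re_h1 (U z) - u y) = 0%:E /\ normV D (im_h1 (U z)) = 0%:E].

Definition sigma_n lo hi (tau : 'I_N -> R) (n : 'I_N) : R :=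
  let q := 2 * tau n / (hi n - lo n) in ln (q + Num.sqrt (1 + q ^+ 2)).

(* the infimum of a finite set, hence its minimum when 0 < N *)
Definition sigma_min lo hi (tau : 'I_N -> R) : R :=
  inf (range (sigma_n lo hi tau)).

End parametric.

Definition level (i : nat) : nat :=
  if (i <= 1)%N then i else (2 ^ i.-1 + 1)%N.

(* [level] for real arguments; only used for t >= 1, where level 1 = 1 *)
Definition levelR {R : realType} (t : R) : R :=
  if t <= 1 then t else 2 `^ (t - 1) + 1.

Section sparse_grid.
Context {R : realType} (N : nat).
Implicit Types (lo hi : 'I_N -> R) (y : 'rV[R]_N).

(* the nodes are indexed by 0 <= j < m *)
Definition cc_node (a b : R) (m j : nat) : R :=
  let t := if m == 1%N then 0 else - cos (pi * j%:R / m.-1%:R) in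
  (a + b) / 2 + (b - a) / 2 * t.

Definition cc_lagrange (a b : R) (m : nat) (j : 'I_m) (t : R) : R :=
  \prod_(k < m | k != j)
    ((t - cc_node a b m k) / (cc_node a b m j - cc_node a b m k)).

Definition upd y (n : 'I_N) (t : R) : 'rV[R]_N :=
  \row_k (if k == n then t else y ord0 k).

Definition interp lo hi (n : 'I_N) (m : nat) (W : lmodType R)
    (v : 'rV[R]_N -> W) : 'rV[R]_N -> W :=
  fun y => \sum_(j < m) cc_lagrange (lo n) (hi n) j (y ord0 n)
             *: v (upd y n (cc_node (lo n) (hi n) m j)).

Definition midx : Type := {ffun 'I_N -> nat}.

HB.instance Definition _ := Choice.on midx.

(* The factors of the tensor product act on different variables, so that it
   is their composition. *)
Definition hsurplus lo hi (i : midx) (W : lmodType R) (v : 'rV[R]_N -> W) :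
    'rV[R]_N -> W :=
  foldr (fun n w y => interp lo hi n (level (i n)) w y
                      - interp lo hi n (level (i n).-1) w y)
    v (enum 'I_N).

Definition sparse_interp lo hi (I : set midx) (W : lmodType R)
    (v : 'rV[R]_N -> W) : 'rV[R]_N -> W :=
  fun y => \sum_(i \in I) hsurplus lo hi i v y.

(* Multi-indices live in {1, 2, ...}^N. *)
Definition posidx (i : midx) : Prop := forall n, (0 < i n)%N.

Definition idx_one : midx := [ffun => 1%N].

Definition idx_pred (i : midx) (n : 'I_N) : midx :=
  [ffun k => (i k - (k == n))%N].

Definition downward_closed (I : set midx) : Prop :=
  forall i n, I i -> (1 < i n)%N -> I (idx_pred i n).

Definition margin (I : set midx) : set midx :=
  [set i | [/\ posidx i, ~ I i & exists2 n, (1 < i n)%N & I (idx_pred i n)]].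

Definition completion (I : set midx) (i : midx) : set midx :=
  smallest [set A | A `<=` margin I /\ downward_closed (I `|` A)] [set i].

Definition lexi_le (i j : midx) : Prop :=
  i = j \/
  exists n : 'I_N, (forall k : 'I_N, (k < n)%N -> i k = j k) /\ (i n < j n)%N.

Definition work (j : midx) : nat :=
  (\prod_n (level (j n) - level (j n).-1))%N.

End sparse_grid.

Section algorithm.
Context {R : realType} (d N : nat).
Local Notation E := 'rV[R]_d.
Variables (D : set E) (lo hi : 'I_N -> R) (a : 'rV[R]_N -> E -> R)
  (u : 'rV[R]_N -> h1fun (R := R) d).
Implicit Types (I : set (midx N)) (i : midx N).

Definition sup_norm (F : 'rV[R]_N -> \bar R) : \bar R :=
  ereal_sup [set F y | y in box lo hi].

Definition a_nabla_S I (y : 'rV[R]_N) : E -> E :=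
  fun x => a y x *: nabla (sparse_interp lo hi I u y) x.

Definition zeta I i : \bar R :=
  sup_norm (fun y => l2norm D (hsurplus lo hi i (a_nabla_S I) y)).

Definition profit I i : \bar R :=
  ((\sum_(j \in completion I i) zeta I j) *
   ((\sum_(j \in completion I i) ((work j)%:R : R))%R^-1)%:E)%E.

Definition selected I i : Prop :=
  [/\ margin I i,
      forall j, margin I j -> (profit I j <= profit I i)%E &
      forall j, margin I j -> profit I j = profit I i -> lexi_le i j].

Definition SC_run (I : nat -> set (midx N)) : Prop :=
  I 0%N = [set idx_one N] /\
  forall l, exists2 i, selected (I l) i &
    I l.+1 = I l `|` completion (I l) i.

End algorithm.

(* Main.v *)
(* Set K := max {i_n : i \in I_l}. As I_l has more than l elements,
   K^N >= l + 1.  Consider the step l' < l at which the coordinate K is first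
   reached in direction n.  Every index j added at this step has j_n = K, and
   j - e_n is its only backward neighbour in I_l'.  The surplus of index j of
   a \nabla S_I u is therefore a_n times a surplus of y_n U_n u, where U_n
   interpolates at level(K - 1) nodes in y_n.  Interpolation is exact on
   polynomials, so only the error of the polynomial approximation of u in y_n
   matters, which is of size exp(- \sigma (2^K / 4 - 1)) because u is
   holomorphic around the interval.  The selected profit is thus tiny; by
   maximality so are all estimators in the margin, and Galerkin orthogonality
   bounds the error at step l' by their sum.  The later steps only apply
   projections.  All constants lost are at most exp(c l).  The gap between
   (\sigma / 4) 2^K and the exponent (\sigma / 4) 2^(l^(1/N)) of the theorem
   absorbs them, since K^N >= l + 1 makes it at least of order
   2^K / K^(N - 1). *)
Require Import Defs.
From mathcomp Require Import all_boot all_order all_algebra finmap.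
From mathcomp Require Import all_classical all_reals all_analysis.
From mathcomp Require Import complex measurable_realfun.
From mathcomp Require Import ring lra zify.
From HB Require Import structures.

Set Implicit Arguments.
Unset Strict Implicit.
Unset Printing Implicit Defensive.

Import Order.TTheory GRing.Theory Num.Theory.
Import numFieldNormedType.Exports.

Local Open Scope classical_set_scope.
Local Open Scope ring_scope.

(** * Clenshaw-Curtis interpolation *)

(** Two facts reduce the problem to scalar functions and single directions. Sparse grid operators
    are finite combinations of point evaluations, so they commute with linear maps; pairing
    [nabla (u y)] with a fixed field psi leaves a scalar holomorphic function of one complex
    variable, with bounds proportional to the norm of psi, and psi is finally taken to be the
    surplus itself. Multiplication by y_k is bidiagonal in the hierarchical decomposition: it sends
    the component of index i to the indices i and i + e_k. Hence a \nabla S_I u lives on I and its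
    margin, and a margin index sees u only through its backward neighbours in I. The scalar
    approximation needs the rate exp(- sigma p) with the exact sigma, while any factor exp(c l) is
    harmless. So Lebesgue constants, cardinalities and works are bounded crudely, but the Dirichlet
    kernel is integrated along the edges of the full strip that the Joukowski map sends into the
    region of holomorphy. Goursat's theorem on rectangles suffices there, since the only singularity
    is removable. *)

Section clenshaw_curtis.
Context {R : realType}.

Fixpoint chebT (n : nat) : {poly R} :=
  match n with
  | 0 => 1
  | 1 => 'X
  | (n''.+1 as n').+1 => (2 *: ('X * chebT n') - chebT n'')
  end.

Lemma chebTSS n : chebT n.+2 = 2 *: ('X * chebT n.+1) - chebT n.
Proof. by []. Qed.

Lemma chebT_cos n (x : R) : (chebT n).[cos x] = cos (n%:R * x).
Proof.
suff: (chebT n).[cos x] = cos (n%:R * x) /\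
      (chebT n.+1).[cos x] = cos (n.+1%:R * x) by case.
elim: n => [|n [IH1 IH2]]; first by rewrite /= !hornerE cos0.
split=> //; rewrite chebTSS !hornerE IH1 IH2.
have -> : n.+2%:R * x = n.+1%:R * x + x by rewrite -natr1; ring.
have -> : n%:R * x = n.+1%:R * x - x by rewrite -natr1; ring.
by rewrite cosB cosD /=; ring.
Qed.

Lemma size_chebT n : (size (chebT n) <= n.+1)%N.
Proof.
suff: (size (chebT n) <= n.+1)%N /\ (size (chebT n.+1) <= n.+2)%N by case.
elim: n => [|n [IH1 IH2]]; first by rewrite /= size_polyC size_polyX; case: eqP.
split=> //; rewrite chebTSS.
apply: (leq_trans (size_polyD _ _)); rewrite size_polyN geq_max.
rewrite (leq_trans IH1) ?andbT; last by rewrite leqW.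
apply: (leq_trans (size_scale_leq _ _)).
by rewrite (leq_trans (size_polyMleq _ _)) // size_polyX.
Qed.

Lemma sin_natpi n : sin (n%:R * pi) = 0 :> R.
Proof.
elim: n => [|n IH]; first by rewrite mulr0n mul0r sin0.
by rewrite -natr1 mulrDl mul1r sinDpi IH oppr0.
Qed.

(** Multiplying by sin (x / 2) makes the sum telescope, each term becoming cos (x / 2) (sin ((k + 1)
    x) - sin (k x)). The sum is twice the trapezoidal rule, which halves the weight of the two end
    terms. *)
Lemma trapezoid_cos (n : nat) (x : R) : sin (x / 2) != 0 -> sin (n%:R * x) = 0 ->
  \sum_(k < n) (cos (k%:R * x) + cos (k.+1%:R * x)) = 0.
Proof.
move=> sx snx; apply: (mulfI sx); rewrite mulr0.
suff -> : sin (x / 2) * \sum_(k < n) (cos (k%:R * x) + cos (k.+1%:R * x)) =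
   cos (x / 2) * sin (n%:R * x) by rewrite snx mulr0.
elim: n {snx} => [|n IH]; first by rewrite big_ord0 mulr0n mul0r sin0 !mulr0.
rewrite big_ord_recr mulrDr IH /=.
set y := n%:R * x + x / 2.
have -> : n.+1%:R * x = y + x / 2 by rewrite /y -natr1; field.
have -> : n%:R * x = y - x / 2 by rewrite /y; field.
by clearbody y; rewrite cosB sinB cosD sinD; ring.
Qed.

(** Reversing the index absorbs the minus sign of the nodes, so that they become cosines of angles
    in [0, pi], where cos is injective. *)
Lemma cc_nodeE (a b : R) n j : (0 < n)%N -> (j <= n)%N ->
  cc_node a b n.+1 j =
  (a + b) / 2 + (b - a) / 2 * cos ((n - j)%:R * (pi / n%:R)).
Proof.
move=> n0 jn; rewrite /cc_node /= eqSS eqn0Ngt n0 /=.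
have n0' : n%:R != 0 :> R by rewrite pnatr_eq0 -lt0n.
have -> : (n - j)%:R * (pi / n%:R) = - (pi * j%:R / n%:R) + pi :> R.
  by rewrite natrB //; field.
by rewrite cosDpi cosN.
Qed.

Lemma cc_node1 (a b : R) j : cc_node a b 1 j = (a + b) / 2.
Proof. by rewrite /cc_node /= mulr0 addr0. Qed.

Lemma cc_node_itv (a b : R) m j : a <= b -> a <= cc_node a b m j <= b.
Proof.
move=> ab; rewrite /cc_node.
set t := if _ then _ else _.
have /andP[t1 t2] : -1 <= t <= 1.
  rewrite /t; case: ifP => _; first by rewrite lerN10 ler01.
  by rewrite -ler_norml normrN cos_max.
by apply/andP; split; nra.
Qed.

Lemma cc_angle_itv n j : (0 < n)%N -> (j <= n)%N ->
  j%:R * (pi / n%:R) \in `[0, pi : R].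
Proof.
move=> n0 jn; rewrite in_itv /= mulr_ge0 ?divr_ge0 ?pi_ge0 //=.
by rewrite mulrCA ler_piMr ?pi_ge0 // ler_pdivrMr ?ltr0n // mul1r ler_nat.
Qed.

Lemma cc_node_inj (a b : R) m (j k : 'I_m) : a < b ->
  cc_node a b m j = cc_node a b m k -> j = k.
Proof.
case: m j k => [[]//|[|n]] j k ab; first by rewrite !ord1.
have nR : n.+1%:R != 0 :> R by rewrite pnatr_eq0.
rewrite !cc_nodeE -1?ltnS // => /addrI.
have ba : (b - a) / 2 != 0 by rewrite mulf_neq0 ?subr_eq0 ?gt_eqF ?invr_gt0.
move=> /(mulfI ba) /cos_inj; rewrite !cc_angle_itv ?leq_subr // => /(_ isT isT).
have pin : pi / n.+1%:R != 0 :> R by rewrite mulf_neq0 ?invr_neq0 // gt_eqF ?pi_gt0.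
move=> /(mulIf pin)/eqP; rewrite eqr_nat => /eqP e; apply/val_inj => /=.
have := ltn_ord j; have := ltn_ord k; move: e; lia.
Qed.

Definition lagrange_poly (a b : R) m (j : 'I_m) : {poly R} :=
  \prod_(k < m | k != j)
    ((cc_node a b m j - cc_node a b m k)^-1 *: ('X - (cc_node a b m k)%:P)).

Lemma horner_lagrange a b m (j : 'I_m) t :
  (lagrange_poly a b j).[t] = cc_lagrange a b j t.
Proof.
rewrite /lagrange_poly horner_prod; apply: eq_bigr => k _.
by rewrite !hornerE mulrC.
Qed.

Lemma size_lagrange a b m (j : 'I_m) : (size (lagrange_poly a b j) <= m)%N.
Proof.
apply: leq_trans (size_poly_prod_leq _ _) _.
have m0 : (0 < m)%N by case: m j => [[]|].
have card : #|(fun k : 'I_m => k != j)| = m.-1.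
  by rewrite (cardC1 j) card_ord.
rewrite card leq_subLR; apply: (@leq_trans (m.-1 * 2).+1%N); last by lia.
rewrite ltnS -[in leqRHS]card -sum_nat_const; apply: leq_sum => k _.
by rewrite (leq_trans (size_scale_leq _ _)) // size_XsubC.
Qed.

Lemma lagrange_node (a b : R) m (i j : 'I_m) : a < b ->
  cc_lagrange a b j (cc_node a b m i) = (i == j)%:R.
Proof.
move=> ab; have [->|ij] := eqVneq i j.
  rewrite /cc_lagrange big1 // => k kj; rewrite divff // subr_eq0.
  by apply: contra_neq kj => /cc_node_inj ->.
by rewrite /cc_lagrange (bigD1 i) //= subrr mul0r mul0r.
Qed.

(** The interpolant minus P has size at most m and vanishes at the m distinct nodes. *)
Lemma lagrange_exact (a b : R) m (P : {poly R}) t : a < b -> (size P <= m)%N ->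
  \sum_(j < m) P.[cc_node a b m j] * cc_lagrange a b j t = P.[t].
Proof.
move=> ab sP; set Q := \sum_(j < m) P.[cc_node a b m j] *: lagrange_poly a b j.
have -> : \sum_(j < m) P.[cc_node a b m j] * cc_lagrange a b j t = Q.[t].
  rewrite horner_sum; apply: eq_bigr => j _.
  by rewrite hornerZ horner_lagrange.
suff : Q - P == 0 by rewrite subr_eq0 => /eqP ->.
apply/negPn/negP => QP0.
have sQ : (size (Q - P)%R <= m)%N.
  rewrite (leq_trans (size_polyD _ _)) // size_polyN geq_max sP andbT.
  apply: (leq_trans (size_sum _ _ _)); apply/bigmax_leqP => j _.
  by rewrite (leq_trans (size_scale_leq _ _)) // size_lagrange.
have := @max_poly_roots _ (Q - P) [seq cc_node a b m (val j) | j <- enum 'I_m] QP0.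
rewrite size_map size_enum_ord ltnNge sQ /= => H; suff: false by []; apply: H; last first.
  rewrite map_inj_uniq ?enum_uniq // => i j; exact: cc_node_inj.
apply/allP => x /mapP[i _ ->]; rewrite /root hornerD hornerN subr_eq0.
rewrite horner_sum (bigD1 i) //= hornerZ horner_lagrange lagrange_node // eqxx.
rewrite mulr1 big1 ?addr0 // => j ji.
by rewrite hornerZ horner_lagrange lagrange_node // eq_sym (negPf ji) mulr0.
Qed.


(** Doubling the number of intervals halves the angles, so node i of one level is node 2 i of the
    next. The single node of level 1 is the exception: it is the middle one of the three nodes of
    level 2. *)
Lemma level_nested (a b : R) p q j : (p <= q)%N -> (j < level p)%N ->
  exists2 j', (j' < level q)%N & cc_node a b (level p) j = cc_node a b (level q) j'.
Proof.
elim: q => [|q IH]; first by rewrite leqn0 => /eqP -> /=.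
rewrite leq_eqVlt => /predU1P[->|]; first by exists j.
rewrite ltnS => pq jp; have [i iq ->] := IH pq jp.
case: q {IH pq} iq => [//|[|q]].
  rewrite [level 1]/= ltnS leqn0 => /eqP ->; exists 1%N => //.
  rewrite cc_node1 [level 2]/= (@cc_nodeE a b 2) //= subSS subn0 mul1r.
  by rewrite cos_pihalf mulr0 addr0.
have l2 k : level k.+2 = (2 ^ k.+1).+1 by rewrite /level /= addn1.
rewrite !l2 !ltnS => iq; exists (2 * i)%N; first by rewrite ltnS expnS leq_pmul2l.
rewrite !cc_nodeE ?expn_gt0 //; last by rewrite expnS leq_pmul2l.
have e2 : (2 ^ q.+1)%:R != 0 :> R by rewrite pnatr_eq0 expn_eq0.
congr (_ + _ * cos _).
rewrite (expnS 2 q.+1) -mulnBr !natrM natrB //; field.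
by rewrite e2.
Qed.

(** The product formula leads to cosines of frequencies i - j and i + j, whose trapezoidal sums
    vanish unless the frequency is 0 or 2 n. These two cases produce the doubled value at the end
    indices. *)
Lemma cos_node_orth n (i j : nat) : (0 < n)%N -> (i <= n)%N -> (j <= n)%N ->
  \sum_(k < n) (cos (k%:R * (i%:R * (pi / n%:R))) * cos (k%:R * (j%:R * (pi / n%:R)))
     + cos (k.+1%:R * (i%:R * (pi / n%:R))) * cos (k.+1%:R * (j%:R * (pi / n%:R)))) =
  (if i == j then if (j == 0%N) || (j == n) then 2 else 1 else 0) * n%:R :> R.
Proof.
move=> n0; set c := pi / n%:R.
have nR : n%:R != 0 :> R by rewrite pnatr_eq0 -lt0n.
have cn : n%:R * c = pi by rewrite /c; field.
have c0 : 0 < c :> R by rewrite divr_gt0 ?pi_gt0 ?ltr0n.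
pose S (x : R) := \sum_(k < n) (cos (k%:R * x) + cos (k.+1%:R * x)).
have sinc r : (0 < r < 2 * n)%N -> sin (r%:R * c / 2) != 0.
  move=> /andP[r0 rn]; rewrite gt_eqF // sin_gt0_pi //.
  have r0' : 0 < r%:R :> R by rewrite ltr0n.
  apply/andP; split; first by apply: divr_gt0 => //; apply: mulr_gt0.
  rewrite ltr_pdivrMr // -cn.
  by rewrite mulrAC ltr_pM2r // -natrM ltr_nat mulnC.
have S0 r : (0 < r < 2 * n)%N -> S (r%:R * c) = 0.
  move=> rn; apply: trapezoid_cos; first exact: sinc.
  by rewrite mulrCA cn sin_natpi.
have S00 : S 0 = 2 * n%:R.
  rewrite /S (eq_bigr (fun=> 2)) => [|k _]; last by rewrite !mulr0 cos0.
  by rewrite sumr_const card_ord mulr_natr.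
have S2n : S ((n + n)%:R * c) = 2 * n%:R.
  rewrite -S00; apply: eq_bigr => k _; rewrite !mulr0 !natrD mulrDl cn.
  have cosk (l : nat) : cos (l%:R * (pi + pi)) = cos 0 :> R.
    elim: l => [|l IH]; first by rewrite mulr0n mul0r.
    rewrite -natr1 mulrDl mul1r addrA !cosDpi opprK; exact: IH.
  by rewrite !cosk.
wlog: i j / (j <= i)%N.
  move=> H iN jN; case: (leqP j i) => ij; first exact: H.
  have := H j i (ltnW ij) jN iN; rewrite eq_sym (ltn_eqF ij) => <-.
  by apply: eq_bigr => k _; rewrite mulrC [X in _ + X]mulrC.
move=> ji iN jN.
have -> : \sum_(k < n) (cos (k%:R * (i%:R * c)) * cos (k%:R * (j%:R * c))
     + cos (k.+1%:R * (i%:R * c)) * cos (k.+1%:R * (j%:R * c))) =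
     2^-1 * (S ((i - j)%:R * c) + S ((i + j)%:R * c)).
  rewrite /S -big_split mulr_sumr; apply: eq_bigr => k _ /=.
  rewrite natrB // natrD !mulrDr !mulrDl mulNr !mulrDr !mulrN !cosB !cosD; by field.
case: (eqVneq i j) => [->|ij].
  rewrite subnn mul0r S00.
  case: (eqVneq j 0%N) => [->|j0] /=.
    by rewrite addn0 mul0r S00; field.
  case: (eqVneq j n) => [->|jn]; first by rewrite S2n; field.
  by rewrite S0; [field | lia].
by rewrite !S0 ?mul0r ?addr0 ?mulr0 //; lia.
Qed.

(* By discrete orthogonality of the cosines at the nodes, a Lagrange polynomial
   for n + 1 nodes is w / n, with w <= 1, times a sum of 2 n products of two
   cosines. *)
Lemma cc_lagrange_le2 (a b : R) m (j : 'I_m) t : a < b -> a <= t <= b ->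
  `|cc_lagrange a b j t| <= 2.
Proof.
case: m j => [[]//|[|n]] j ab tab.
  rewrite /cc_lagrange big1 ?normr1 ?ler1n // => k; by rewrite !ord1.
set m := n.+1 in j *.
have mR : m%:R != 0 :> R by rewrite pnatr_eq0.
pose s i : R := cos ((m - i)%:R * (pi / m%:R)).
(* The weight 1/2 compensates the doubled discrete norm at the two end nodes. *)
pose w : R := if (val j == 0%N) || (val j == m) then 2^-1 else 1.
pose q : {poly R} := \sum_(k < m)
  ((chebT k).[s j] *: chebT k + (chebT k.+1).[s j] *: chebT k.+1).
pose P := (w / m%:R) *: (q \Po ((2 / (b - a)) *: ('X - ((a + b) / 2)%:P))).
have ba : b - a != 0 by rewrite subr_eq0 gt_eqF.
have sP : (size P <= m.+1)%N.
  apply: (leq_trans (size_scale_leq _ _)).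
  apply: (leq_trans (size_comp_poly_leq _ _)).
  rewrite size_scale ?mulf_neq0 ?invr_neq0 // size_XsubC muln1 ltnS.
  suff : (size q <= m.+1)%N by case: (size q).
  apply: (leq_trans (size_sum _ _ _)); apply/bigmax_leqP => k _.
  apply: (leq_trans (size_polyD _ _)); rewrite geq_max; apply/andP; split.
    apply: (leq_trans (size_scale_leq _ _)); apply: (leq_trans (size_chebT _)).
    by rewrite ltnW // ltnS.
  apply: (leq_trans (size_scale_leq _ _)); apply: (leq_trans (size_chebT _)).
  rewrite ltnS; exact: ltn_ord.
have PE x : P.[(a + b) / 2 + (b - a) / 2 * cos x] = (w / m%:R) *
   \sum_(k < m) ((chebT k).[s j] * cos (k%:R * x)
     + (chebT k.+1).[s j] * cos (k.+1%:R * x)).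
  rewrite hornerZ horner_comp !hornerE.
  have -> : 2 / (b - a) * ((a + b) / 2 + (b - a) / 2 * cos x - (a + b) / 2) = cos x.
    by field.
  rewrite horner_sum; congr (_ * _); apply: eq_bigr => k _.
  by rewrite hornerD !hornerZ !chebT_cos.
have Pn (i : 'I_m.+1) : P.[cc_node a b m.+1 i] = (i == j)%:R.
  rewrite cc_nodeE // -1?ltnS // PE.
  under eq_bigr do rewrite !chebT_cos.
  rewrite cos_node_orth ?leq_subr //.
  have im := ltn_ord i; have jm := ltn_ord j.
  have -> : ((m - j)%N == (m - i)%N) = (i == j).
    by rewrite -val_eqE /=; apply/eqP/eqP; lia.
  case: eqP => [->|_]; last by rewrite mul0r mulr0.
  rewrite /w; have -> : ((m - j)%N == 0%N) || ((m - j)%N == m) =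
     (val j == 0%N) || (val j == m).
    rewrite orbC /=; clear - jm; move: (nat_of_ord j) jm => k km.
    by congr (_ || _); apply/eqP/eqP; lia.
  by case: ifP => _ /=; rewrite mulr1n; field.
(* [P] has size at most [m.+1] and the nodal values of the Lagrange polynomial, so exactness of
   interpolation identifies the two. *)
have -> : cc_lagrange a b j t = P.[t].
  rewrite -(@lagrange_exact a b m.+1 P t ab sP) (bigD1 j) //= Pn eqxx mul1r.
  by rewrite big1 ?addr0 // => i ij; rewrite Pn (negPf ij) mul0r.
have [x ->] : exists x, t = (a + b) / 2 + (b - a) / 2 * cos x.
  exists (acos (2 / (b - a) * (t - (a + b) / 2))).
  have ba0 : 0 < b - a by rewrite subr_gt0.
  rewrite acosK; first by field.
  move: tab => /andP[ta tb]; rewrite in_itv /=.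
  have -> : 2 / (b - a) * (t - (a + b) / 2) = (2 * t - (a + b)) / (b - a) by field.
  by rewrite ler_pdivlMr // ler_pdivrMr //; apply/andP; split; lra.
rewrite PE normrM.
have w1 : `|w / m%:R| <= m%:R^-1.
  rewrite normrM ger0_norm; last by rewrite /w; case: ifP => _; lra.
  rewrite ger0_norm // ler_piMl ?invr_ge0 //.
  by rewrite /w; case: ifP => _; lra.
apply: (@le_trans _ _ (m%:R^-1 * (2 * m%:R))); last by rewrite mulrCA mulVf ?mulr1.
apply: ler_pM => //; apply: (le_trans (ler_norm_sum _ _ _)).
have -> : 2 * m%:R = \sum_(k < m) 2 :> R by rewrite sumr_const card_ord mulr_natr.
apply: ler_sum => k _; apply: (le_trans (ler_normD _ _)).
have c1 (u v : R) : `|cos u * cos v| <= 1.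
  by rewrite normrM mulr_ile1 ?cos_max.
by rewrite !chebT_cos lerD.
Qed.

End clenshaw_curtis.

(** * Hierarchical surpluses *)

Lemma level_lt p : (level p < level p.+1)%N.
Proof.
case: p => [|[|p]] //; rewrite /level /= ltn_add2r.
by rewrite ltn_exp2l.
Qed.

Lemma level_le p q : (p <= q)%N -> (level p <= level q)%N.
Proof.
elim: q => [|q IH]; first by rewrite leqn0 => /eqP ->.
rewrite leq_eqVlt => /predU1P[->//|]; rewrite ltnS => /IH /leq_trans; apply.
exact: ltnW (level_lt _).
Qed.

Section directional.
Context {R : realType} {N : nat} (lo hi : 'I_N -> R) (W : lmodType R).
Hypothesis lohi : forall n, lo n < hi n.
Local Notation F := ('rV[R]_N -> W).
Implicit Types (v w : F) (y : 'rV[R]_N) (n k : 'I_N) (i j : midx N) (p q m : nat).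
Local Notation intp n m := (@interp R N lo hi n m W).

Lemma updE y n t k : upd y n t ord0 k = if k == n then t else y ord0 k.
Proof. by rewrite mxE. Qed.

Lemma upd_same y n t : upd y n t ord0 n = t.
Proof. by rewrite updE eqxx. Qed.

Lemma upd_upd y n t t' : upd (upd y n t) n t' = upd y n t'.
Proof. by apply/rowP => k; rewrite !updE; case: eqP. Qed.

Lemma upd_id y n : upd y n (y ord0 n) = y.
Proof. by apply/rowP => k; rewrite !updE; case: eqP => // ->. Qed.

Lemma upd_comm y n k t t' : n != k -> upd (upd y n t) k t' = upd (upd y k t') n t.
Proof.
move=> nk; apply/rowP => l; rewrite !updE.
by case: (eqVneq l k) => // ->; rewrite eq_sym (negPf nk).
Qed.

Lemma interp_is_linear n m : linear (intp n m : F -> F).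
Proof.
move=> c v w; apply/funext => y.
rewrite !fctE /interp /= scaler_sumr -big_split /=.
by apply: eq_bigr => j _; rewrite scalerDr !scalerA mulrC.
Qed.

HB.instance Definition _ n m :=
  GRing.isLinear.Build R F F *:%R (intp n m : F -> F) (interp_is_linear n m).

Definition dirsurplus n p v : F :=
  fun y => intp n (level p) v y - intp n (level p.-1) v y.

Lemma dirsurplusE n p v : dirsurplus n p v = intp n (level p) v - intp n (level p.-1) v.
Proof. by []. Qed.

Lemma dirsurplus_is_linear n p : linear (dirsurplus n p).
Proof.
by move=> c v w; rewrite !dirsurplusE !linearP /= addrACA scalerBr scalerN.
Qed.

HB.instance Definition _ n p :=
  GRing.isLinear.Build R F F *:%R (dirsurplus n p) (dirsurplus_is_linear n p).

Lemma interp0 n v : intp n 0 v = 0.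
Proof. by apply/funext => y; rewrite /interp big_ord0. Qed.

Lemma dirsurplus0 n v : dirsurplus n 0 v = 0.
Proof. by rewrite dirsurplusE /= interp0 subr0. Qed.

Definition coordmul n v : F := fun y => y ord0 n *: v y.

Lemma coordmul_is_linear n : linear (coordmul n).
Proof.
move=> c v w; apply/funext => y.
by rewrite /coordmul !fctE /= scalerDr !scalerA mulrC.
Qed.

HB.instance Definition _ n :=
  GRing.isLinear.Build R F F *:%R (coordmul n) (coordmul_is_linear n).

Lemma interp_comm n k m m' v : n != k ->
  intp n m (intp k m' v) = intp k m' (intp n m v).
Proof.
move=> nk; apply/funext => y; rewrite /interp.
under eq_bigr do rewrite scaler_sumr.
rewrite exchange_big /=; apply: eq_bigr => j _; rewrite scaler_sumr.
apply: eq_bigr => l _; rewrite !scalerA !updE (negPf nk) eq_sym (negPf nk).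
by rewrite mulrC upd_comm.
Qed.

Lemma interp_coordmul n k m v : n != k ->
  intp n m (coordmul k v) = coordmul k (intp n m v).
Proof.
move=> nk; apply/funext => y; rewrite /interp /coordmul scaler_sumr.
by apply: eq_bigr => j _; rewrite updE eq_sym (negPf nk) !scalerA mulrC.
Qed.

Lemma dirsurplus_comm n k p q v : n != k ->
  dirsurplus n p (dirsurplus k q v) = dirsurplus k q (dirsurplus n p v).
Proof.
move=> nk; rewrite !dirsurplusE !linearB /= !(interp_comm _ _ _ nk).
by rewrite addrACA.
Qed.

Lemma dirsurplus_coordmul n k p v : n != k ->
  dirsurplus n p (coordmul k v) = coordmul k (dirsurplus n p v).
Proof. by move=> nk; rewrite !dirsurplusE linearB /= !interp_coordmul. Qed.

Lemma interp_at_node n p q v y (l : 'I_(level p)) : (p <= q)%N ->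
  intp n (level q) v (upd y n (cc_node (lo n) (hi n) (level p) l)) =
  v (upd y n (cc_node (lo n) (hi n) (level p) l)).
Proof.
move=> pq; have [l' lq ->] := level_nested (lo n) (hi n) pq (ltn_ord l).
rewrite /interp upd_same (bigD1 (Ordinal lq)) //=.
rewrite (lagrange_node (Ordinal lq) (Ordinal lq)) // eqxx scale1r upd_upd.
rewrite big1 ?addr0 // => k kl.
by rewrite (lagrange_node (Ordinal lq) k) // eq_sym (negPf kl) scale0r.
Qed.

Lemma interp_nest n p q v : (p <= q)%N -> intp n (level p) (intp n (level q) v) = intp n (level p) v.
Proof.
move=> pq; apply/funext => y; apply: eq_bigr => l _.
by rewrite interp_at_node.
Qed.

Lemma interp_coordmul_nest n p q v : (p <= q)%N ->
  intp n (level p) (coordmul n (intp n (level q) v)) =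
  intp n (level p) (coordmul n v).
Proof.
move=> pq; apply/funext => y; apply: eq_bigr => l _; rewrite /coordmul.
by rewrite interp_at_node.
Qed.

(** The coefficients may depend on the remaining coordinates: only the restriction to each line in
    direction n is polynomial. [p] is the number of coefficients, not the degree. *)
Definition poly_in n p v := forall y, exists c : nat -> W,
  forall t, v (upd y n t) = \sum_(l < p) t ^+ l *: c l.

Lemma interp_exact n m v : poly_in n m v -> intp n m v = v.
Proof.
move=> pv; apply/funext => y; have [c cE] := pv y.
rewrite -[in RHS](upd_id y n) cE /interp.
under eq_bigr do rewrite cE scaler_sumr.
rewrite exchange_big /=; apply: eq_bigr => l _.
under eq_bigr do rewrite scalerA.
rewrite -scaler_suml; congr (_ *: _).
have := @lagrange_exact _ (lo n) (hi n) m 'X^l (y ord0 n) (lohi n).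
rewrite size_polyXn hornerXn => <- //.
by apply: eq_bigr => j _; rewrite hornerXn mulrC.
Qed.

Lemma poly_in_interp n m v : poly_in n m (intp n m v).
Proof.
move=> y; exists (fun l => \sum_(j < m)
  (lagrange_poly (lo n) (hi n) j)`_l *: v (upd y n (cc_node (lo n) (hi n) m j))).
move=> t; rewrite /interp upd_same.
under [RHS]eq_bigr do rewrite scaler_sumr.
rewrite exchange_big /=; apply: eq_bigr => j _.
rewrite upd_upd -horner_lagrange (@horner_coef_wide _ m) ?size_lagrange //.
by rewrite scaler_suml; apply: eq_bigr => l _; rewrite scalerA mulrC.
Qed.

Lemma poly_in_mono n p q v : (p <= q)%N -> poly_in n p v -> poly_in n q v.
Proof.
move=> pq pv y; have [c cE] := pv y.
exists (fun l => if (l < p)%N then c l else 0) => t; rewrite cE.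
rewrite (big_ord_widen _ (fun l => t ^+ l *: c l) pq) big_mkcond.
by apply: eq_bigr => l _; case: ifP => // _; rewrite scaler0.
Qed.

Lemma poly_in_coordmul n p v : poly_in n p v -> poly_in n p.+1 (coordmul n v).
Proof.
move=> pv y; have [c cE] := pv y.
exists (fun l => if l is l'.+1 then c l' else 0) => t.
rewrite /coordmul upd_same cE big_ord_recl scaler0 add0r scaler_sumr.
by apply: eq_bigr => l _; rewrite scalerA -exprS.
Qed.

Lemma dirsurplus_exact n p v : poly_in n (level p.-1) v -> dirsurplus n p v = 0.
Proof.
move=> pv; rewrite dirsurplusE !interp_exact ?subrr //.
by apply: poly_in_mono pv; apply: level_le; exact: leq_pred.
Qed.

Lemma interp_interp n p q v :
  intp n (level p) (intp n (level q) v) = intp n (level (minn p q)) v.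
Proof.
case: (leqP p q) => pq; first exact: interp_nest.
apply: interp_exact; apply: poly_in_mono (poly_in_interp _ _ _).
exact: level_le (ltnW pq).
Qed.

(** Interpolation at nested nodes composes to the smaller level, so the four terms cancel in pairs
    when p and q differ. *)
Lemma dirsurplus_dirsurplus n p q v :
  dirsurplus n p (dirsurplus n q v) = if p == q then dirsurplus n p v else 0.
Proof.
rewrite [in LHS]dirsurplusE dirsurplusE !linearB /= !interp_interp.
case: eqP => [<-|pq].
  rewrite !minnn; have -> : minn p p.-1 = p.-1 by lia.
  have -> : minn p.-1 p = p.-1 by lia.
  by rewrite subrr addr0.
have [lt_pq|lt_qp] : (p < q)%N \/ (q < p)%N by lia.
  have -> : minn p q = minn p q.-1 by lia.
  have -> : minn p.-1 q = minn p.-1 q.-1 by lia.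
  by rewrite subrr add0r subrr.
have -> : minn p q = minn p.-1 q by lia.
have -> : minn p q.-1 = minn p.-1 q.-1 by lia.
by rewrite addrACA !subrr addr0.
Qed.

(** The factor y_n raises the size by one, and level (p - 2) + 1 <= level (p - 1), so both
    interpolation operators of the surplus are exact. For p = 1 the inner interpolant is already
    0. *)
Lemma dirsurplus_coordmul_interp n p v : (0 < p)%N ->
  dirsurplus n p (coordmul n (intp n (level p.-1.-1) v)) = 0.
Proof.
case: p => [//|[|p]] _; first by rewrite interp0 !linear0.
apply: dirsurplus_exact; apply: poly_in_mono (poly_in_coordmul (poly_in_interp _ _ _)).
exact: level_lt.
Qed.

Lemma dirsurplus_coordmul_nest n p q v : (p <= q)%N ->
  dirsurplus n p (coordmul n (intp n (level q) v)) = dirsurplus n p (coordmul n v).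
Proof.
move=> pq; rewrite !dirsurplusE !interp_coordmul_nest //.
by rewrite (leq_trans (leq_pred _)).
Qed.

(** Components of v above level p are invisible at the nodes of level p, and those up to level p - 2
    are annihilated because of their degree; only the levels p and p - 1 remain. *)
Lemma dirsurplus_coordmul_split n p v : (0 < p)%N ->
  dirsurplus n p (coordmul n v) = dirsurplus n p (coordmul n (dirsurplus n p v))
    + dirsurplus n p (coordmul n (dirsurplus n p.-1 v)).
Proof.
move=> p0; rewrite [dirsurplus n p v in RHS]dirsurplusE [dirsurplus n p.-1 v]dirsurplusE.
rewrite 2!(linearB (coordmul n)) 2!(linearB (dirsurplus n p)) /= (dirsurplus_coordmul_interp _ _ p0) subr0 subrK.
by rewrite dirsurplus_coordmul_nest.
Qed.

(** A surplus of level p vanishes at the nodes of level p - 1, which kills every component below p,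
    and its product with y_n is reproduced exactly at level p + 1. *)
Lemma coordmul_dirsurplus_split n p v : (0 < p)%N ->
  coordmul n (dirsurplus n p v) = dirsurplus n p (coordmul n (dirsurplus n p v))
    + dirsurplus n p.+1 (coordmul n (dirsurplus n p v)).
Proof.
move=> p0; set w := dirsurplus n p v.
rewrite [dirsurplus n p (coordmul n w)]dirsurplusE dirsurplusE /= addrC addrA subrK.
have -> : intp n (level p.-1) (coordmul n w) = 0.
  rewrite -(@interp_coordmul_nest n p.-1 p.-1) // /w dirsurplusE linearB /=.
  rewrite interp_nest ?leq_pred // interp_nest // subrr.
  by rewrite !linear0.
rewrite subr0 interp_exact //.
have Yp q : (q <= p)%N -> poly_in n (level p.+1) (coordmul n (intp n (level q) v)).
  move=> qp; apply: poly_in_mono (poly_in_coordmul (poly_in_interp _ _ _)).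
  by rewrite (leq_ltn_trans (level_le qp)) ?level_lt.
move=> y; have [c cE] := Yp p (leqnn _) y; have [c' cE'] := Yp p.-1 (leq_pred _) y.
exists (fun l => c l - c' l) => t.
rewrite /w dirsurplusE linearB /= [LHS]/GRing.add /= [X in _ + X]/GRing.opp /= cE cE'.
by rewrite -sumrB; apply: eq_bigr => l _; rewrite scalerBr.
Qed.

Lemma dirsurplus_succ_coordmul n p v : (0 < p)%N ->
  dirsurplus n p.+1 (coordmul n (dirsurplus n p v)) =
  dirsurplus n p.+1 (coordmul n (intp n (level p) v)).
Proof.
move=> p0; rewrite [dirsurplus n p v]dirsurplusE.
rewrite (linearB (coordmul n)) (linearB (dirsurplus n p.+1)) /=.
by rewrite (@dirsurplus_coordmul_interp n p.+1) // subr0.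
Qed.


(** Keeping the list of directions as a parameter allows one direction to be taken out and treated
    separately; the full enumeration gives [hsurplus]. *)
Definition tensor (s : seq 'I_N) (i : midx N) v : F :=
  foldr (fun n w => dirsurplus n (i n) w) v s.

Lemma tensor_is_linear s i : linear (tensor s i).
Proof.
elim: s => [|n s IH] c v w //=.
by rewrite IH linearP.
Qed.

HB.instance Definition _ s i :=
  GRing.isLinear.Build R F F *:%R (tensor s i) (tensor_is_linear s i).

Lemma tensor_dirsurplus s i n p v : n \notin s ->
  tensor s i (dirsurplus n p v) = dirsurplus n p (tensor s i v).
Proof.
elim: s => //= k s IH; rewrite inE negb_or => /andP[nk ns].
by rewrite IH // dirsurplus_comm // eq_sym.
Qed.

Lemma tensor_coordmul s i k v : k \notin s ->
  tensor s i (coordmul k v) = coordmul k (tensor s i v).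
Proof.
elim: s => //= n s IH; rewrite inE negb_or => /andP[nk ns].
by rewrite IH // dirsurplus_coordmul // eq_sym.
Qed.

Lemma tensor_idem s i v : uniq s -> tensor s i (tensor s i v) = tensor s i v.
Proof.
elim: s => //= n s IH /andP[ns us].
by rewrite tensor_dirsurplus // dirsurplus_dirsurplus eqxx IH.
Qed.

Lemma tensor_ext s i j v : {in s, i =1 j} -> tensor s i v = tensor s j v.
Proof.
elim: s => //= n s IH ij; rewrite ij ?mem_head // IH // => k ks.
by rewrite ij // inE ks orbT.
Qed.

Lemma tensor_rem s i k v : uniq s -> k \in s ->
  tensor s i v = tensor (rem k s) i (dirsurplus k (i k) v).
Proof.
elim: s => //= n s IH /andP[ns us]; rewrite inE.
case: (eqVneq n k) ns => [->|nk] ns /=; first by rewrite -tensor_dirsurplus.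
by move=> ks; rewrite IH.
Qed.

Local Notation surplus i := (@hsurplus R N lo hi i W).
Local Notation others k := (rem k (enum 'I_N)).

Lemma hsurplusE i v : surplus i v = tensor (enum 'I_N) i v.
Proof. by []. Qed.

Lemma hsurplus_is_linear i : linear (surplus i : F -> F).
Proof. exact: tensor_is_linear. Qed.

HB.instance Definition _ i :=
  GRing.isLinear.Build R F F *:%R (surplus i : F -> F) (hsurplus_is_linear i).

Lemma notin_others k : k \notin others k.
Proof. by rewrite mem_rem_uniq ?enum_uniq // inE eqxx. Qed.

Lemma uniq_others k : uniq (others k).
Proof. by rewrite rem_uniq // enum_uniq. Qed.

Lemma hsurplus_rem i k v :
  surplus i v = tensor (others k) i (dirsurplus k (i k) v).
Proof. by rewrite hsurplusE (@tensor_rem _ _ k) ?enum_uniq ?mem_enum. Qed.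

Lemma hsurplus0 i k v : i k = 0%N -> surplus i v = 0.
Proof. by move=> ik; rewrite (hsurplus_rem _ k) ik dirsurplus0 linear0. Qed.

Lemma hsurplus_idem i v : surplus i (surplus i v) = surplus i v.
Proof. by rewrite !hsurplusE tensor_idem // enum_uniq. Qed.

Lemma hsurplus_orth i j v : i <> j -> surplus i (surplus j v) = 0.
Proof.
move=> ij; have [k ijk] : exists k, i k <> j k.
  apply: contrapT => /forallNP H; apply: ij; apply/ffunP => k.
  exact: contrapT (H k).
rewrite (hsurplus_rem i k) (hsurplus_rem j k).
rewrite -(tensor_dirsurplus _ _ _ (notin_others k)) dirsurplus_dirsurplus.
by case: eqP ijk => // _ _; rewrite !(linear0 (tensor _ _)).
Qed.

Definition idx_succ (i : midx N) (n : 'I_N) : midx N :=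
  [ffun k => (i k + (k == n))%N].

Lemma idx_pred_same i k : idx_pred i k k = (i k).-1.
Proof. by rewrite ffunE eqxx subn1. Qed.

Lemma idx_pred_other i k n : n != k -> idx_pred i k n = i n.
Proof. by move=> nk; rewrite ffunE (negPf nk) subn0. Qed.

Lemma idx_succ_same i k : idx_succ i k k = (i k).+1.
Proof. by rewrite ffunE eqxx addn1. Qed.

Lemma idx_succ_other i k n : n != k -> idx_succ i k n = i n.
Proof. by move=> nk; rewrite ffunE (negPf nk) addn0. Qed.

Lemma others_neq k n : n \in others k -> n != k.
Proof. by rewrite mem_rem_uniq ?enum_uniq // inE => /andP[]. Qed.

Lemma hsurplus_pred j k v :
  surplus (idx_pred j k) v = tensor (others k) j (dirsurplus k (j k).-1 v).
Proof.
rewrite (hsurplus_rem _ k) idx_pred_same; apply: tensor_ext => n /others_neq nk.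
exact: idx_pred_other.
Qed.

Lemma hsurplus_succ j k v :
  surplus (idx_succ j k) v = tensor (others k) j (dirsurplus k (j k).+1 v).
Proof.
rewrite (hsurplus_rem _ k) idx_succ_same; apply: tensor_ext => n /others_neq nk.
exact: idx_succ_other.
Qed.

Lemma hsurplus_coordmul_tensor j k p q v :
  tensor (others k) j (dirsurplus k p (coordmul k
    (tensor (others k) j (dirsurplus k q v)))) =
  tensor (others k) j (dirsurplus k p (coordmul k (dirsurplus k q v))).
Proof.
have nk := notin_others k.
rewrite -(tensor_coordmul _ _ nk) -(tensor_dirsurplus _ _ _ nk).
by rewrite tensor_idem ?uniq_others.
Qed.

(** The one-dimensional splitting is applied in direction k. The other directions commute with
    [coordmul k] and are idempotent, so their surpluses may be inserted a second time. *)
Lemma hsurplus_coordmul_split j k v : posidx j ->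
  surplus j (coordmul k v) = surplus j (coordmul k (surplus j v))
    + surplus j (coordmul k (surplus (idx_pred j k) v)).
Proof.
move=> jpos; rewrite hsurplus_pred !(hsurplus_rem j k) !hsurplus_coordmul_tensor.
by rewrite [in LHS]dirsurplus_coordmul_split ?linearD.
Qed.

Lemma coordmul_hsurplus_split i k v : posidx i ->
  coordmul k (surplus i v) = surplus i (coordmul k (surplus i v))
    + surplus (idx_succ i k) (coordmul k (surplus i v)).
Proof.
move=> ipos; rewrite hsurplus_succ !(hsurplus_rem i k) !hsurplus_coordmul_tensor.
rewrite -(linearD (tensor (others k) i)) -coordmul_dirsurplus_split //.
by rewrite /= tensor_coordmul ?notin_others.
Qed.

(** The surplus of level j_k - 1 may be replaced by the whole interpolant of that level, as the part
    of level j_k - 2 is annihilated. In this form exactness on polynomials can be used. *)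
Lemma hsurplus_coordmul_pred j k v : (1 < j k)%N ->
  surplus j (coordmul k (surplus (idx_pred j k) v)) =
  tensor (others k) j
    (dirsurplus k (j k) (coordmul k (intp k (level (j k).-1) v))).
Proof.
move=> jk; rewrite hsurplus_pred (hsurplus_rem j k) hsurplus_coordmul_tensor.
case: (j k) jk => [//|p] p0.
by rewrite dirsurplus_succ_coordmul.
Qed.

End directional.

(** * Interpolation with values in a submodule *)

Section submodule_valued.
Context {R : realType} {N : nat} (lo hi : 'I_N -> R) (W W' : lmodType R).
Hypothesis lohi : forall n, lo n < hi n.
Variables (P : W -> Prop) (P0 : P 0)
  (PD : forall (c : R) v w, P v -> P w -> P (c *: v + w)).
Implicit Types (y : 'rV[R]_N) (n : 'I_N) (m : nat)
  (Z : set 'rV[R]_N).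

(** Interpolation in direction n only samples points moved along n inside the interval. The sets
    used later are the whole space, the box and a single segment. *)
Definition stable_dir Z n :=
  forall y t, Z y -> lo n <= t <= hi n -> Z (upd y n t).

Lemma submod_sum (T : Type) (r : seq T) (c : T -> R) (F : T -> W) :
  (forall i, P (F i)) -> P (\sum_(i <- r) c i *: F i).
Proof.
by move=> PF; elim: r => [|i r IH]; rewrite ?big_nil // big_cons; exact: PD.
Qed.

Lemma submodB v w : P v -> P w -> P (v - w).
Proof. by move=> Pv Pw; rewrite addrC -scaleN1r; exact: PD. Qed.

Lemma node_stable Z n y m j : stable_dir Z n -> Z y ->
  Z (upd y n (cc_node (lo n) (hi n) m j)).
Proof. by move=> st Zy; apply: st => //; rewrite cc_node_itv // ltW. Qed.

Lemma interp_submod Z n m (v : 'rV[R]_N -> W) : stable_dir Z n -> (forall y, Z y -> P (v y)) ->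
  forall y, Z y -> P (interp lo hi n m v y).
Proof.
by move=> st Pv y Zy; apply: submod_sum => j; apply: Pv; exact: node_stable.
Qed.

Lemma interp_eq_on Z n m (v w : 'rV[R]_N -> W) : stable_dir Z n -> (forall y, Z y -> v y = w y) ->
  forall y, Z y -> interp lo hi n m v y = interp lo hi n m w y.
Proof.
by move=> st vw y Zy; apply: eq_bigr => j _; rewrite vw //; exact: node_stable.
Qed.

Variables (L : W -> W').
Hypothesis Llin : forall (c : R) v w, P v -> P w -> L (c *: v + w) = c *: L v + L w.

Lemma submod_lin0 : L 0 = 0.
Proof.
have := Llin 1 P0 P0; rewrite scaler0 addr0 scale1r => /(congr1 (fun x => x - L 0)).
by rewrite addrK subrr.
Qed.

Lemma submod_linB v w : P v -> P w -> L (v - w) = L v - L w.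
Proof. by move=> Pv Pw; rewrite addrC -scaleN1r Llin // scaleN1r addrC. Qed.

Lemma submod_lin_sum (T : Type) (r : seq T) (c : T -> R) (F : T -> W) :
  (forall i, P (F i)) ->
  L (\sum_(i <- r) c i *: F i) = \sum_(i <- r) c i *: L (F i).
Proof.
move=> PF; elim: r => [|i r IH]; rewrite ?big_nil ?submod_lin0 // !big_cons.
by rewrite Llin ?IH //; exact: submod_sum.
Qed.

Lemma interp_lin Z n m (v : 'rV[R]_N -> W) : stable_dir Z n -> (forall y, Z y -> P (v y)) ->
  forall y, Z y -> L (interp lo hi n m v y) = interp lo hi n m (L \o v) y.
Proof.
move=> st Pv y Zy; rewrite submod_lin_sum // => j; apply: Pv.
exact: node_stable.
Qed.

Lemma dirsurplus_submod Z n p (v : 'rV[R]_N -> W) : stable_dir Z n -> (forall y, Z y -> P (v y)) ->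
  forall y, Z y -> P (dirsurplus lo hi n p v y).
Proof. by move=> st Pv y Zy; apply: submodB; apply: interp_submod Zy. Qed.

Lemma dirsurplus_lin Z n p (v : 'rV[R]_N -> W) : stable_dir Z n -> (forall y, Z y -> P (v y)) ->
  forall y, Z y -> L (dirsurplus lo hi n p v y) = dirsurplus lo hi n p (L \o v) y.
Proof.
move=> st Pv y Zy; rewrite submod_linB ?(interp_lin _ st Pv Zy) //;
  exact: interp_submod Zy.
Qed.

Lemma tensor_submod Z s i (v : 'rV[R]_N -> W) : (forall n, stable_dir Z n) ->
  (forall y, Z y -> P (v y)) -> forall y, Z y -> P (tensor lo hi s i v y).
Proof.
move=> st Pv; elim: s => //= n s IH; exact: dirsurplus_submod.
Qed.

Variable (nu : W -> R).
Hypothesis nu_ge0 : forall v, 0 <= nu v.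
Hypothesis nuD : forall v w, P v -> P w -> nu (v + w) <= nu v + nu w.
Hypothesis nuZ : forall c v, P v -> nu (c *: v) = `|c| * nu v.

Lemma nu0 : nu 0 = 0.
Proof. by rewrite -(scale0r (0 : W)) nuZ // normr0 mul0r. Qed.

Lemma nuB v w : P v -> P w -> nu (v - w) <= nu v + nu w.
Proof.
move=> Pv Pw; apply: (le_trans (nuD Pv _)).
  by rewrite -[- w]addr0 -scaleN1r; exact: PD.
by rewrite -scaleN1r nuZ // normrN1 mul1r.
Qed.

Lemma nu_sum (T : Type) (r : seq T) (c : T -> R) (F : T -> W) :
  (forall i, P (F i)) ->
  nu (\sum_(i <- r) c i *: F i) <= \sum_(i <- r) `|c i| * nu (F i).
Proof.
move=> PF; elim: r => [|i r IH]; rewrite ?big_nil ?nu0 // !big_cons.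
have Pi : P (c i *: F i) by rewrite -[_ *: _]addr0; exact: PD.
by apply: (le_trans (nuD Pi (submod_sum _ _ PF))); rewrite nuZ // lerD2l.
Qed.

(** Each Lagrange polynomial is at most 2 in absolute value, whence the Lebesgue constant 2 m. Its
    growth costs only a factor exponential in the level. *)
Lemma interp_bound Z n m (v : 'rV[R]_N -> W) (B : R) y : 0 <= B -> stable_dir Z n ->
  Z y -> lo n <= y ord0 n <= hi n ->
  (forall y, Z y -> P (v y)) -> (forall y, Z y -> nu (v y) <= B) ->
  nu (interp lo hi n m v y) <= (2 * m)%:R * B.
Proof.
move=> B0 st Zy yn Pv vB.
have Zn j := node_stable m j st Zy.
apply: (le_trans (nu_sum _ _ _)) => [j|]; first exact: Pv.
have -> : (2 * m)%:R * B = \sum_(j < m) 2 * B.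
  by rewrite sumr_const card_ord natrM -[RHS]mulr_natl; ring.
apply: ler_sum => j _; apply: ler_pM => //; last exact: vB.
exact: cc_lagrange_le2.
Qed.

Lemma dirsurplus_bound Z n p (v : 'rV[R]_N -> W) (B : R) y : 0 <= B -> stable_dir Z n ->
  Z y -> lo n <= y ord0 n <= hi n ->
  (forall y, Z y -> P (v y)) -> (forall y, Z y -> nu (v y) <= B) ->
  nu (dirsurplus lo hi n p v y) <= (4 * level p)%:R * B.
Proof.
move=> B0 st Zy yn Pv vB.
apply: (le_trans (nuB (interp_submod _ st Pv Zy) (interp_submod _ st Pv Zy))).
apply: (le_trans (lerD (interp_bound _ B0 st Zy yn Pv vB) (interp_bound _ B0 st Zy yn Pv vB))).
rewrite -mulrDl ler_wpM2r // -natrD ler_nat.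
have := level_le (leq_pred p); lia.
Qed.

Lemma level_le_exp p : (level p <= 2 ^ p)%N.
Proof.
rewrite /level; case: (leqP p 1) => [|p1]; first by case: p => [|[|]].
case: p p1 => // p _ /=; rewrite expnS mul2n -addnn leq_add2l.
by rewrite expn_gt0.
Qed.

(** Every direction contributes a factor 4 level (i_n) <= 2 ^ (q + 2). *)
Lemma tensor_bound s (i : midx N) q (v : 'rV[R]_N -> W) (B : R) : 0 <= B -> (forall n, (i n <= q)%N) ->
  (forall y, box lo hi y -> P (v y)) -> (forall y, box lo hi y -> nu (v y) <= B) ->
  forall y, box lo hi y ->
  nu (tensor lo hi s i v y) <= (2 ^ ((q + 2) * size s))%:R * B.
Proof.
have st n : stable_dir (box lo hi) n.
  by move=> y t yb tb k; rewrite updE; case: eqP => // ->.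
move=> B0 iq Pv vB; elim: s => [|n s IH] y yb; first by rewrite muln0 mul1r vB.
rewrite /= mulnS expnD natrM -mulrA.
set B' := _%:R * B in IH *.
have B'0 : 0 <= B' by rewrite mulr_ge0.
apply: le_trans (dirsurplus_bound _ B'0 (st n) yb (yb n) _ IH) _.
  exact: tensor_submod.
rewrite ler_wpM2r // ler_nat addnC expnD leq_mul //.
by rewrite (leq_trans (level_le_exp _)) // leq_exp2l.
Qed.

End submodule_valued.

Lemma box_stable {R : realType} {N : nat} (lo hi : 'I_N -> R) n :
  stable_dir lo hi (box lo hi) n.
Proof. by move=> y t yb tb k; rewrite updE; case: eqP => // ->. Qed.

Section tensor_map.
Context {R : realType} {N : nat} (lo hi : 'I_N -> R) (W W' : lmodType R).
Hypothesis lohi : forall n, lo n < hi n.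
Variables (P : W -> Prop) (P0 : P 0)
  (PD : forall (c : R) v w, P v -> P w -> P (c *: v + w)).
Variables (L : W -> W').
Hypothesis Llin : forall (c : R) v w, P v -> P w -> L (c *: v + w) = c *: L v + L w.

Lemma tensor_eq_on (V : lmodType R) (Z : set 'rV[R]_N) s i (v w : 'rV[R]_N -> V) :
  (forall n, stable_dir lo hi Z n) ->
  (forall y, Z y -> v y = w y) ->
  forall y, Z y -> tensor lo hi s i v y = tensor lo hi s i w y.
Proof.
move=> st vw; elim: s => //= n s IH y Zy; rewrite /dirsurplus.
by rewrite !(interp_eq_on lohi _ (st n) IH Zy).
Qed.

Lemma tensor_lin (Z : set 'rV[R]_N) s i (v : 'rV[R]_N -> W) :
  (forall n, stable_dir lo hi Z n) -> (forall y, Z y -> P (v y)) ->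
  forall y, Z y -> L (tensor lo hi s i v y) = tensor lo hi s i (L \o v) y.
Proof.
move=> st Pv; elim: s => //= n s IH y Zy.
rewrite (dirsurplus_lin lohi P0 PD Llin _ (st n) _ Zy).
  by rewrite /dirsurplus !(interp_eq_on lohi _ (st n) IH Zy).
exact: (tensor_submod lohi).
Qed.

End tensor_map.

(** * Sparse grid operators *)

Section margins.
Context {N : nat}.
Implicit Types (I : set (midx N)) (i j : midx N) (n k : 'I_N).

Lemma idx_succK i n : idx_pred (idx_succ i n) n = i.
Proof. by apply/ffunP => k; rewrite !ffunE addnK. Qed.

Lemma idx_predK i n : (0 < i n)%N -> idx_succ (idx_pred i n) n = i.
Proof.
move=> i0; apply/ffunP => k; rewrite !ffunE subnK //.
by case: eqP => // ->.
Qed.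

Lemma finite_margin I : finite_set I -> finite_set (margin I).
Proof.
move=> finI; have fin2 : finite_set (I `*` [set: 'I_N]).
  by apply: finite_setX => //; exact: finite_finset.
apply: sub_finite_set (finite_image (fun p => idx_succ p.1 p.2) fin2).
move=> i [ipos nIi [n i1 In]] /=; exists (idx_pred i n, n) => //=.
by rewrite idx_predK // ltnW.
Qed.

Lemma margin_succ I i n : (forall i, I i -> posidx i) -> I i ->
  I (idx_succ i n) \/ margin I (idx_succ i n).
Proof.
move=> Ipos Ii; case: (pselect (I (idx_succ i n))) => [?|nI]; [by left|right].
have ipos := Ipos _ Ii; split => //.
  by move=> k; rewrite ffunE addn_gt0 ipos.
by exists n; rewrite ?idx_succ_same ?idx_succK // ltnS ipos.
Qed.

End margins.

Section sparse.
Context {R : realType} {N : nat} (lo hi : 'I_N -> R) (W : lmodType R).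
Hypothesis lohi : forall n, lo n < hi n.
Local Notation F := ('rV[R]_N -> W).
Local Notation surplus i := (@hsurplus R N lo hi i W).
Implicit Types (v w : F) (I J : set (midx N)) (i j : midx N) (n k : 'I_N).

(** The sum is taken in the space of functions, so that S_I is available as a linear operator. *)
Definition sparse_sum I v : F := \sum_(i <- fset_set I) surplus i v.

Local Notation sparse := sparse_sum.

Lemma sparse_interpE I v : finite_set I -> sparse_interp lo hi I v = sparse I v.
Proof.
move=> finI; apply/funext => y; rewrite /sparse_interp fsbig_finite //=.
by rewrite /sparse fct_sumE.
Qed.

Lemma sparse_is_linear I : linear (sparse I).
Proof.
move=> c v w; rewrite /sparse scaler_sumr -big_split /=.
by apply: eq_bigr => i _; rewrite linearP.
Qed.

HB.instance Definition _ I :=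
  GRing.isLinear.Build R F F *:%R (sparse I) (sparse_is_linear I).

Lemma sparse_surplus I i v : finite_set I -> I i -> sparse I (surplus i v) = surplus i v.
Proof.
move=> finI Ii; rewrite /sparse (big_fsetD1 i) /=; last by rewrite in_fset_set //; exact: mem_set.
rewrite hsurplus_idem // big_seq big1 ?addr0 // => j.
by rewrite in_fsetD1 => /andP[/eqP ji _]; exact: hsurplus_orth.
Qed.

Lemma surplus_sparse I j v : finite_set I -> I j -> surplus j (sparse I v) = surplus j v.
Proof.
move=> finI Ij; rewrite /sparse linear_sum (big_fsetD1 j) /=; last first.
  by rewrite in_fset_set //; exact: mem_set.
rewrite hsurplus_idem // big_seq big1 ?addr0 // => i.
by rewrite in_fsetD1 => /andP[/eqP ij _]; apply: hsurplus_orth => // ji; exact: ij.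
Qed.

Lemma surplus_sparse0 I j v : finite_set I -> ~ I j -> surplus j (sparse I v) = 0.
Proof.
move=> finI nIj; rewrite /sparse linear_sum big_seq big1 // => i.
rewrite in_fset_set // => /set_mem Ii; apply: hsurplus_orth => // ji.
by apply: nIj; rewrite ji.
Qed.

Lemma sparse_sparse I J v : finite_set J -> finite_set I -> I `<=` J ->
  sparse J (sparse I v) = sparse I v.
Proof.
move=> finJ finI IJ; rewrite {2 3}/sparse linear_sum big_seq [RHS]big_seq /=.
apply: eq_bigr => i; rewrite in_fset_set // => /set_mem Ii.
by rewrite sparse_surplus //; exact: IJ.
Qed.

Lemma surplus_comp (L : {linear W -> W}) i v : surplus i (L \o v) = L \o surplus i v.
Proof.
apply/funext => y; symmetry.
apply: (@tensor_lin R N lo hi W W lohi (fun=> True) I _ L _ setT) => //.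
by move=> c x z _ _; rewrite linearP.
Qed.

Lemma sparse_comp (L : {linear W -> W}) I v : sparse I (L \o v) = L \o sparse I v.
Proof.
apply/funext => y; rewrite /sparse !fct_sumE /= linear_sum.
by apply: eq_bigr => i _; rewrite surplus_comp.
Qed.

Variables (m0 : {linear W -> W}) (mk : 'I_N -> {linear W -> W}).

(** This is multiplication by the affine coefficient a, with the multiplications by a_0 and a_k
    abstracted to linear maps of the value space. *)
Definition affmul v : F := m0 \o v + \sum_k coordmul k (mk k \o v).

(** Multiplication by y_k sends the component of index i in I to i and i + e_k, and the latter is in
    I or in the margin. *)
Lemma affmul_sparse_total I v : finite_set I -> (forall i, I i -> posidx i) ->
  sparse (I `|` margin I) (affmul (sparse I v)) = affmul (sparse I v).
Proof.
move=> finI Ipos; set J := I `|` margin I.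
have finJ : finite_set J by rewrite finite_setU; split => //; exact: finite_margin.
rewrite /affmul linearD linear_sum -sparse_comp; congr (_ + _).
  by apply: sparse_sparse => // i; left.
apply: eq_bigr => k _; rewrite -sparse_comp; set w := mk k \o v.
have -> : sparse I w = \sum_(i <- fset_set I) surplus i w by [].
rewrite (linear_sum (coordmul k)) (linear_sum (sparse J)) big_seq [RHS]big_seq /=.
apply: eq_bigr => i; rewrite in_fset_set // => /set_mem Ii.
rewrite coordmul_hsurplus_split //; last exact: Ipos.
rewrite (linearD (sparse J)) /= !sparse_surplus //; last by left.
exact: margin_succ.
Qed.

Lemma affmul_sparse_margin I v : finite_set I -> (forall i, I i -> posidx i) ->
  affmul (sparse I v) = sparse I (affmul (sparse I v))
    + \sum_(j <- fset_set (margin I)) surplus j (affmul (sparse I v)).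
Proof.
move=> finI Ipos; rewrite -[LHS](affmul_sparse_total v finI Ipos) {1}/sparse.
have finM := finite_margin finI.
rewrite -fsbig_finite; last by rewrite finite_setU.
rewrite fsbigU0 //; last by move=> i [Ii []].
by rewrite !fsbig_finite.
Qed.

(** The surplus of index j sees only the components of v at j and at the indices j - e_k. These
    belong to I, or have a zero coordinate and vanish. *)
Lemma surplus_affmul I j v : finite_set I -> downward_closed I -> posidx j -> I j ->
  surplus j (affmul (sparse I v)) = surplus j (affmul v).
Proof.
move=> finI dcI jpos Ij; rewrite /affmul !linearD !linear_sum /=; congr (_ + _).
  by rewrite -sparse_comp surplus_sparse.
apply: eq_bigr => k _; rewrite -sparse_comp.
rewrite hsurplus_coordmul_split // [RHS]hsurplus_coordmul_split //.
rewrite surplus_sparse //; congr (_ + _).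
have [jk|jk] := leqP (j k) 1.
  have j0 : idx_pred j k k = 0%N by rewrite idx_pred_same; lia.
  by rewrite !(hsurplus0 _ _ _ j0).
by rewrite surplus_sparse //; exact: dcI.
Qed.

Lemma sparse_affmul I v : finite_set I -> downward_closed I ->
  (forall i, I i -> posidx i) ->
  sparse I (affmul (sparse I v)) = sparse I (affmul v).
Proof.
move=> finI dcI Ipos; rewrite {1 3}/sparse big_seq [RHS]big_seq.
apply: eq_bigr => i; rewrite in_fset_set // => /set_mem Ii.
by rewrite surplus_affmul //; exact: Ipos.
Qed.

(** S_I v has no component at j, and none at j - e_k for k other than n, either because that index
    is outside I or because it has a zero coordinate. *)
Lemma surplus_affmul_margin I j n v : finite_set I -> posidx j -> ~ I j ->
  (1 < j n)%N -> I (idx_pred j n) ->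
  (forall k, (1 < j k)%N -> I (idx_pred j k) -> k = n) ->
  surplus j (affmul (sparse I v)) =
  mk n \o surplus j (coordmul n (surplus (idx_pred j n) v)).
Proof.
move=> finI jpos nIj jn Ijn uniqn.
rewrite /affmul linearD linear_sum /= -sparse_comp surplus_sparse0 // add0r.
rewrite (bigD1 n) //= big1 ?addr0 => [|k kn].
  rewrite -sparse_comp hsurplus_coordmul_split // surplus_sparse0 //.
  rewrite !linear0 add0r surplus_sparse // surplus_comp -[RHS]surplus_comp.
  congr (surplus j _); apply/funext => y.
  by rewrite /coordmul /= linearZ.
rewrite -sparse_comp hsurplus_coordmul_split // surplus_sparse0 // !linear0 add0r.
have [jk|jk] := leqP (j k) 1.
  have j0 : idx_pred j k k = 0%N by rewrite idx_pred_same; lia.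
  by rewrite (hsurplus0 _ _ _ j0) !linear0.
rewrite surplus_sparse0 ?linear0 // => Ijk.
by move/eqP: kn; apply; exact: uniqn.
Qed.

End sparse.

(** * Goursat's theorem for rectangles *)

Section segment_integral.
Context {R : realType}.
Notation mu := (@lebesgue_measure R).
Implicit Types (f g : R -> R) (a b c e : R).

Definition segint a b f : R := \int[mu]_(x in `[a, b]) f x.

Lemma within_itv_continuous a b f :
  (forall x, a <= x <= b -> forall e, 0 < e -> exists2 r, 0 < r &
    forall x', a <= x' <= b -> `|x' - x| < r -> `|f x' - f x| <= e) ->
  {within `[a, b], continuous f}.
Proof.
move=> H; apply/subspace_continuousP => x; rewrite /= in_itv /= => xab.
apply/cvgrPdist_le => e e0; have [r r0 Hr] := H x xab e e0.
rewrite near_withinE; apply/nbhs_normP; exists r => //= x' x'r.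
rewrite in_itv /= => x'ab; rewrite distrC; apply: Hr => //.
by rewrite distrC.
Qed.

Lemma segint_integrable a b f : {within `[a, b], continuous f} ->
  mu.-integrable `[a, b] (EFin \o f).
Proof. by move=> cf; apply: continuous_compact_integrable => //; exact: segment_compact. Qed.

Lemma segint_split a b c f : a <= c -> c <= b ->
  {within `[a, b], continuous f} -> segint a b f = segint a c f + segint c b f.
Proof.
move=> ac cb cf; have intf := segint_integrable cf.
rewrite /segint; have := @Rintegral_itvB R f (BLeft a) (BRight b) c intf.
rewrite !bnd_simp => /(_ ac cb)/eqP; rewrite subr_eq addrC => /eqP ->; congr (_ + _).
apply: Rintegral_itv_obnd_cbnd.
apply: integrableS intf => // x /=; rewrite !in_itv /= => /andP[x1 x2].
by rewrite x2 (le_trans ac) // ltW.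
Qed.

Lemma segintB a b f g : {within `[a, b], continuous f} ->
  {within `[a, b], continuous g} ->
  segint a b (fun x => f x - g x) = segint a b f - segint a b g.
Proof. by move=> cf cg; apply: RintegralB => //; exact: segint_integrable. Qed.

Lemma segintD a b f g : {within `[a, b], continuous f} ->
  {within `[a, b], continuous g} ->
  segint a b (fun x => f x + g x) = segint a b f + segint a b g.
Proof. by move=> cf cg; apply: RintegralD => //; exact: segint_integrable. Qed.

Lemma segint_cst a b c : a <= b -> segint a b (fun=> c) = c * (b - a).
Proof.
move=> ab; have := @lebesgue_measure_itv R `[a, b]; rewrite /= lte_fin.
rewrite /segint Rintegral_cst // => E; congr (_ * _); apply: (etrans (congr1 fine E)).
case: ltP => //= ba; have -> : a = b by apply/eqP; rewrite eq_le ab ba.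
by rewrite subrr.
Qed.

Lemma segint_bound a b f c e : a <= b -> {within `[a, b], continuous f} ->
  (forall x, a <= x <= b -> `|f x - c| <= e) ->
  `|segint a b f - c * (b - a)| <= e * (b - a).
Proof.
move=> ab cf H; rewrite -!segint_cst // ler_distl.
have icst (r : R) : mu.-integrable `[a, b] (EFin \o (fun=> r)).
  by apply: segint_integrable => x; exact: cst_continuous.
have intf := segint_integrable cf.
have ccst (r : R) : {within `[a, b], continuous (fun=> r)}.
  by move=> x; exact: cst_continuous.
rewrite -segintB // -segintD //.
apply/andP; split; apply: le_Rintegral => //;
  try (apply: segint_integrable; move=> x; exact: cst_continuous);
  move=> x /=; rewrite in_itv /= => /H; rewrite ler_distl => /andP[]; lra.
Qed.

Lemma within_continuousM a b f g : {within `[a, b], continuous f} ->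
  {within `[a, b], continuous g} -> {within `[a, b], continuous (fun x => f x * g x)}.
Proof.
by move=> cf cg x; exact: (@continuousM R (subspace `[a, b]) f g x (cf x) (cg x)).
Qed.

Lemma within_continuousD a b f g : {within `[a, b], continuous f} ->
  {within `[a, b], continuous g} -> {within `[a, b], continuous (fun x => f x + g x)}.
Proof.
by move=> cf cg x; exact: (@continuousD R _ (subspace `[a, b]) f g x (cf x) (cg x)).
Qed.

Lemma within_continuous_cst a b c : {within `[a, b], continuous (fun=> c)}.
Proof. by move=> x; exact: cst_continuous. Qed.

End segment_integral.

Section bisection.
Context {R : realType}.

Lemma nested_dyadic (w : R) (u : nat -> R) :
  (forall n, u n <= u n.+1) ->
  (forall n, u n.+1 + w / 2 ^+ n.+1 <= u n + w / 2 ^+ n) ->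
  0 <= w ->
  exists x, forall n, u n <= x <= u n + w / 2 ^+ n.
Proof.
move=> u1 u2 w0.
have mono m n : (m <= n)%N -> u m <= u n.
  elim: n => [|n IH]; first by rewrite leqn0 => /eqP ->.
  rewrite leq_eqVlt => /predU1P[->//|]; rewrite ltnS => /IH /le_trans; exact.
have anti m n : (m <= n)%N -> u n + w / 2 ^+ n <= u m + w / 2 ^+ m.
  elim: n => [|n IH]; first by rewrite leqn0 => /eqP ->.
  rewrite leq_eqVlt => /predU1P[->//|]; rewrite ltnS => /IH; exact: le_trans.
have le n m : u m <= u n + w / 2 ^+ n.
  have [mn|nm] := leqP m n.
    by rewrite (le_trans (mono _ _ mn)) // lerDl divr_ge0 // exprn_ge0.
  apply: le_trans (anti _ _ (ltnW nm)).
  by rewrite lerDl divr_ge0 // exprn_ge0.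
exists (sup (range u)) => n; apply/andP; split.
  apply: ub_le_sup; last by exists n.
  by exists (u 0%N + w / 2 ^+ 0) => _ [m _ <-].
by apply: ge_sup; [exists (u 0%N), 0%N | move=> _ [m _ <-]].
Qed.

(** Compactness in the form of bisection: if the property failed, one of four quarters would fail at
    every stage, and the nested failing rectangles would shrink to a point at which the local
    hypothesis applies. *)
Lemma rect_bisection (good : R -> R -> R -> R -> Prop) (A B C D : R) :
  A <= B -> C <= D ->
  (forall x1 x2 y1 y2, A <= x1 -> x1 <= x2 -> x2 <= B -> C <= y1 -> y1 <= y2 -> y2 <= D ->
    let xm := (x1 + x2) / 2 in let ym := (y1 + y2) / 2 in
    good x1 xm y1 ym -> good xm x2 y1 ym -> good x1 xm ym y2 -> good xm x2 ym y2 ->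
    good x1 x2 y1 y2) ->
  (forall x y, A <= x <= B -> C <= y <= D -> exists2 r, 0 < r &
    forall x1 x2 y1 y2, A <= x1 -> x1 <= x <= x2 -> x2 <= B ->
      C <= y1 -> y1 <= y <= y2 -> y2 <= D ->
      x2 - x1 < r -> y2 - y1 < r -> good x1 x2 y1 y2) ->
  good A B C D.
Proof.
move=> AB CD split_ local_; apply: contrapT => nG.
set w := B - A; set h := D - C.
have w0 : 0 <= w by rewrite subr_ge0.
have h0 : 0 <= h by rewrite subr_ge0.
(* The pair is the lower left corner of a failing rectangle of stage k, whose size is determined by
   k. *)
pose bad k (p : R * R) := [/\ A <= p.1, p.1 + w / 2 ^+ k <= B, C <= p.2,
  p.2 + h / 2 ^+ k <= D & ~ good p.1 (p.1 + w / 2 ^+ k) p.2 (p.2 + h / 2 ^+ k)].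
pose next k (p q : R * R) := [/\ p.1 <= q.1,
  q.1 + w / 2 ^+ k.+1 <= p.1 + w / 2 ^+ k, p.2 <= q.2 &
  q.2 + h / 2 ^+ k.+1 <= p.2 + h / 2 ^+ k].
have half k (v : R) : v / 2 ^+ k = v / 2 ^+ k.+1 + v / 2 ^+ k.+1.
  by rewrite exprS invfM; field; rewrite expf_neq0.
(* [choice] requires a successor for every pair; for those that are not bad any value serves. *)
have step (kp : nat * (R * R)) : exists q, bad kp.1 kp.2 ->
    bad kp.1.+1 q /\ next kp.1 kp.2 q.
  case: kp => k [x y] /=; case: (pselect (bad k (x, y))) => [|nb]; last by exists 0.
  move=> [/= Ax xB Cy yD ng].
  have w'0 : 0 <= w / 2 ^+ k.+1 by rewrite divr_ge0 // exprn_ge0.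
  have h'0 : 0 <= h / 2 ^+ k.+1 by rewrite divr_ge0 // exprn_ge0.
  move: (half k w) (half k h) w'0 h'0 => hw hh.
  rewrite hw in xB ng *; rewrite hh in yD ng *; rewrite /bad /next /= {}hw {}hh.
  move: (w / 2 ^+ k.+1) (h / 2 ^+ k.+1) xB yD ng => w' h' xB yD ng w'0 h'0.
  apply: contrapT => /forallNP H; apply: ng.
  have child x' y' : x <= x' -> x' <= x + w' -> y <= y' -> y' <= y + h' ->
      good x' (x' + w') y' (y' + h').
    move=> l1 l2 l3 l4; apply: contrapT => ng.
    by apply: (H (x', y')) => _; clear - Ax xB Cy yD l1 l2 l3 l4 w'0 h'0 ng; split; split => //=; lra.
  have em : (x + (x + (w' + w'))) / 2 = x + w' by field.
  have en : (y + (y + (h' + h'))) / 2 = y + h' by field.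
  clear H.
  apply: split_ => //; rewrite ?em ?en ?(addrA x) ?(addrA y); try lra;
    by apply: child; lra.
have [f fP] := choice step.
pose p := fix p k := if k is k'.+1 then f (k', p k') else (A, C).
have badp k : bad k (p k).
  elim: k => [|k IH]; last by have [] := fP (k, p k) IH.
  by split; rewrite /= ?divr1 /w /h ?expr0 ?divr1 // ?subrKC //.
have nextp k : next k (p k) (p k.+1) by have [] := fP (k, p k) (badp k).
have [x xP] := @nested_dyadic w (fun k => (p k).1) (fun k => let: And4 a _ _ _ := nextp k in a)
  (fun k => let: And4 _ a _ _ := nextp k in a) w0.
have [y yP] := @nested_dyadic h (fun k => (p k).2) (fun k => let: And4 _ _ a _ := nextp k in a)
  (fun k => let: And4 _ _ _ a := nextp k in a) h0.
have [] := local_ x y.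
- have [a1 a2 _ _ _] := badp 0%N; have := xP 0%N; lra.
- have [_ _ a1 a2 _] := badp 0%N; have := yP 0%N; lra.
move=> r r0 Hr.
have [k kP] : exists k, (w + h) / 2 ^+ k < r.
  have [k kP] : exists k : nat, (w + h) / r < k%:R.
    exists (Num.trunc ((w + h) / r)).+1; exact: truncnS_gt.
  exists k; rewrite ltr_pdivrMr ?exprn_gt0 // mulrC -ltr_pdivrMr //.
  apply: (lt_le_trans kP); rewrite -natrX ler_nat.
  by rewrite ltnW // ltn_expl.
have [a1 a2 a3 a4 ng] := badp k; apply: ng; apply: Hr => //.
  rewrite addrC addKr; apply: le_lt_trans kP.
  by rewrite ler_pM2r ?invr_gt0 ?exprn_gt0 // lerDl.
rewrite addrC addKr; apply: le_lt_trans kP.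
by rewrite ler_pM2r ?invr_gt0 ?exprn_gt0 // lerDr.
Qed.

End bisection.

Section goursat.
Context {R : realType}.
Variables P Q : R -> R -> R.

Definition cont_at (f : R -> R -> R) (x y : R) := forall e : R, 0 < e ->
  exists2 r : R, 0 < r & forall x' y', `|x' - x| < r -> `|y' - y| < r ->
    `|f x' y' - f x y| <= e.

(* The form P dx + Q dy is differentiable and closed at (x, y). *)
Definition closed_at (x y : R) := exists al be ga : R, forall e : R, 0 < e ->
  exists2 r : R, 0 < r & forall x' y', `|x' - x| < r -> `|y' - y| < r ->
    `|P x' y' - P x y - (al * (x' - x) + be * (y' - y))|
      <= e * (`|x' - x| + `|y' - y|) /\
    `|Q x' y' - Q x y - (be * (x' - x) + ga * (y' - y))|
      <= e * (`|x' - x| + `|y' - y|).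

(** Circulation of P dx + Q dy along the boundary, counterclockwise. *)
Definition contour (x1 x2 y1 y2 : R) : R :=
  (segint x1 x2 (P ^~ y1) - segint x1 x2 (P ^~ y2)) +
  (segint y1 y2 (Q x2) - segint y1 y2 (Q x1)).

Lemma slicex_cont f a b y : (forall x, a <= x <= b -> cont_at f x y) ->
  {within `[a, b], continuous (f ^~ y)}.
Proof.
move=> H; apply: within_itv_continuous => x xab e e0.
have [r r0 Hr] := H x xab e e0; exists r => // x' _ x'r.
by apply: Hr => //; rewrite subrr normr0.
Qed.

Lemma slicey_cont f a b x : (forall y, a <= y <= b -> cont_at f x y) ->
  {within `[a, b], continuous (f x)}.
Proof.
move=> H; apply: within_itv_continuous => y yab e e0.
have [r r0 Hr] := H y yab e e0; exists r => // y' _ y'r.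
by apply: Hr => //; rewrite subrr normr0.
Qed.

Section rectangle.
Variables A B C D : R.
Hypothesis contP : forall x y, A <= x <= B -> C <= y <= D -> cont_at P x y.
Hypothesis contQ : forall x y, A <= x <= B -> C <= y <= D -> cont_at Q x y.

Lemma slicexP x1 x2 y : A <= x1 -> x2 <= B -> C <= y <= D ->
  {within `[x1, x2], continuous (P ^~ y)}.
Proof.
move=> Ax xB yCD; apply: slicex_cont => x /andP[h1 h2]; apply: contP => //.
by rewrite (le_trans Ax) // (le_trans h2).
Qed.

Lemma sliceyQ y1 y2 x : C <= y1 -> y2 <= D -> A <= x <= B ->
  {within `[y1, y2], continuous (Q x)}.
Proof.
move=> Cy yD xAB; apply: slicey_cont => y /andP[h1 h2]; apply: contQ => //.
by rewrite (le_trans Cy) // (le_trans h2).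
Qed.

Lemma contour_splitx x1 x2 x3 y1 y2 : A <= x1 -> x1 <= x2 -> x2 <= x3 -> x3 <= B ->
  C <= y1 -> y1 <= y2 -> y2 <= D ->
  contour x1 x3 y1 y2 = contour x1 x2 y1 y2 + contour x2 x3 y1 y2.
Proof.
move=> h1 h2 h3 h4 h5 h6 h7; rewrite /contour.
rewrite (@segint_split _ x1 x3 x2 (P ^~ y1)) ?(@segint_split _ x1 x3 x2 (P ^~ y2)) //.
- by ring.
- by apply: slicexP => //; apply/andP; split; lra.
- by apply: slicexP => //; apply/andP; split; lra.
Qed.

Lemma contour_splity x1 x2 y1 y2 y3 : A <= x1 -> x1 <= x2 -> x2 <= B ->
  C <= y1 -> y1 <= y2 -> y2 <= y3 -> y3 <= D ->
  contour x1 x2 y1 y3 = contour x1 x2 y1 y2 + contour x1 x2 y2 y3.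
Proof.
move=> h1 h2 h3 h4 h5 h6 h7; rewrite /contour.
rewrite (@segint_split _ y1 y3 y2 (Q x1)) ?(@segint_split _ y1 y3 y2 (Q x2)) //.
- by ring.
- by apply: sliceyQ => //; apply/andP; split; lra.
- by apply: sliceyQ => //; apply/andP; split; lra.
Qed.

(** The linear terms with the common slope [be] cancel between the horizontal and the vertical
    sides, so only the deviations from them are integrated. *)
Lemma contour_bound x1 x2 y1 y2 (be e : R) : A <= x1 -> x1 <= x2 -> x2 <= B ->
  C <= y1 -> y1 <= y2 -> y2 <= D ->
  (forall x, x1 <= x <= x2 -> `|P x y1 - P x y2 - be * (y1 - y2)| <= e) ->
  (forall y, y1 <= y <= y2 -> `|Q x2 y - Q x1 y - be * (x2 - x1)| <= e) ->
  `|contour x1 x2 y1 y2| <= e * ((x2 - x1) + (y2 - y1)).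
Proof.
move=> h1 h2 h3 h4 h5 h6 HP HQ; rewrite /contour.
have p1 : {within `[x1, x2], continuous (P ^~ y1)}.
  by apply: slicexP => //; apply/andP; split; lra.
have p2 : {within `[x1, x2], continuous (P ^~ y2)}.
  by apply: slicexP => //; apply/andP; split; lra.
have q1 : {within `[y1, y2], continuous (Q x1)}.
  by apply: sliceyQ => //; apply/andP; split; lra.
have q2 : {within `[y1, y2], continuous (Q x2)}.
  by apply: sliceyQ => //; apply/andP; split; lra.
rewrite -!segintB //.
have I1 := @segint_bound _ x1 x2 _ (be * (y1 - y2)) e h2 (fun x => continuousB (p1 x) (p2 x)) HP.
have I2 := @segint_bound _ y1 y2 _ (be * (x2 - x1)) e h5 (fun x => continuousB (q2 x) (q1 x)) HQ.
set a := segint _ _ _ in I1 *; set b := segint _ _ _ in I2 *.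
have -> : a + b = (a - be * (y1 - y2) * (x2 - x1)) + (b - be * (x2 - x1) * (y2 - y1)) by ring.
by apply: le_trans (ler_normD _ _) _; rewrite [leRHS]mulrDr; exact: lerD.
Qed.

Lemma goursat : A <= B -> C <= D ->
  (forall x y, A <= x <= B -> C <= y <= D -> closed_at x y) ->
  contour A B C D = 0.
Proof.
move=> AB CD cl; apply/eqP; rewrite -normr_le0.
set S := (B - A + (D - C)) ^+ 2.
suff H e : 0 < e -> `|contour A B C D| <= e * S.
  rewrite leNgt; apply/negP => c0.
  have S0 : 0 <= S by exact: sqr_ge0.
  have Sp : 0 < S + 1 by lra.
  set c := `|_| in c0 H *.
  have d0 : 0 < c / (S + 1) by rewrite divr_gt0.
  have dE : c / (S + 1) * (S + 1) = c by rewrite mulfVK ?gt_eqF.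
  move: d0 dE; set d := c / (S + 1) => d0 dE.
  have d20 : 0 < d / 2 by rewrite divr_gt0.
  have := H _ d20; lra.
move=> e0; rewrite /S.
(* The bound is quadratic in half the perimeter, so the bounds for the four quarters add up exactly
   to that of the whole rectangle, while differentiability provides it near each point. *)
apply: (rect_bisection (good := fun x1 x2 y1 y2 =>
   `|contour x1 x2 y1 y2| <= e * (x2 - x1 + (y2 - y1)) ^+ 2)) => //.
- move=> x1 x2 y1 y2 h1 h2 h3 h4 h5 h6 xm ym g1 g2 g3 g4.
  have k1 : x1 <= xm by rewrite /xm; lra.
  have k2 : xm <= x2 by rewrite /xm; lra.
  have k3 : y1 <= ym by rewrite /ym; lra.
  have k4 : ym <= y2 by rewrite /ym; lra.
  rewrite (@contour_splity x1 x2 y1 ym y2) //.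
  rewrite (@contour_splitx x1 xm x2 y1 ym) // ?(le_trans k4) //.
  rewrite (@contour_splitx x1 xm x2 ym y2) // ?(le_trans h4) //.
  apply: (le_trans (ler_normD _ _)).
  apply: (le_trans (lerD (ler_normD _ _) (ler_normD _ _))).
  apply: (le_trans (lerD (lerD g1 g2) (lerD g3 g4))).
  rewrite -!mulrDr ler_pM2l // /xm /ym.
  by rewrite le_eqVlt; apply/orP; left; apply/eqP; field.
- move=> x y xAB yCD; have [al [be [ga H]]] := cl x y xAB yCD.
  have e20 : 0 < e / 2 by rewrite divr_gt0.
  have [r r0 Hr] := H _ e20; exists r => // x1 x2 y1 y2 h1 h2 h3 h4 h5 h6 h7 h8.
  have [h2a h2b] := andP h2; have [h5a h5b] := andP h5.
  rewrite expr2 mulrA; apply: (@contour_bound _ _ _ _ be) => //; try lra.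
  + move=> t t12; have [t1 t2] := andP t12.
    have l1 : `|t - x| <= x2 - x1 by rewrite ler_norml; apply/andP; split; lra.
    have l1' : `|t - x| < r by rewrite (le_lt_trans l1).
    have [] := Hr t y1 l1'.
      by rewrite ltr_norml; apply/andP; split; lra.
    have [] := Hr t y2 l1'.
      by rewrite ltr_norml; apply/andP; split; lra.
    rewrite (@ler0_norm _ (y1 - y)) ?(@ger0_norm _ (y2 - y)); try lra.
    move=> H2 _ H1 _.
    have b1 : e / 2 * (`|t - x| + (y2 - y)) + e / 2 * (`|t - x| + - (y1 - y)) <=
        e * (x2 - x1 + (y2 - y1)).
      have : e / 2 * (`|t - x| + `|t - x| + (y2 - y1)) <= e / 2 * (2 * (x2 - x1 + (y2 - y1))).
        by rewrite ler_pM2l //; lra.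
      lra.
    apply: le_trans b1.
    have -> : P t y1 - P t y2 - be * (y1 - y2) =
      - (P t y2 - P x y - (al * (t - x) + be * (y2 - y))) +
      (P t y1 - P x y - (al * (t - x) + be * (y1 - y))) by ring.
    by rewrite (le_trans (ler_normD _ _)) // normrN lerD.
  + move=> t t12; have [t1 t2] := andP t12.
    have l1 : `|t - y| <= y2 - y1 by rewrite ler_norml; apply/andP; split; lra.
    have l1' : `|t - y| < r by rewrite (le_lt_trans l1).
    have [] := Hr x1 t _ l1'.
      by rewrite ltr_norml; apply/andP; split; lra.
    have [] := Hr x2 t _ l1'.
      by rewrite ltr_norml; apply/andP; split; lra.
    rewrite (@ler0_norm _ (x1 - x)) ?(@ger0_norm _ (x2 - x)); try lra.
    move=> _ H2 _ H1.
    have b1 : e / 2 * (x2 - x + `|t - y|) + e / 2 * (- (x1 - x) + `|t - y|) <=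
        e * (x2 - x1 + (y2 - y1)).
      have : e / 2 * (`|t - y| + `|t - y| + (x2 - x1)) <= e / 2 * (2 * (x2 - x1 + (y2 - y1))).
        by rewrite ler_pM2l //; lra.
      lra.
    apply: le_trans b1.
    have -> : Q x2 t - Q x1 t - be * (x2 - x1) =
      (Q x2 t - Q x y - (be * (x2 - x) + ga * (t - y))) +
      - (Q x1 t - Q x y - (be * (x1 - x) + ga * (t - y))) by ring.
    by rewrite (le_trans (ler_normD _ _)) // normrN lerD.
Qed.

End rectangle.

(** Cutting out a square of half side s around the exceptional point leaves four rectangles with
    zero circulation. On the square P and Q are bounded by M, so its contribution is at most 2 M (4
    s), which tends to 0 with s. *)
Lemma goursat_exception (A B C D px py : R) : A < px < B -> C < py < D ->
  (forall x y, A <= x <= B -> C <= y <= D -> cont_at P x y) ->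
  (forall x y, A <= x <= B -> C <= y <= D -> cont_at Q x y) ->
  (forall x y, A <= x <= B -> C <= y <= D -> (x, y) <> (px, py) -> closed_at x y) ->
  contour A B C D = 0.
Proof.
move=> /andP[Ap pB] /andP[Cp pD] cP cQ cl; apply/eqP; rewrite -normr_le0.
have pAB : A <= px <= B by rewrite !ltW.
have pCD : C <= py <= D by rewrite !ltW.
have [r1 r10 HP] := cP px py pAB pCD 1 ltr01.
have [r2 r20 HQ] := cQ px py pAB pCD 1 ltr01.
pose M := `|P px py| + `|Q px py| + 1.
have M0 : 0 < M by rewrite ltr_wpDl // addr_ge0.
pose s0 := Num.min (Num.min r1 r2) (Num.min (Num.min (px - A) (B - px)) (Num.min (py - C) (D - py))).
have s00 : 0 < s0 by rewrite !lt_min r10 r20 !subr_gt0 Ap pB Cp.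
suff H s : 0 < s -> s < s0 -> `|contour A B C D| <= 2 * M * (4 * s).
  rewrite leNgt; apply/negP => c0; set c := `|_| in c0 H.
  have M16 : 0 < 16 * M by rewrite mulr_gt0.
  pose s := Num.min (s0 / 2) (c / (16 * M)).
  have s_gt0 : 0 < s by rewrite lt_min !divr_gt0.
  have ss0 : s < s0 by rewrite gt_min; apply/orP; left; lra.
  have := H s s_gt0 ss0; apply/negP; rewrite -ltNge.
  have : s <= c / (16 * M) by rewrite ge_min lexx orbT.
  rewrite ler_pdivlMr //; lra.
move=> s_gt0; rewrite !lt_min => /andP[/andP[sr1 sr2] /andP[/andP[sA sB] /andP[sC sD]]].
have sub0 (A' B' C' D' : R) : A <= A' -> A' <= B' -> B' <= B -> C <= C' -> C' <= D' ->
    D' <= D -> ~ (A' <= px <= B' /\ C' <= py <= D') -> contour A' B' C' D' = 0.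
  move=> h1 h2 h3 h4 h5 h6 np; apply: goursat => //.
  - by move=> x y /andP[x1 x2] /andP[y1 y2]; apply: cP; apply/andP; split; clear - h1 h2 h3 h4 h5 h6 x1 x2 y1 y2; lra.
  - by move=> x y /andP[x1 x2] /andP[y1 y2]; apply: cQ; apply/andP; split; clear - h1 h2 h3 h4 h5 h6 x1 x2 y1 y2; lra.
  - move=> x y hx hy; have [x1 x2] := andP hx; have [y1 y2] := andP hy.
    apply: cl; try (apply/andP; split; clear - h1 h2 h3 h4 h5 h6 x1 x2 y1 y2; lra).
    by case=> ex ey; apply: np; rewrite -ex -ey.
have splx := @contour_splitx A B C D cP.
have sply := @contour_splity A B C D cQ.
rewrite (sply A B C (py - s) D) //; try (clear - Ap pB Cp pD s_gt0 sA sB sC sD; lra).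
rewrite (sply A B (py - s) (py + s) D) //; try (clear - Ap pB Cp pD s_gt0 sA sB sC sD; lra).
rewrite (splx A (px - s) B (py - s) (py + s)) //; try (clear - Ap pB Cp pD s_gt0 sA sB sC sD; lra).
rewrite (splx (px - s) (px + s) B (py - s) (py + s)) //; try (clear - Ap pB Cp pD s_gt0 sA sB sC sD; lra).
have -> : contour A B C (py - s) = 0.
  by apply: sub0; try (clear - Ap pB Cp pD s_gt0 sA sB sC sD; lra); case=> _ /andP[h1 h2]; clear - h1 h2 s_gt0; lra.
have -> : contour A B (py + s) D = 0.
  by apply: sub0; try (clear - Ap pB Cp pD s_gt0 sA sB sC sD; lra); case=> _ /andP[h1 h2]; clear - h1 h2 s_gt0; lra.
have -> : contour A (px - s) (py - s) (py + s) = 0.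
  by apply: sub0; try (clear - Ap pB Cp pD s_gt0 sA sB sC sD; lra); case=> /andP[h1 h2]; clear - h1 h2 s_gt0; lra.
have -> : contour (px + s) B (py - s) (py + s) = 0.
  by apply: sub0; try (clear - Ap pB Cp pD s_gt0 sA sB sC sD; lra); case=> /andP[h1 h2]; clear - h1 h2 s_gt0; lra.
rewrite !add0r !addr0.
have near_ t v : v - s <= t <= v + s -> `|t - v| <= s.
  by move=> /andP[t1 t2]; rewrite ler_norml; apply/andP; split; clear - t1 t2; lra.
have -> : 4 * s = (px + s - (px - s) + (py + s - (py - s))) by ring.
apply: (contour_bound cP cQ (be := 0)) => //; try (clear - Ap pB Cp pD s_gt0 sA sB sC sD; lra).
- move=> x hx; rewrite mul0r subr0.
  have xs := near_ _ _ hx.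
  have b y : `|y - py| <= s -> `|P x y| <= M.
    move=> ys; have := HP x y (le_lt_trans xs sr1) (le_lt_trans ys sr1).
    have := ler_normD (P x y - P px py) (P px py); rewrite subrK /M.
    have := normr_ge0 (Q px py); lra.
  rewrite (le_trans (ler_normB _ _)) // mulrDl mul1r.
  by apply: lerD; apply: b; apply: near_; apply/andP; split; clear - s_gt0; lra.
- move=> y hy; rewrite mul0r subr0.
  have ys := near_ _ _ hy.
  have b x : `|x - px| <= s -> `|Q x y| <= M.
    move=> xs; have := HQ x y (le_lt_trans xs sr2) (le_lt_trans ys sr2).
    have := ler_normD (Q x y - Q px py) (Q px py); rewrite subrK /M.
    have := normr_ge0 (P px py); lra.
  rewrite (le_trans (ler_normB _ _)) // mulrDl mul1r.
  by apply: lerD; apply: b; apply: near_; apply/andP; split; clear - s_gt0; lra.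
Qed.

End goursat.

(** * Complex differentiability *)

(** The order of R[i] is only partial, but positive elements are real and hence comparable. *)
Lemma min_pos {K : numDomainType} (r s : K) : 0 < r -> 0 < s ->
  exists t, [/\ 0 < t, t <= r & t <= s].
Proof.
move=> r0 s0; have : r >=< s by rewrite real_comparable ?gtr0_real.
by move=> /comparable_leP[rs|sr]; [exists r|exists s; split => //; exact: ltW].
Qed.

Section caratheodory.
Context {K : numFieldType}.
Implicit Types (F G phi : K -> K) (z c : K).

Definition hol_at F z := exists c, forall e, 0 < e -> exists2 r, 0 < r &
  forall z', `|z' - z| < r -> `|F z' - F z - c * (z' - z)| <= e * `|z' - z|.

Definition cont_pt phi z := phi x @[x --> z] --> phi z.

(* Differentiability in the form of Caratheodory: sums, products and
   compositions then only require continuity of the slopes. *)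
Definition slope_at F z := exists2 phi : K -> K, cont_pt phi z &
  exists2 r, 0 < r & forall z', `|z' - z| < r -> F z' - F z = phi z' * (z' - z).

Lemma near_normP z (P : K -> Prop) :
  (\forall z' \near z, P z') <-> exists2 r, 0 < r & forall z', `|z' - z| < r -> P z'.
Proof.
split=> [/nbhs_normP[r r0 H]|[r r0 H]].
  by exists r => // z' z'r; apply: H; rewrite /= distrC.
by apply/nbhs_normP; exists r => // z' /= z'r; apply: H; rewrite distrC.
Qed.

Lemma cont_ptP phi z : cont_pt phi z <-> forall e, 0 < e -> exists2 r, 0 < r &
  forall z', `|z' - z| < r -> `|phi z' - phi z| <= e.
Proof.
split=> [/cvgrPdist_le H e e0|H].
  have /near_normP[r r0 Hr] := H e e0.
  by exists r => // z' /Hr; rewrite distrC.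
apply/(@cvgrPdist_le _ _ _ (nbhs z) _ phi (phi z)) => e e0; apply/near_normP; have [r r0 Hr] := H e e0.
by exists r => // z' /Hr; rewrite distrC.
Qed.

Lemma cont_pt_near phi psi z : (exists2 r, 0 < r & forall z', `|z' - z| < r -> phi z' = psi z') ->
  cont_pt phi z -> cont_pt psi z.
Proof.
move=> [r r0 Hr] /cont_ptP H; apply/cont_ptP => e e0.
have [r1 r10 Hr1] := H e e0.
have [r2 [r20 r2r r2r1]] := min_pos r0 r10.
exists r2 => // z' z'r; rewrite -!Hr ?subrr ?normr0 //.
  by apply: Hr1; apply: lt_le_trans r2r1.
exact: lt_le_trans r2r.
Qed.

Lemma slope_hol F z : slope_at F z <-> hol_at F z.
Proof.
split=> [[phi /cont_ptP cphi [r r0 H]]|[c H]].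
  exists (phi z) => e e0; have [r1 r10 Hr1] := cphi e e0.
  have [r2 [r20 r2r r2r1]] := min_pos r0 r10.
  exists r2 => // z' zr; have zr' := lt_le_trans zr r2r.
  rewrite H // -mulrBl normrM ler_wpM2r //; apply: Hr1.
  exact: lt_le_trans zr r2r1.
exists (fun z' => if z' == z then c else (F z' - F z) / (z' - z)); last first.
  exists 1 => // z' _; case: eqVneq => [->|zz']; first by rewrite !subrr mulr0.
  by rewrite mulfVK // subr_eq0.
apply/cont_ptP => e e0.
have [r r0 Hr] := H e e0; exists r => // z' /Hr; rewrite eqxx.
case: eqVneq => [_ _|zz' le]; first by rewrite subrr normr0 ltW.
have nz : z' - z != 0 by rewrite subr_eq0.
have n0 : 0 < `|z' - z| by rewrite normr_gt0.
by rewrite -(ler_pM2r n0) -normrM mulrBl mulfVK.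
Qed.

Lemma cont_cst c z : cont_pt (fun=> c) z.
Proof. by apply/cont_ptP => e e0; exists 1 => // z' _; rewrite subrr normr0 ltW. Qed.

Lemma cont_id z : cont_pt id z.
Proof. by apply/cont_ptP => e e0; exists e => // z' h; exact: ltW. Qed.

Lemma contD F G z : cont_pt F z -> cont_pt G z -> cont_pt (fun x => F x + G x) z.
Proof. by move=> h1 h2; apply: (@cvgD _ _ _ _ _ F G _ _ h1 h2). Qed.

Lemma contN F z : cont_pt F z -> cont_pt (fun x => - F x) z.
Proof. by move=> h; apply: (@cvgN _ _ _ _ _ F _ h). Qed.

Lemma contM F G z : cont_pt F z -> cont_pt G z -> cont_pt (fun x => F x * G x) z.
Proof. by move=> h1 h2; apply: (@cvgM _ _ _ _ F G _ _ h1 h2). Qed.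

Lemma contV F z : cont_pt F z -> F z != 0 -> cont_pt (fun x => (F x)^-1) z.
Proof. by move=> cF F0; apply: (@cvgV _ _ _ _ F _ F0 cF). Qed.

Lemma cont_comp F G z : cont_pt F z -> cont_pt G (F z) -> cont_pt (G \o F) z.
Proof. by move=> cF cG; exact: (cvg_comp _ _ cF cG). Qed.

Lemma slope_cont F z : slope_at F z -> cont_pt F z.
Proof.
move=> [phi cphi [r r0 H]].
apply: (@cont_pt_near (fun z' => F z + phi z' * (z' - z))).
  by exists r => // z' z'r; rewrite -H // subrKC.
apply: contD; first exact: cont_cst.
by apply: contM => //; apply: contD; [exact: cont_id|exact: cont_cst].
Qed.

Lemma slope_cst c z : slope_at (fun=> c) z.
Proof.
exists (fun=> 0); first exact: cont_cst.
by exists 1 => // z' _; rewrite mul0r subrr.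
Qed.

Lemma slope_id z : slope_at id z.
Proof.
exists (fun=> 1); first exact: cont_cst.
by exists 1 => // z' _; rewrite mul1r.
Qed.

Lemma slopeD F G z : slope_at F z -> slope_at G z -> slope_at (fun x => F x + G x) z.
Proof.
move=> [f cf [r r0 Hf]] [g cg [r1 r10 Hg]]; exists (fun x => f x + g x); first exact: contD.
have [r2 [r20 r2r r2r1]] := min_pos r0 r10.
exists r2 => // z' zr; rewrite mulrDl -Hf ?(lt_le_trans zr) // -Hg ?(lt_le_trans zr) //.
by rewrite opprD addrACA.
Qed.

Lemma slopeM F G z : slope_at F z -> slope_at G z -> slope_at (fun x => F x * G x) z.
Proof.
move=> sF sG; have cG := slope_cont sG.
move: sF sG => [f cf [r r0 Hf]] [g cg [r1 r10 Hg]].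
exists (fun x => f x * G x + F z * g x).
  by apply: contD; apply: contM => //; exact: cont_cst.
have [r2 [r20 r2r r2r1]] := min_pos r0 r10.
exists r2 => // z' zr; rewrite mulrDl mulrAC -[F z * g z' * _]mulrA.
by rewrite -Hf ?(lt_le_trans zr) // -Hg ?(lt_le_trans zr) //; ring.
Qed.

Lemma slopeV F z : slope_at F z -> F z != 0 -> slope_at (fun x => (F x)^-1) z.
Proof.
move=> sF Fz0; have cF := slope_cont sF; move: sF => [f cf [r r0 Hf]].
exists (fun x => - f x * (F x * F z)^-1).
  apply: contM; first exact: contN.
  by apply: contV; [apply: contM => //; exact: cont_cst|rewrite mulf_neq0].
have n0 : 0 < `|F z| by rewrite normr_gt0.
have n20 : 0 < `|F z| / 2 by rewrite divr_gt0.
have /cont_ptP/(_ _ n20)[r1 r10 Hr1] := cF.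
have nz z' : `|z' - z| < r1 -> F z' != 0.
  move=> /Hr1; apply: contraTneq => ->.
  by rewrite sub0r normrN ler_pdivlMr // ger_pMr // lern1.
have [r2 [r20 r2r r2r1]] := min_pos r0 r10.
exists r2 => // z' zr; have z'0 : F z' != 0 by apply: nz; exact: lt_le_trans r2r1.
rewrite mulrAC mulNr -Hf ?(lt_le_trans zr) //; field; by rewrite z'0 Fz0.
Qed.

Lemma slope_comp F G z : slope_at F z -> slope_at G (F z) -> slope_at (G \o F) z.
Proof.
move=> sF; have cF := slope_cont sF; move: sF => [f cf [r r0 Hf]] [g cg [r1 r10 Hg]].
exists (fun x => g (F x) * f x).
  by apply: contM => //; exact: (cont_comp cF cg).
have r120 : 0 < r1 / 2 by rewrite divr_gt0.
have /cont_ptP/(_ _ r120)[r2 r20 Hr2] := cF.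
have [r3 [r30 r3r r3r2]] := min_pos r0 r20.
exists r3 => // z' zr; rewrite -mulrA -Hf ?(lt_le_trans zr) // Hg //.
apply: le_lt_trans (Hr2 z' (lt_le_trans zr r3r2)) _.
by rewrite ltr_pdivrMr // ltr_pMr // ltr1n.
Qed.

Lemma slope_near F G z : (exists2 r, 0 < r & forall z', `|z' - z| < r -> F z' = G z') ->
  slope_at F z -> slope_at G z.
Proof.
move=> [r r0 Hr] [f cf [r1 r10 Hf]]; exists f => //.
have [r2 [r20 r2r r2r1]] := min_pos r0 r10.
exists r2 => // z' zr; rewrite -!Hr ?subrr ?normr0 ?(lt_le_trans zr) //.
by rewrite Hf ?(lt_le_trans zr).
Qed.

End caratheodory.

Section real_derivative.
Local Open Scope complex_scope.
Context {R : realType}.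

Lemma is_derive0_bound (f : R -> R) (d : R) : is_derive (0 : R) (1 : R) f d ->
  forall e : R, 0 < e -> exists2 r : R, 0 < r &
    forall x, `|x| < r -> `|f x - f 0 - d * x| <= e * `|x|.
Proof.
move=> [df fd] e e0; move: df; rewrite /derivable => /cvg_ex[l lP].
have ld : l = d by rewrite -fd /derive; symmetry; apply: cvg_lim lP.
rewrite {}ld in lP; move/cvgrPdist_le: lP => /(_ e e0).
rewrite near_withinE => /nbhs_normP[r r0 Hr]; exists r => // x xr.
have [->|x0] := eqVneq x 0; first by rewrite subrr mulr0 subr0 normr0 mulr0.
have := Hr x; rewrite /= sub0r normrN => /(_ xr x0).
rewrite addr0 scaler1 -[_ *: _]/(x^-1 * _) distrC.
have nx : 0 < `|x| by rewrite normr_gt0.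
rewrite -(ler_pM2r nx) -normrM mulrBl mulrAC mulVf // mul1r.
by [].
Qed.

End real_derivative.

(** * The complex exponential *)

Section complex_exponential.
Local Open Scope complex_scope.
Context {R : realType}.
Local Notation C := R[i].
Local Notation normc := (@Normc.normc R).
Implicit Types (z u : C) (x y : R).

Lemma normc_le x y : normc (x +i* y) <= `|x| + `|y|.
Proof.
rewrite /= -[leRHS]ger0_norm ?addr_ge0 // -sqrtr_sqr ler_wsqrtr // sqrrD.
rewrite !real_normK ?num_real // lerD2r lerDl.
by rewrite mulrn_wge0 // mulr_ge0.
Qed.

Lemma normc_ge0 z : 0 <= normc z.
Proof. by case: z => a b; exact: sqrtr_ge0. Qed.

Lemma Re_le_normc z : `|complex.Re z| <= normc z.
Proof. by have := normc_ge_Re z; rewrite lecR. Qed.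

Lemma Im_le_normc z : `|complex.Im z| <= normc z.
Proof.
case: z => a b /=; rewrite -sqrtr_sqr ler_wsqrtr // lerDr.
exact: sqr_ge0.
Qed.

Lemma posc (r : C) : 0 < r -> exists2 s : R, 0 < s & r = s%:C.
Proof.
case: r => a b; rewrite ltcE /= => /andP[/eqP b0 a0]; exists a => //.
by rewrite b0.
Qed.

Lemma cont_ptC (phi : C -> C) z : cont_pt phi z <->
  forall e : R, 0 < e -> exists2 r : R, 0 < r &
    forall z', normc (z' - z) < r -> normc (phi z' - phi z) <= e.
Proof.
split=> [/cont_ptP H e e0|H].
  have e0' : 0 < e%:C by rewrite ltcR.
  have [r /posc[s s0 ->] Hr] := H _ e0'; exists s => // z' z's.
  by have := Hr z'; rewrite ltcR lecR; apply.
apply/cont_ptP => e /posc[s s0 ->]; have [r r0 Hr] := H s s0.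
exists r%:C; first by rewrite ltcR.
by move=> z'; rewrite ltcR lecR; exact: Hr.
Qed.

Lemma hol_atC (F : C -> C) z : hol_at F z <->
  exists c : C, forall e : R, 0 < e -> exists2 r : R, 0 < r &
    forall z', normc (z' - z) < r ->
      normc (F z' - F z - c * (z' - z)) <= e * normc (z' - z).
Proof.
split=> [[c H]|[c H]]; exists c.
  move=> e e0; have e0' : 0 < e%:C by rewrite ltcR.
  have [r /posc[s s0 ->] Hr] := H _ e0'; exists s => // z' z's.
  have := Hr z'; rewrite ltcR => /(_ z's).
  by rewrite -[e%:C * _]rmorphM lecR.
move=> e /posc[s s0 ->]; have [r r0 Hr] := H s s0.
exists r%:C; first by rewrite ltcR.
by move=> z'; rewrite ltcR => /Hr; rewrite -[s%:C * _]rmorphM lecR.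
Qed.

Lemma Re_cont_at (F : C -> C) x y : cont_pt F (x +i* y) ->
  cont_at (fun x y => complex.Re (F (x +i* y))) x y.
Proof.
move=> /cont_ptC H e e0; have [r r0 Hr] := H e e0.
exists (r / 2); first by rewrite divr_gt0.
move=> x' y' xr yr; have := Hr (x' +i* y').
have -> : normc (x' +i* y' - (x +i* y)) < r.
  by apply: le_lt_trans (normc_le _ _) _; lra.
move=> /(_ isT); apply: le_trans; apply: le_trans (Re_le_normc _).
by case: (F _) => a b; case: (F _) => a' b'.
Qed.

Lemma Im_cont_at (F : C -> C) x y : cont_pt F (x +i* y) ->
  cont_at (fun x y => - complex.Im (F (x +i* y))) x y.
Proof.
move=> /cont_ptC H e e0; have [r r0 Hr] := H e e0.
exists (r / 2); first by rewrite divr_gt0.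
move=> x' y' xr yr; have := Hr (x' +i* y').
have -> : normc (x' +i* y' - (x +i* y)) < r.
  by apply: le_lt_trans (normc_le _ _) _; lra.
move=> /(_ isT); apply: le_trans; apply: le_trans (Im_le_normc _).
by case: (F _) => a b; case: (F _) => a' b' /=; rewrite -opprD normrN.
Qed.

(** The real part of F dz is Re F dx - Im F dy. If a + i b is the derivative, the Cauchy-Riemann
    equations give both cross derivatives the value - b, which makes the form closed. *)
Lemma slope_closed_at (F : C -> C) x y : slope_at F (x +i* y) ->
  closed_at (fun x y => complex.Re (F (x +i* y)))
            (fun x y => - complex.Im (F (x +i* y))) x y.
Proof.
move=> /slope_hol/hol_atC[[a b] H]; exists a, (- b), (- a) => e e0.
have [r r0 Hr] := H e e0; exists (r / 2); first by rewrite divr_gt0.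
move=> x' y' xr yr; have := Hr (x' +i* y').
have n1 : normc (x' +i* y' - (x +i* y)) <= `|x' - x| + `|y' - y| by exact: normc_le.
have -> : normc (x' +i* y' - (x +i* y)) < r by apply: le_lt_trans n1 _; lra.
move=> /(_ isT) H1.
have {}H1 := le_trans H1 (ler_wpM2l (ltW e0) n1).
split.
  apply: le_trans H1; apply: le_trans (Re_le_normc _).
  by case: (F _) => p q; case: (F _) => p' q' /=; rewrite mulNr.
apply: le_trans H1; apply: le_trans (Im_le_normc _).
case: (F _) => p q; case: (F _) => p' q' /=.
by rewrite -normrN le_eqVlt; apply/orP; left; apply/eqP; congr (`|_|); ring.
Qed.

(** This is exp (i z). *)
Definition cis z : C := let: x +i* y := z in
  (expR (- y) * cos x) +i* (expR (- y) * sin x).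

Lemma cisD z u : cis (z + u) = cis z * cis u.
Proof.
case: z => a b; case: u => c d; apply/eqP; rewrite eq_complex /=.
by rewrite opprD expRD cosD sinD; apply/andP; split; apply/eqP; ring.
Qed.

Lemma cis0 : cis 0 = 1.
Proof. by apply/eqP; rewrite eq_complex /= oppr0 expR0 cos0 sin0 !mul1r !eqxx. Qed.

Lemma normc_cis x y : normc (cis (x +i* y)) = expR (- y).
Proof.
by rewrite /= !exprMn -mulrDr cos2Dsin2 mulr1 sqrtr_sqr ger0_norm ?expR_ge0.
Qed.

Lemma cis_neq0 z : cis z != 0.
Proof.
case: z => x y; apply/eqP => /(congr1 normc); rewrite normc_cis Normc.normc0.
by apply/eqP; rewrite gt_eqF // expR_gt0.
Qed.

(** The real derivatives of exp, cos and sin at 0 suffice; the addition formula then transports the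
    derivative to every other point. *)
Lemma hol_cis0 (e : R) : 0 < e -> exists2 r : R, 0 < r &
  forall u, normc u < r -> normc (cis u - 1 - 'i * u) <= e * normc u.
Proof.
move=> e0; have e80 : 0 < e / 8 by rewrite divr_gt0.
have [r1 r10 H1] := is_derive0_bound (is_derive_expR 0) e80.
have [r2 r20 H2] := is_derive0_bound (is_derive_cos 0) e80.
have [r3 r30 H3] := is_derive0_bound (is_derive_sin 0) e80.
have e1 : 0 < 1 :> R by [].
have [r4 r40 H4] := is_derive0_bound (is_derive_expR 0) e1.
pose r := Num.min (Num.min r1 r2) (Num.min (Num.min r3 r4) (Num.min 1 (e / 8))).
exists (r / 2); first by rewrite divr_gt0 // /r !lt_min r10 r20 r30 r40 e80 ltr01.
case=> x y ur; set n := normc _ in ur *.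
have nx : `|x| <= n by exact: (Re_le_normc (x +i* y)).
have ny : `|y| <= n by exact: (Im_le_normc (x +i* y)).
have n0 : 0 <= n by exact: normc_ge0.
have : r <= r by []; rewrite {2}/r !le_min => /andP[/andP[h1 h2] /andP[/andP[h3 h4] /andP[h5 h6]]].
have := H1 (- y); have := H2 x; have := H3 x; have := H4 (- y).
rewrite !normrN expR0 cos0 sin0 !oppr0 !mul0r !mul1r !subr0 addr0.
have -> : `|x| < r2 by lra.
have -> : `|x| < r3 by lra.
have -> : `|y| < r1 by lra.
have -> : `|y| < r4 by lra.
move=> /(_ isT) k4 /(_ isT) k3 /(_ isT) k2 /(_ isT) k1.
set E := expR (- y) in k1 k4 *.
have E2 : `|E - 1| <= 2 * n.
  have -> : E - 1 = (E - 1 - - y) + - y by ring.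
  rewrite (le_trans (ler_normD _ _)) // normrN.
  lra.
have E0 : 0 <= E by exact: expR_ge0.
have E3 : E <= 2.
  have := ler_norm (E - 1); lra.
have -> : cis (x +i* y) - 1 - 'i * (x +i* y) =
    (E - 1 - - y + E * (cos x - 1)) +i* (E * (sin x - x) + (E - 1) * x).
  by apply/eqP; rewrite eq_complex /= -/E; apply/andP; split; apply/eqP; ring.
apply: le_trans (normc_le _ _) _.
have b1 : `|E * (cos x - 1)| <= 2 * (e / 8 * n).
  rewrite normrM ger0_norm // ler_pM //.
  by apply: (le_trans k2); rewrite ler_wpM2l // ltW.
have b2 : `|E * (sin x - x)| <= 2 * (e / 8 * n).
  rewrite normrM ger0_norm // ler_pM //.
  by apply: (le_trans k3); rewrite ler_wpM2l // ltW.
have b3 : `|(E - 1) * x| <= 2 * n * (e / 8 / 2).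
  rewrite normrM ler_pM //.
  lra.
have b4 : `|E - 1 - - y| <= e / 8 * n.
  by apply: (le_trans k1); rewrite ler_wpM2l // ltW.
have := ler_normD (E - 1 - - y) (E * (cos x - 1)).
have := ler_normD (E * (sin x - x)) ((E - 1) * x).
have : 0 <= e * n by rewrite mulr_ge0 // ltW.
lra.
Qed.

Lemma slope_cis z : slope_at cis z.
Proof.
apply/slope_hol/hol_atC; exists (cis z * 'i) => e e0.
have nz : 0 < normc (cis z).
  by case: z => x y; rewrite normc_cis expR_gt0.
have [r r0 Hr] := hol_cis0 (divr_gt0 e0 nz).
exists r => // z' /Hr; set u := z' - z.
have -> : z' = z + u by rewrite /u subrKC.
rewrite cisD => H.
have -> : cis z * cis u - cis z - cis z * 'i * u = cis z * (cis u - 1 - 'i * u) by ring.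
rewrite Normc.normcM mulrC -ler_pdivlMr //.
by rewrite mulrAC.
Qed.

End complex_exponential.

Ltac complex_ring := apply/eqP; rewrite eq_complex /=; apply/andP; split; apply/eqP; ring.

(** * The Dirichlet kernel *)

Section dirichlet.
Local Open Scope complex_scope.
Context {R : realType}.
Local Notation C := R[i].
Local Notation normc := (@Normc.normc R).
Implicit Types (z u : C) (x y : R) (n p : nat).

(** The Dirichlet kernel, that is the sum of exp (i k u) over - p <= k <= p. *)
Fixpoint dirichlet p u : C :=
  if p is p'.+1 then dirichlet p' u + (cis (p%:R * u) + cis (- (p%:R * u))) else 1.

(** The sum is geometric. The closed form separates the frequency p + 1, to be estimated in the
    upper half plane, from the frequency - p, to be estimated in the lower one. *)
Lemma dirichletE p u :
  (cis u - 1) * dirichlet p u = cis (p.+1%:R * u) - cis (- (p%:R * u)).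
Proof.
elim: p => [|p IH]; first by rewrite /= mulr1 mul1r mul0r oppr0 cis0.
rewrite [dirichlet _ _]/= mulrDr IH.
have -> : p.+2%:R * u = u + p.+1%:R * u by rewrite -[p.+2%:R]natr1; ring.
have -> : - (p%:R * u) = u + - (p.+1%:R * u) by rewrite -[p.+1%:R]natr1; ring.
rewrite !cisD; ring.
Qed.

Fixpoint dirichletR p x : R :=
  if p is p'.+1 then dirichletR p' x + 2 * cos (p%:R * x) else 1.

Lemma cis_real x : cis x%:C = (cos x) +i* (sin x).
Proof. by rewrite /= oppr0 expR0 !mul1r. Qed.

Lemma natrC n : n%:R = n%:R%:C :> C.
Proof. by rewrite rmorph_nat. Qed.

Lemma dirichlet_real p x : dirichlet p x%:C = (dirichletR p x)%:C.
Proof.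
elim: p => [//|p IH]; rewrite [LHS]/= IH natrC -rmorphM -rmorphN !cis_real cosN sinN.
by complex_ring.
Qed.

Lemma cis_scale_normc n x y : normc (cis (n%:R * (x +i* y))) = expR (- (n%:R * y)).
Proof.
have -> : n%:R * (x +i* y) = (n%:R * x) +i* (n%:R * y) :> C.
  by rewrite natrC; complex_ring.
exact: normc_cis.
Qed.

Lemma cis_scaleN_normc n x y : normc (cis (- (n%:R * (x +i* y)))) = expR (n%:R * y).
Proof.
have -> : - (n%:R * (x +i* y)) = (- (n%:R * x)) +i* (- (n%:R * y)) :> C.
  by rewrite natrC; complex_ring.
by rewrite normc_cis opprK.
Qed.

Lemma cis2pi n : cis (n%:R * (pi *+ 2)%:C) = 1 :> C.
Proof.
rewrite natrC -rmorphM cis_real.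
elim: n => [|n IH]; first by rewrite mul0r cos0 sin0.
rewrite -natr1 mulrDl mul1r.
by rewrite (cosD (n%:R * (pi *+ 2))) (sinD (n%:R * (pi *+ 2))) cos2pi sin2pi !mulr1 !mulr0 subr0 addr0.
Qed.

Lemma cis_period n u : cis (n%:R * (u + (pi *+ 2)%:C)) = cis (n%:R * u).
Proof. by rewrite mulrDr cisD cis2pi mulr1. Qed.

Lemma cis_periodN n u : cis (- (n%:R * (u + (pi *+ 2)%:C))) = cis (- (n%:R * u)).
Proof.
apply: (mulfI (cis_neq0 (n%:R * (u + (pi *+ 2)%:C)))).
by rewrite -cisD subrr cis_period -cisD subrr.
Qed.

Lemma dirichlet_period p u : dirichlet p (u + (pi *+ 2)%:C) = dirichlet p u.
Proof. by elim: p => // p IH; rewrite /= IH cis_period cis_periodN. Qed.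

Lemma cis_eq1 x y : - (pi *+ 2) < x < pi *+ 2 -> cis (x +i* y) = 1 -> x = 0 /\ y = 0.
Proof.
move=> xpi cis1; have := normc_cis x y; rewrite cis1 Normc.normc1 => e1.
have y0 : y = 0.
  by apply: oppr_inj; rewrite oppr0; apply: expR_inj; rewrite -e1 expR0.
split=> //; move: cis1; rewrite y0 cis_real => -[c1 s1].
move: c1; have -> : x = x / 2 + x / 2 by field.
rewrite cosD => c1; have := cos2Dsin2 (x / 2) => cs.
have s0 : sin (x / 2) = 0.
  by apply/eqP; rewrite -sqrf_eq0; apply/eqP; rewrite expr2; lra.
have [x0|x0|//] := ltrgt0P x.
- have /lt0r_neq0 : 0 < sin (x / 2).
    apply: sin_gt0_pi; move/andP: xpi => [_ x2]; rewrite divr_gt0 //=.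
    by rewrite ltr_pdivrMr // mulr_natr.
  by rewrite s0 eqxx.
- have /lt0r_neq0 : 0 < sin (- (x / 2)).
    apply: sin_gt0_pi; move/andP: xpi => [x2 _].
    rewrite -mulNr divr_gt0 ?oppr_gt0 //=.
    by rewrite ltr_pdivrMr // mulr_natr; lra.
  by rewrite sinN s0 oppr0 eqxx.
- by lra.
Qed.

Lemma slope_scale c z : slope_at (fun z => c * z) z.
Proof. by apply: slopeM; [exact: slope_cst|exact: slope_id]. Qed.

Lemma slopeN (F : C -> C) z : slope_at F z -> slope_at (fun z => - F z) z.
Proof.
move=> sF; have := slopeM (slope_cst (-1) z) sF.
by congr slope_at; apply/funext => w; rewrite mulN1r.
Qed.

Lemma slope_cis_comp (F : C -> C) z : slope_at F z -> slope_at (fun z => cis (F z)) z.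
Proof. by move=> sF; apply: (slope_comp sF); exact: slope_cis. Qed.

Lemma slope_dirichlet p z : slope_at (dirichlet p) z.
Proof.
elim: p => [|p IH]; first exact: slope_cst.
apply: slopeD => //; apply: slopeD; apply: slope_cis_comp.
  exact: slope_scale.
by apply: slopeN; exact: slope_scale.
Qed.

Lemma slope_shift (F : C -> C) c z : slope_at F (z - c) -> slope_at (fun z => F (z - c)) z.
Proof.
move=> sF; apply: (@slope_comp _ (fun z => z - c) F) => //.
by apply: slopeD; [exact: slope_id|exact: slope_cst].
Qed.

(* By periodicity, the two vertical sides of the contour cancel. *)
Lemma period_shift (F : C -> C) (A c d : R) : c <= d ->
  (forall x y, c <= y <= d -> F ((A + pi *+ 2) +i* y) = F (A +i* y)) ->
  contour (fun x y => complex.Re (F (x +i* y))) (fun x y => - complex.Im (F (x +i* y)))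
    A (A + pi *+ 2) c d = 0 ->
  segint A (A + pi *+ 2) (fun x => complex.Re (F (x +i* c))) =
  segint A (A + pi *+ 2) (fun x => complex.Re (F (x +i* d))).
Proof.
move=> cd per; rewrite /contour.
have -> : segint c d (fun y => - complex.Im (F ((A + pi *+ 2) +i* y))) =
          segint c d (fun y => - complex.Im (F (A +i* y))).
  by apply: eq_Rintegral => y; rewrite inE /= in_itv /= => ycd; rewrite per.
by rewrite subrr addr0 => /eqP; rewrite subr_eq0 => /eqP.
Qed.

Lemma segint_le (a b : R) (f : R -> R) (e : R) : a <= b ->
  {within `[a, b], continuous f} -> (forall x, a <= x <= b -> `|f x| <= e) ->
  `|segint a b f| <= e * (b - a).
Proof.
move=> ab cf H; have := @segint_bound _ a b f 0 e ab cf.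
by rewrite mul0r subr0; apply => x /H; rewrite subr0.
Qed.

Lemma twopi_gt0 : 0 < pi *+ 2 :> R.
Proof. by rewrite pmulrn_lgt0 // pi_gt0. Qed.

(** By periodicity the segment may be lifted to any height Y, where the integrand is at most exp (-
    n Y); letting Y grow leaves 0. *)
Lemma segint_cos n (x1 : R) : (0 < n)%N ->
  segint (- pi) (- pi + pi *+ 2) (fun x => cos (n%:R * (x - x1))) = 0.
Proof.
move=> n0; set B := - pi + pi *+ 2; set c := segint _ _ _.
have AB : - pi <= B by rewrite /B lerDl ltW // twopi_gt0.
pose F z : C := cis (n%:R * (z - x1%:C)).
have sF z : slope_at F z.
  apply: (@slope_shift (fun u => cis (n%:R * u))).
  by apply: slope_cis_comp; exact: slope_scale.
have cF y : {within `[- pi, B], continuous (fun x => complex.Re (F (x +i* y)))}.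
  apply: (@slicex_cont _ (fun x y => complex.Re (F (x +i* y)))) => x _.
  by apply: Re_cont_at; exact: slope_cont.
have H Y : 0 <= Y -> `|c| <= expR (- (n%:R * Y)) * (pi *+ 2).
  move=> Y0; have -> : c = segint (- pi) B (fun x => complex.Re (F (x +i* Y))).
    rewrite -(@period_shift F (- pi) 0 Y) //.
    - apply: eq_Rintegral => x _; rewrite /F natrC.
      have -> : (x +i* 0 - x1%:C) = (x - x1)%:C by rewrite rmorphB.
      by rewrite -rmorphM cis_real.
    - move=> x y _; rewrite /F -/B.
      have -> : B +i* y - x1%:C = (- pi +i* y - x1%:C) + (pi *+ 2)%:C.
        by rewrite /B; complex_ring.
      by rewrite cis_period.
    - apply: (@goursat _ _ _ _ _ 0 Y) => //.
      + by move=> x y _ _; apply: Re_cont_at; exact: slope_cont.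
      + by move=> x y _ _; apply: Im_cont_at; exact: slope_cont.
      + by move=> x y _ _; exact: slope_closed_at.
  have -> : pi *+ 2 = B - - pi :> R by rewrite /B; ring.
  apply: segint_le => // x _; apply: le_trans (Re_le_normc _) _.
  have -> : F (x +i* Y) = cis (n%:R * ((x - x1) +i* Y)).
    by congr (cis (_ * _)); complex_ring.
  by rewrite cis_scale_normc.
apply/eqP; rewrite -normr_le0 leNgt; apply/negP => c0.
have pi0 : 0 < pi *+ 2 :> R := twopi_gt0.
(* Since 1 + Y <= exp (n Y), this height turns the bound into |c| + 2 pi <= 2 pi. *)
pose Y := pi *+ 2 / `|c|.
have Y0 : 0 <= Y by rewrite divr_ge0 // ltW.
have := H Y Y0; have n1 : 1 <= n%:R :> R by rewrite ler1n.
have e1 : 1 + Y <= expR (n%:R * Y).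
  apply: le_trans (expR_ge1Dx _); rewrite lerD2l ler_peMl //.
rewrite expRN => h1.
have {h1} : `|c| * (1 + Y) <= pi *+ 2.
  apply: le_trans (ler_wpM2l (normr_ge0 c) e1) _.
  by rewrite -ler_pdivlMr ?expR_gt0 // mulrC.
rewrite mulrDr /Y mulrCA divff ?gt_eqF // ; lra.
Qed.

Lemma segint_dirichlet p (x1 : R) :
  segint (- pi) (- pi + pi *+ 2) (fun x => dirichletR p (x - x1)) = pi *+ 2.
Proof.
have AB : - pi <= - pi + pi *+ 2 :> R by rewrite lerDl ltW // twopi_gt0.
elim: p => [|p IH] /=; first by rewrite segint_cst //; ring.
have ccos0 n : continuous (fun x => cos (n%:R * (x - x1))).
  move=> x; apply: (@continuous_comp _ _ _ (fun x => n%:R * (x - x1)) cos); last exact: continuous_cos.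
  apply: (@continuousM _ _ (fun=> n%:R) (fun x => x - x1)); first exact: cst_continuous.
  by apply: (@continuousB _ _ _ id (fun=> x1)) => //; exact: cst_continuous.
have ccos n : continuous (fun x => 2 * cos (n%:R * (x - x1))).
  move=> x; apply: (@continuousM _ _ (fun=> 2) (fun x => cos (n%:R * (x - x1)))).
    exact: cst_continuous.
  exact: ccos0.
have cdir q : continuous (fun x => dirichletR q (x - x1)).
  elim: q => [|q IHq] x /=; first exact: cst_continuous.
  apply: (@continuousD _ _ _ (fun x => dirichletR q (x - x1))); first exact: IHq.
  exact: ccos.
rewrite segintD; [|exact: continuous_subspaceT|exact: continuous_subspaceT].
rewrite IH /segint RintegralZl //; last first.
  by apply: segint_integrable; exact: continuous_subspaceT.
by have := @segint_cos p.+1 x1 isT; rewrite /segint => ->; rewrite mulr0 addr0.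
Qed.

End dirichlet.

(** * Polynomial approximation of holomorphic functions *)

Section strip.
Local Open Scope complex_scope.
Context {R : realType}.
Local Notation C := R[i].
Local Notation normc := (@Normc.normc R).
Implicit Types (z u : C) (x y : R) (n p : nat).

Variables (G : C -> C) (s M : R).
Hypothesis s_gt0 : 0 < s.
Hypothesis G_slope : forall x y, `|y| <= s -> slope_at G (x +i* y).
Hypothesis G_bound : forall x y, `|y| <= s -> normc (G (x +i* y)) <= M.
Hypothesis G_period : forall u, G (u + (pi *+ 2)%:C) = G u.

Let A : R := - pi.
Let B : R := - pi + pi *+ 2.

Lemma A_le_B : A <= B.
Proof. by rewrite /B lerDl ltW // twopi_gt0. Qed.

Lemma G_continuous y : `|y| <= s ->
  {within `[A, B], continuous (fun x => complex.Re (G (x +i* y)))}.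
Proof.
move=> ys; apply: (@slicex_cont _ (fun x y => complex.Re (G (x +i* y)))) => x _.
by apply: Re_cont_at; apply: slope_cont; exact: G_slope.
Qed.

Lemma normcD (z w : C) : normc (z + w) <= normc z + normc w.
Proof. by have := ler_normD z w; rewrite -[_ + _ in leRHS]rmorphD lecR. Qed.

Lemma normc_opp (z : C) : normc (- z) = normc z.
Proof. by have := normrN z => /complexI. Qed.

Lemma normcB_ge (z w : C) : normc z - normc w <= normc (z - w).
Proof. by rewrite lerBlDr; have := normcD (z - w) w; rewrite subrK. Qed.

Section base_point.
Variables (x1 : R).
Hypothesis x1_itv : - pi < x1 < pi.
Variable p : nat.

Let x1c : C := x1%:C.
(** On the real axis [F0] integrates to the error of the Dirichlet sum at x1, up to a factor 2 pi.
    Subtracting the value of G at x1 compensates the zero of the denominator of [quot], and F0 = Fp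
    - Fm splits the kernel into parts that are small on one edge of the strip each. *)
Let F0 z := (G z - G x1c) * dirichlet p (z - x1c).
Let quot z := (G z - G x1c) / (cis (z - x1c) - 1).
Let Fp z := quot z * cis (p.+1%:R * (z - x1c)).
Let Fm z := quot z * cis (- (p%:R * (z - x1c))).

Lemma s0 : `|0 : R| <= s. Proof. by rewrite normr0 ltW. Qed.

Lemma period_point x y : (x + pi *+ 2) +i* y - x1c = (x +i* y - x1c) + (pi *+ 2)%:C.
Proof. by rewrite /x1c; complex_ring. Qed.

Lemma period_pointG x y : (x + pi *+ 2) +i* y = (x +i* y) + (pi *+ 2)%:C.
Proof. by complex_ring. Qed.

Lemma F0_slope x y : `|y| <= s -> slope_at F0 (x +i* y).
Proof.
move=> ys; apply: slopeM.
  by apply: slopeD; [exact: G_slope|exact: slope_cst].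
by apply: slope_shift; exact: slope_dirichlet.
Qed.

Lemma cis_neq1 x y : A <= x <= B -> (x, y) <> (x1, 0) -> cis (x +i* y - x1c) - 1 != 0.
Proof.
move=> /andP[Ax xB] ne; apply/eqP => /eqP; rewrite subr_eq0 => /eqP.
have -> : x +i* y - x1c = (x - x1) +i* y by rewrite /x1c; complex_ring.
move/andP: x1_itv => [h1 h2]; move=> /cis_eq1[|xx y0].
  by move: Ax xB; rewrite /A /B mulr2n => *; apply/andP; split; lra.
by apply: ne; rewrite y0; congr pair; lra.
Qed.

Lemma quot_slope x y : `|y| <= s -> A <= x <= B -> (x, y) <> (x1, 0) ->
  slope_at quot (x +i* y).
Proof.
move=> ys xAB ne; apply: slopeM.
  by apply: slopeD; [exact: G_slope|exact: slope_cst].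
apply: slopeV; last exact: cis_neq1.
apply: slopeD; last exact: slope_cst.
by apply: slope_shift; exact: slope_cis.
Qed.

Lemma Fm_slope x y : `|y| <= s -> A <= x <= B -> (x, y) <> (x1, 0) ->
  slope_at Fm (x +i* y).
Proof.
move=> ys xAB ne; apply: slopeM; first exact: quot_slope.
apply: (@slope_shift _ (fun u => cis (- (p%:R * u)))).
by apply: slope_cis_comp; apply: slopeN; exact: slope_scale.
Qed.

Lemma Fp_slope x y : `|y| <= s -> A <= x <= B -> (x, y) <> (x1, 0) ->
  slope_at Fp (x +i* y).
Proof.
move=> ys xAB ne; apply: slopeM; first exact: quot_slope.
apply: (@slope_shift _ (fun u => cis (p.+1%:R * u))).
by apply: slope_cis_comp; exact: slope_scale.
Qed.

Lemma F0E x y : A <= x <= B -> (x, y) <> (x1, 0) ->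
  F0 (x +i* y) = Fp (x +i* y) - Fm (x +i* y).
Proof.
move=> xAB ne; have nz := cis_neq1 xAB ne.
rewrite /F0 /Fp /Fm -mulrBr -dirichletE /quot.
by rewrite mulrA divfK.
Qed.

(* The quotient has a removable singularity at x1: the value assigned there is
   the quotient of the derivatives. *)
Lemma Fm_extension : exists c : C, forall x y, `|y| <= s -> A <= x <= B ->
  cont_pt (fun z => if z == x1c then c else Fm z) (x +i* y).
Proof.
have [phi cphi [r r0 Hr]] : slope_at G x1c by apply: G_slope; exact: s0.
have [psi cpsi [r' r'0 Hr']] : slope_at (fun z => cis (z - x1c)) x1c.
  by apply: slope_shift; exact: slope_cis.
(* The value of [psi] here is the derivative of exp (i z) at 0, namely i. If it vanished, then v =
   |i v| would be at most v / 4 + v / 4 for small v. *)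
have psi0 : psi x1c != 0.
  have /slope_hol/hol_atC : slope_at (@cis R) 0 by exact: slope_cis.
  move=> _; apply/eqP => psi0.
  have h12 : 0 < 4^-1 :> R by rewrite invr_gt0.
  have [r2 r20 Hr2] := hol_cis0 h12.
  have [r3 r30 Hr3] := (cont_ptC psi x1c).1 cpsi _ h12.
  have [r4 r40 r4E] := posc r'0.
  have [t [t0 tr2 tr3]] := min_pos r20 r30.
  have [t1 [t10 t1t t1r4]] := min_pos t0 r40.
  pose v := t1 / 2; have v0 : 0 < v by rewrite divr_gt0.
  have nv : normc v%:C = v by rewrite /= expr0n addr0 sqrtr_sqr gtr0_norm.
  have := Hr2 v%:C; rewrite nv; have -> : v < r2 by rewrite /v; lra.
  move=> /(_ isT) k2.
  have := Hr3 (x1c + v%:C); rewrite addrAC subrr add0r nv psi0 subr0.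
  have -> : v < r3 by rewrite /v; lra.
  move=> /(_ isT) k3.
  have := Hr' (x1c + v%:C); rewrite addrAC subrr add0r r4E.
  have -> : `|v%:C| < r4%:C by rewrite ltcR nv /v; lra.
  rewrite cis0 => /(_ isT) k4; rewrite k4 in k2.
  have : normc ('i * v%:C) <= normc (psi (x1c + v%:C) * v%:C) + 4^-1 * v.
    have -> : 'i * v%:C = psi (x1c + v%:C) * v%:C - (psi (x1c + v%:C) * v%:C - 'i * v%:C) by ring.
    by apply: le_trans (normcD _ _) _; rewrite normc_opp lerD2l.
  rewrite !Normc.normcM nv.
  have -> : normc 'i = 1 by rewrite /= expr0n expr1n add0r sqrtr1.
  have : normc (psi (x1c + v%:C)) * v <= 4^-1 * v by rewrite ler_wpM2r // ltW.
  lra.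
exists (phi x1c / psi x1c) => x y ys xAB.
have [xy|ne] := pselect ((x, y) = (x1, 0)).
  case: xy => -> ->; rewrite -/x1c -[x1 +i* 0]/x1c.
  pose H z := phi z * (psi z)^-1 * cis (- (p%:R * (z - x1c))).
  apply: (@cont_pt_near _ H).
    have [r2 [r20 r2r r2r']] := min_pos r0 r'0.
    exists r2 => // z zr; have [->|zx1] := eqVneq z x1c.
      by rewrite /H subrr mulr0 oppr0 cis0 mulr1.
    rewrite /Fm /quot Hr ?(lt_le_trans zr) //.
    have /(lt_le_trans zr)/Hr' := r2r'; rewrite subrr cis0 => ->.
    by rewrite invfM mulrACA divff ?mulr1 // subr_eq0.
  apply: (@contM _ (fun z => phi z * (psi z)^-1) (fun z => cis (- (p%:R * (z - x1c))))).
    apply: (@contM _ phi (fun z => (psi z)^-1)); first exact: cphi.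
    exact: (contV cpsi psi0).
  apply: slope_cont; apply: (@slope_shift _ (fun u => cis (- (p%:R * u)))).
  by apply: slope_cis_comp; apply: slopeN; exact: slope_scale.
apply: (@cont_pt_near _ Fm); last by apply: slope_cont; exact: Fm_slope.
have zne : x +i* y != x1c.
  by apply/eqP => -[ex ey]; apply: ne; rewrite ex ey.
exists `|x1c - (x +i* y)|; first by rewrite normr_gt0 subr_eq0 eq_sym.
move=> z; case: eqVneq => // ->; by rewrite ltxx.
Qed.

Lemma within_strip y : - s <= y <= s -> `|y| <= s.
Proof. by rewrite ler_norml. Qed.

Lemma cut_bound x y : `|y| = s -> A <= x <= B ->
  normc (quot (x +i* y)) <= 2 * M / `|expR (- y) - 1|.
Proof.
move=> ys xAB; have ysl : `|y| <= s by rewrite ys.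
have yn : y != 0 by rewrite -normr_eq0 ys gt_eqF.
have e1 : 0 < `|expR (- y) - 1|.
  rewrite normr_gt0 subr_eq0; apply: contra_neq yn => e1.
  by apply: oppr_inj; rewrite oppr0; apply: expR_inj; rewrite e1 expR0.
rewrite /quot Normc.normcM Normc.normcV.
have -> : x +i* y - x1c = (x - x1) +i* y by rewrite /x1c; complex_ring.
have n1 : `|expR (- y) - 1| <= normc (cis ((x - x1) +i* y) - 1).
  have := normcB_ge (cis ((x - x1) +i* y)) 1.
  have := normcB_ge 1 (cis ((x - x1) +i* y)).
  rewrite -[1 - cis _]opprB normc_opp normc_cis Normc.normc1.
  by rewrite ler_norml => *; apply/andP; split; lra.
have M2 : normc (G (x +i* y) - G x1c) <= 2 * M.
  apply: le_trans (normcD _ _) _; rewrite normc_opp.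
  have := G_bound x ysl; have := G_bound x1 s0; rewrite -[x1 +i* 0]/x1c.
  by lra.
rewrite ler_pM // ?normc_ge0 // ?invr_ge0 ?normc_ge0 //.
by rewrite lef_pV2 // posrE (lt_le_trans e1).
Qed.

Lemma period_G x y : G ((x + pi *+ 2) +i* y) = G (x +i* y).
Proof. by rewrite period_pointG G_period. Qed.

Lemma period_quot x y : quot ((x + pi *+ 2) +i* y) = quot (x +i* y).
Proof.
rewrite /quot period_G period_point.
by have := cis_period 1 (x +i* y - x1c); rewrite !mul1r => ->.
Qed.

Lemma shift0 : segint A B (fun x => complex.Re (F0 (x +i* 0))) =
  segint A B (fun x => complex.Re (F0 (x +i* s))).
Proof.
have st y : 0 <= y <= s -> `|y| <= s.
  by move=> /andP[y0 ys]; rewrite ger0_norm.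
apply: period_shift; first exact: ltW.
  by move=> x y _; rewrite /F0 period_G period_point dirichlet_period.
apply: (@goursat _ _ _ _ _ 0 s); rewrite ?A_le_B ?ltW //.
- by move=> x y _ /st ys; apply: Re_cont_at; apply: slope_cont; exact: F0_slope.
- by move=> x y _ /st ys; apply: Im_cont_at; apply: slope_cont; exact: F0_slope.
- by move=> x y _ /st ys; apply: slope_closed_at; exact: F0_slope.
Qed.

(** The exponential in [Fm] has modulus exp (p y), hence the move to the lower edge. The rectangle
    contains the removable singularity x1, which lies strictly inside it. *)
Lemma shiftm : segint A B (fun x => complex.Re (Fm (x +i* - s))) =
  segint A B (fun x => complex.Re (Fm (x +i* s))).
Proof.
have [c cP] := Fm_extension.
pose Fe z := if z == x1c then c else Fm z.
have FeE x y : y <> 0 -> Fe (x +i* y) = Fm (x +i* y).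
  by move=> y0; rewrite /Fe; case: eqP => // -[_ y00].
have sn0 : s <> 0 by apply/eqP; rewrite gt_eqF.
have nsn0 : - s <> 0 by apply/eqP; rewrite oppr_eq0; apply/eqP.
transitivity (segint A B (fun x => complex.Re (Fe (x +i* - s)))).
  by apply: eq_Rintegral => x _; rewrite FeE.
transitivity (segint A B (fun x => complex.Re (Fe (x +i* s)))); last first.
  by apply: eq_Rintegral => x _; rewrite FeE.
have [h1 h2] := andP x1_itv.
apply: period_shift; first by have := s_gt0; lra.
  move=> x y _; rewrite -/A -/B /Fe.
  have -> : ((A + pi *+ 2) +i* y == x1c) = false.
    apply/negbTE/eqP => -[ex _]; move: h2; rewrite -ex /A mulr2n; lra.
  have -> : (A +i* y == x1c) = false.
    apply/negbTE/eqP => -[ex _]; move: h1; rewrite -ex /A; lra.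
  rewrite /Fm period_quot period_point; by rewrite cis_periodN.
apply: (@goursat_exception _ _ _ _ _ _ _ x1 0).
- by rewrite /A mulr2n; apply/andP; split; lra.
- by rewrite oppr_lt0 s_gt0.
- by move=> x y xAB /within_strip ys; apply: Re_cont_at; exact: cP.
- by move=> x y xAB /within_strip ys; apply: Im_cont_at; exact: cP.
- move=> x y xAB /within_strip ys ne; apply: slope_closed_at.
  apply: (@slope_near _ Fm); last exact: Fm_slope.
  have zne : x +i* y != x1c by apply/eqP => -[ex ey]; apply: ne; rewrite ex ey.
  exists `|x1c - (x +i* y)|; first by rewrite normr_gt0 subr_eq0 eq_sym.
  by move=> z; rewrite /Fe; case: eqVneq => // ->; rewrite ltxx.
Qed.

(** Both edges lead to this bound: on the lower one, exp (- p s) / (exp s - 1) equals exp (- (p + 1)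
    s) / (1 - exp (- s)). *)
Let err := 2 * M / (1 - expR (- s)) * expR (- (p.+1%:R * s)).

Lemma Fp_bound x : A <= x <= B -> `|complex.Re (Fp (x +i* s))| <= err.
Proof.
move=> xAB; apply: le_trans (Re_le_normc _) _; rewrite /Fp Normc.normcM.
have -> : x +i* s - x1c = (x - x1) +i* s by rewrite /x1c; complex_ring.
rewrite cis_scale_normc /err; apply: ler_pM.
- exact: normc_ge0.
- exact: expR_ge0.
- apply: le_trans (cut_bound (gtr0_norm s_gt0) xAB) _.
  rewrite ler0_norm ?opprB //.
  by rewrite subr_le0 expR_le1 oppr_le0 ltW.
- exact: lexx.
Qed.

Lemma Fm_bound x : A <= x <= B -> `|complex.Re (Fm (x +i* - s))| <= err.
Proof.
move=> xAB; apply: le_trans (Re_le_normc _) _; rewrite /Fm Normc.normcM.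
have -> : x +i* - s - x1c = (x - x1) +i* - s by rewrite /x1c; complex_ring.
rewrite cis_scaleN_normc.
have sN : `|- s| = s by rewrite normrN gtr0_norm.
have e1 : 1 < expR s by rewrite expR_gt1.
apply: (@le_trans _ _ (2 * M / (expR s - 1) * expR (p%:R * - s))).
  apply: ler_wpM2r; first exact: expR_ge0.
  apply: le_trans (cut_bound sN xAB) _.
  by rewrite opprK ger0_norm ?subr_ge0 // ltW.
rewrite le_eqVlt; apply/orP; left; apply/eqP; rewrite /err.
have -> : - (p.+1%:R * s) = p%:R * - s + - s by rewrite -natr1; ring.
rewrite expRD expRN; field.
by rewrite !subr_eq0 !gt_eqF // expR_gt0.
Qed.

(** The integral over the real axis is lifted to the upper edge and split there into [Fp] and [Fm],
    and the part with [Fm] is carried down to the lower edge. Each of the two remaining integrals is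
    at most [err] times the period. *)
Lemma dirichlet_error :
  `|segint A B (fun x => complex.Re (G x%:C) * dirichletR p (x - x1))
    - pi *+ 2 * complex.Re (G x1c)| <= 2 * err * (pi *+ 2).
Proof.
have AB := A_le_B.
have cGd y (F : C -> C) : (forall x, A <= x <= B -> slope_at F (x +i* y)) ->
    {within `[A, B], continuous (fun x => complex.Re (F (x +i* y)))}.
  move=> H; apply: (@slicex_cont _ (fun x y => complex.Re (F (x +i* y)))) => x xAB.
  by apply: Re_cont_at; apply: slope_cont; exact: H.
have sne x (y : R) : `|y| = s -> (x, y) <> (x1, 0).
  by move=> ys [_ y0]; move: s_gt0; rewrite -ys y0 normr0 ltxx.
have ss : `|s| = s by rewrite gtr0_norm.
have sN : `|- s| = s by rewrite normrN.
have le_s : s <= s by [].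
have cFp : {within `[A, B], continuous (fun x => complex.Re (Fp (x +i* s)))}.
  by apply: cGd => x xAB; apply: Fp_slope; rewrite ?ss //; exact: sne.
have cFm : {within `[A, B], continuous (fun x => complex.Re (Fm (x +i* s)))}.
  by apply: cGd => x xAB; apply: Fm_slope; rewrite ?ss //; exact: sne.
have cFm' : {within `[A, B], continuous (fun x => complex.Re (Fm (x +i* - s)))}.
  by apply: cGd => x xAB; apply: Fm_slope; rewrite ?sN //; exact: sne.
have cG : {within `[A, B], continuous (fun x => complex.Re (G (x +i* 0)))}.
  by apply: cGd => x _; apply: G_slope; exact: s0.
have cD : {within `[A, B], continuous (fun x => dirichletR p (x - x1))}.
  have -> : (fun x => dirichletR p (x - x1)) =
      (fun x => complex.Re ((fun z => dirichlet p (z - x1c)) (x +i* 0))).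
    apply/funext => x /=; have -> : x +i* 0 - x1c = (x - x1)%:C by rewrite /x1c; complex_ring.
    by rewrite dirichlet_real.
  by apply: (cGd 0 (fun z => dirichlet p (z - x1c))) => x _; apply: slope_shift; exact: slope_dirichlet.
have ccst : {within `[A, B], continuous (fun=> complex.Re (G x1c))}.
  by move=> x; exact: cst_continuous.
have F0real x : complex.Re (F0 (x +i* 0)) =
    complex.Re (G x%:C) * dirichletR p (x - x1) - complex.Re (G x1c) * dirichletR p (x - x1).
  rewrite /F0; have -> : x +i* 0 - x1c = (x - x1)%:C by rewrite /x1c; complex_ring.
  rewrite dirichlet_real -[x +i* 0]/(x%:C).
  by case: (G x%:C) => a b; case: (G x1c) => a' b' /=; ring.
have e0 : segint A B (fun x => complex.Re (F0 (x +i* 0))) =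
    segint A B (fun x => complex.Re (G x%:C) * dirichletR p (x - x1))
    - pi *+ 2 * complex.Re (G x1c).
  under eq_fun do rewrite F0real.
  rewrite segintB.
  - congr (_ - _); rewrite /segint RintegralZl //; last exact: segint_integrable.
    by have := segint_dirichlet p x1; rewrite /segint => ->; rewrite mulrC.
  - exact: (fun x => continuousM (cG x) (cD x)).
  - exact: (fun x => continuousM (ccst x) (cD x)).
rewrite -e0 shift0.
have -> : segint A B (fun x => complex.Re (F0 (x +i* s))) =
    segint A B (fun x => complex.Re (Fp (x +i* s)))
    - segint A B (fun x => complex.Re (Fm (x +i* s))).
  rewrite -segintB //; apply: eq_Rintegral => x; rewrite inE /= in_itv /= => xAB.
  rewrite F0E //; last exact: sne.
  by case: (Fp _) => a b; case: (Fm _) => a' b'.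
rewrite -shiftm.
have BA : B - A = pi *+ 2 by rewrite /A /B; ring.
have := segint_le AB cFp Fp_bound; have := segint_le AB cFm' Fm_bound; rewrite BA => I1 I2.
apply: le_trans (ler_normB _ _) _.
lra.
Qed.

End base_point.
End strip.

(** * Fourier partial sums as polynomials in the cosine *)

Section fourier.
Local Open Scope complex_scope.
Context {R : realType}.
Variable (f : R -> R).
Let A : R := - pi.
Let B : R := - pi + pi *+ 2.
Hypothesis cf : {within `[A, B], continuous f}.

Definition fourier_coef n : R := segint A B (fun x => f x * cos (n%:R * x)).

(** The coefficients carry no factor 1 / (2 pi); this normalisation is applied once, to the whole
    sum. *)
Fixpoint fourier_poly p : {poly R} :=
  if p is p'.+1 then fourier_poly p' + (2 * fourier_coef p) *: chebT p
  else (fourier_coef 0)%:P.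

Lemma size_fourier_poly p : (size (fourier_poly p) <= p.+1)%N.
Proof.
elim: p => [|p IH]; first by rewrite size_polyC; case: eqP.
rewrite [fourier_poly _]/=; apply: leq_trans (size_polyD _ _) _; rewrite geq_max (leq_trans IH) //=.
by apply: leq_trans (size_scale_leq _ _) _; exact: size_chebT.
Qed.

Lemma continuous_dirichletR p (x1 : R) : continuous (fun x => dirichletR p (x - x1)).
Proof.
elim: p => [|p IH] x /=; first exact: cst_continuous.
apply: (@continuousD _ _ _ (fun x => dirichletR p (x - x1))); first exact: IH.
apply: (@continuousM _ _ (fun=> 2) (fun x => cos (p.+1%:R * (x - x1)))); first exact: cst_continuous.
apply: (@continuous_comp _ _ _ (fun x => p.+1%:R * (x - x1)) cos); last exact: continuous_cos.
apply: (@continuousM _ _ (fun=> p.+1%:R) (fun x => x - x1)); first exact: cst_continuous.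
by apply: (@continuousB _ _ _ id (fun=> x1)) => //; exact: cst_continuous.
Qed.

Lemma continuous_cosn n : continuous (fun x : R => cos (n%:R * x)).
Proof.
move=> x; apply: (@continuous_comp _ _ _ (fun x : R => n%:R * x) cos); last exact: continuous_cos.
by apply: (@continuousM _ _ (fun=> n%:R : R) id) => //; exact: cst_continuous.
Qed.

(** As cos (k (x - x0)) + cos (k (x + x0)) = 2 cos (k x) cos (k x0), the sum of the two kernels
    involves x0 only through cosines. *)
Lemma fourier_sum p (x0 : R) :
  segint A B (fun x => f x * dirichletR p (x - x0))
  + segint A B (fun x => f x * dirichletR p (x - - x0)) =
  2 * (fourier_poly p).[cos x0].
Proof.
have wc (g : R -> R) : continuous g -> {within `[A, B], continuous (fun x => f x * g x)}.
  move=> cg; have cg' : {within `[A, B], continuous g} by exact: continuous_subspaceT.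
  exact: within_continuousM.
elim: p => [|p IH].
  rewrite /= hornerC /fourier_coef.
  have -> : segint A B (fun x => f x * cos (0%:R * x)) = segint A B (fun x => f x * 1).
    by apply: eq_Rintegral => x _; rewrite mul0r cos0.
  by rewrite mulr_natl mulr2n.
have cd x1 := wc _ (@continuous_dirichletR p x1).
have cd' x1 := wc _ (@continuous_dirichletR p.+1 x1).
have cc := wc _ (@continuous_cosn p.+1).
have -> : fourier_poly p.+1 = fourier_poly p + (2 * fourier_coef p.+1) *: chebT p.+1 by [].
rewrite hornerD hornerZ chebT_cos mulrDr -IH.
rewrite -segintD // -segintD //.
have -> : 2 * (2 * fourier_coef p.+1 * cos (p.+1%:R * x0)) =
   segint A B (fun x => (4 * cos (p.+1%:R * x0)) * (f x * cos (p.+1%:R * x))).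
  rewrite /segint RintegralZl //; last exact: segint_integrable.
  by rewrite /fourier_coef /segint; ring.
have cc4 : {within `[A, B], continuous (fun x => (4 * cos (p.+1%:R * x0)) * (f x * cos (p.+1%:R * x)))}.
  by apply: within_continuousM => //; exact: within_continuous_cst.
rewrite -segintD //; last exact: within_continuousD.
apply: eq_Rintegral => x _ /=; rewrite opprK (mulrDr p.+1%:R x x0) (mulrBr p.+1%:R x x0).
by rewrite cosB cosD; ring.
Qed.

End fourier.

(** * The Joukowski map and polynomial approximation *)

Section holomorphic_approximation.
Local Open Scope complex_scope.
Context {R : realType}.
Local Notation C := R[i].
Local Notation normc := (@Normc.normc R).
Implicit Types (lo hi tau M : R) (h : C -> C) (p : nat).

(** This is arsinh q, the logarithm of the sum of the half axes of a Bernstein ellipse of the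
    normalised interval. It is the half height of a strip that the Joukowski map sends into the
    tau-neighbourhood, and it agrees with [sigma_n]. *)
Definition bernstein lo hi tau : R :=
  let q := 2 * tau / (hi - lo) in ln (q + Num.sqrt (1 + q ^+ 2)).

Lemma bernstein_sinh lo hi tau : lo < hi -> 0 < tau ->
  0 < bernstein lo hi tau /\
  expR (bernstein lo hi tau) - expR (- bernstein lo hi tau) = 2 * (2 * tau / (hi - lo)).
Proof.
move=> lohi tau0; rewrite /bernstein; set q := 2 * tau / (hi - lo).
have q0 : 0 < q by rewrite divr_gt0 ?mulr_gt0 // subr_gt0.
set r := Num.sqrt (1 + q ^+ 2).
have r2 : r ^+ 2 = 1 + q ^+ 2 by rewrite sqr_sqrtr // addr_ge0 ?sqr_ge0.
have r0 : 0 <= r by exact: sqrtr_ge0.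
have r1 : 1 <= r.
  rewrite -(@ler_pXn2r _ 2) ?nnegrE // expr1n r2 lerDl sqr_ge0 //.
have qr : 0 < q + r by rewrite ltr_wpDr.
split; first by rewrite ln_gt0 //; lra.
rewrite expRN lnK ?posrE //.
have -> : (q + r)^-1 = r - q.
  apply: (mulfI (lt0r_neq0 qr)); rewrite divff ?lt0r_neq0 //.
  by rewrite mulrDl !mulrBr -!expr2 r2; ring.
ring.
Qed.

Section joukowski.
Variables (lo hi tau : R).
Hypotheses (lohi : lo < hi) (tau0 : 0 < tau).
Let mid := (lo + hi) / 2.
Let hal := (hi - lo) / 2.
Let s := bernstein lo hi tau.

Definition joukowski (z : C) : C := mid%:C + (hal / 2)%:C * (cis z + cis (- z)).

Lemma joukowski_coord x y : joukowski (x +i* y) =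
  (mid + hal * cos x * ((expR y + expR (- y)) / 2)) +i*
  (- (hal * sin x * ((expR y - expR (- y)) / 2))).
Proof.
rewrite /joukowski /= opprK cosN sinN; apply/eqP; rewrite eq_complex /=.
by apply/andP; split; apply/eqP; field.
Qed.

Lemma joukowski_slope z : slope_at joukowski z.
Proof.
apply: slopeD; first exact: slope_cst.
apply: slopeM; first exact: slope_cst.
apply: slopeD; first exact: slope_cis.
apply: slope_cis_comp; apply: slopeN; exact: slope_id.
Qed.

Lemma joukowski_period u : joukowski (u + (pi *+ 2)%:C) = joukowski u.
Proof.
rewrite /joukowski; have := cis_period 1 u; rewrite !mul1r => ->.
by have := cis_periodN 1 u; rewrite !mul1r => ->.
Qed.

Lemma joukowski_even u : joukowski (- u) = joukowski u.
Proof. by rewrite /joukowski opprK [cis (- u) + _]addrC. Qed.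

Lemma joukowski_real x : joukowski x%:C = (mid + hal * cos x)%:C.
Proof.
rewrite joukowski_coord oppr0 expR0 subrr; apply/eqP; rewrite eq_complex /=.
by apply/andP; split; apply/eqP; field.
Qed.

(** For t = mid + hal cos x the squared distance is hal^2 (cos^2 x (cosh y - 1)^2 + sin^2 x sinh^2
    y), and (cosh y - 1)^2 <= sinh^2 y. Hence the distance is at most hal sinh s = tau. *)
Lemma joukowski_near x y : `|y| <= s ->
  exists2 t, lo <= t <= hi & normc (joukowski (x +i* y) - t%:C) <= tau.
Proof.
move=> ys; exists (mid + hal * cos x).
  have := cos_max x; rewrite ler_norml /mid /hal => /andP[c1 c2].
  have hl : 0 < (hi - lo) / 2 by rewrite divr_gt0 // subr_gt0.
  by apply/andP; split; nra.
have [s0 sE] := bernstein_sinh lohi tau0.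
rewrite joukowski_coord /= subr0.
set ch := (expR y + _) / 2; set sh := (expR y - _) / 2.
have hal0 : 0 < hal by rewrite /hal divr_gt0 // subr_gt0.
have yy : expR y * expR (- y) = 1 by rewrite -expRD subrr expR0.
have chsh : ch ^+ 2 = 1 + sh ^+ 2.
  by rewrite /ch /sh !exprMn !sqrrD sqrrN mulrN yy; field.
have e1 : 0 < expR y by exact: expR_gt0.
have e2 : 0 < expR (- y) by exact: expR_gt0.
have ch1 : 1 <= ch.
  by rewrite -(@ler_pXn2r _ 2) ?nnegrE ?expr1n ?chsh ?lerDl ?sqr_ge0 // /ch; lra.
have sht : `|sh| <= 2 * tau / (hi - lo).
  move: ys; rewrite ler_norml => /andP[y1 y2].
  have := @ler_expR R y s; rewrite y2 => k1.
  have := @ler_expR R (- y) s; rewrite lerNl y1 => k2.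
  have := @ler_expR R (- s) y; rewrite y1 => k3.
  have := @ler_expR R (- s) (- y); rewrite lerN2 y2 => k4.
  have {}k1 : expR y <= expR s by rewrite k1.
  have {}k2 : expR (- y) <= expR s by rewrite k2.
  have {}k3 : expR (- s) <= expR y by rewrite k3.
  have {}k4 : expR (- s) <= expR (- y) by rewrite k4.
  by move: sE; rewrite -/s ler_norml /sh => sE; apply/andP; split; lra.
have halt : hal * (2 * tau / (hi - lo)) = tau.
  by rewrite /hal; field; rewrite subr_eq0 gt_eqF.
have htau : hal * `|sh| <= tau by rewrite -[leRHS]halt ler_pM2l.
have -> : mid + hal * cos x * ch - (mid + hal * cos x) = hal * (cos x * (ch - 1)) by ring.
have -> : - (hal * sin x * sh) = - (hal * (sin x * sh)) by ring.
rewrite -[leRHS](gtr0_norm tau0) -[leRHS]sqrtr_sqr ler_wsqrtr //.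
apply: (@le_trans _ _ ((hal * `|sh|) ^+ 2)); last first.
  have h0 : 0 <= hal * `|sh| by rewrite mulr_ge0 // ltW.
  by rewrite ler_pXn2r // ?nnegrE // ltW.
rewrite sqrrN !(exprMn 2 hal) real_normK ?num_real // -mulrDr ler_pM2l ?exprn_gt0 //.
rewrite (exprMn 2 (cos x)) (exprMn 2 (sin x)).
have cs := cos2Dsin2 x.
have c2 : 0 <= cos x ^+ 2 by exact: sqr_ge0.
have ch2 : (ch - 1) ^+ 2 <= sh ^+ 2.
  by rewrite sqrrB expr1n mulr1 chsh; lra.
apply: (@le_trans _ _ (cos x ^+ 2 * sh ^+ 2 + sin x ^+ 2 * sh ^+ 2)).
  by rewrite lerD2r ler_wpM2l.
by rewrite -mulrDl cs mul1r.
Qed.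

End joukowski.

(** Averaging the errors at x0 and - x0 and dividing by 2 pi leaves 2 [err], which is this constant
    times M exp (- (p + 1) s) for the kernel of order p. *)
Definition approx_cst (s : R) : R := 4 / (1 - expR (- s)).

Lemma approx_cst_ge1 s : 0 < s -> 1 <= approx_cst s.
Proof.
move=> s0; rewrite /approx_cst.
have e1 : expR (- s) < 1 by rewrite expR_lt1 oppr_lt0.
have e0 : 0 < expR (- s) by exact: expR_gt0.
by rewrite ler_pdivlMr; lra.
Qed.

(* The Joukowski map pulls h back to an even periodic function on a horizontal
   strip; the Dirichlet kernel gives the Fourier partial sums of this function,
   and averaging over x0 and - x0 kills their sine terms, leaving a polynomial
   in cos x0. *)
Theorem polynomial_approximation lo hi tau h M p : lo < hi -> 0 < tau ->
  (forall z t, lo <= t <= hi -> normc (z - t%:C) <= tau -> hol_at h z) ->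
  (forall z t, lo <= t <= hi -> normc (z - t%:C) <= tau -> normc (h z) <= M) ->
  exists2 Q : {poly R}, (size Q <= p)%N & forall t, lo <= t <= hi ->
    `|complex.Re (h t%:C) - Q.[t]| <=
      approx_cst (bernstein lo hi tau) * M * expR (- (p%:R * bernstein lo hi tau)).
Proof.
move=> lohi tau0 hh hM; set s := bernstein lo hi tau.
have [s0 _] := bernstein_sinh lohi tau0; rewrite -/s in s0.
have real_dist (t : R) : normc (t%:C - t%:C) <= tau.
  by rewrite subrr Normc.normc0 ltW.
have M0 : 0 <= M.
  have lolo : lo <= lo <= hi by rewrite lexx ltW.
  exact: le_trans (normc_ge0 _) (hM _ _ lolo (real_dist _)).
(* For size 0 the bound M on h is enough, as [approx_cst] is at least 1. Otherwise the kernel of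
   order p yields a polynomial of size p + 1. *)
case: p => [|p].
  exists 0; first by rewrite size_poly0.
  move=> t tI; rewrite horner0 subr0 mul0r oppr0 expR0 mulr1.
  apply: le_trans (Re_le_normc _) _.
  apply: le_trans (hM _ _ tI (real_dist _)) _.
  by rewrite ler_peMl // approx_cst_ge1.
pose G := h \o joukowski lo hi.
have Gs x y : `|y| <= s -> slope_at G (x +i* y).
  move=> ys; apply: slope_comp; first exact: joukowski_slope.
  have [t tI tD] := joukowski_near lohi tau0 x ys.
  by apply/slope_hol; exact: hh tD.
have Gb x y : `|y| <= s -> normc (G (x +i* y)) <= M.
  move=> ys; have [t tI tD] := joukowski_near lohi tau0 x ys; exact: hM tD.
have Gp u : G (u + (pi *+ 2)%:C) = G u by rewrite /G /= joukowski_period.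
pose f x := complex.Re (G x%:C).
have cf : {within `[- pi, - pi + pi *+ 2], continuous f}.
  apply: (@G_continuous _ G s Gs 0); by rewrite normr0 ltW.
pose mid := (lo + hi) / 2; pose hal := (hi - lo) / 2.
have hal0 : 0 < hal by rewrite /hal divr_gt0 // subr_gt0.
pose Q := ((pi *+ 2)^-1 *: fourier_poly f p) \Po (hal^-1 *: ('X - mid%:P)).
exists Q.
  apply: (leq_trans (size_comp_poly_leq _ _)).
  rewrite (@size_scale _ hal^-1) ?invr_neq0 ?gt_eqF // size_XsubC muln1 ltnS.
  have : (size ((pi *+ 2)^-1 *: fourier_poly f p) <= p.+1)%N.
    by rewrite (leq_trans (size_scale_leq _ _)) // size_fourier_poly.
  by case: (size _).
set E := approx_cst s * M * expR (- (p.+1%:R * s)).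
have pi2 : 0 < pi *+ 2 :> R := twopi_gt0.
(* The end point lo corresponds to x0 = pi, where the singularity would lie on the vertical sides of
   the contour. It is excluded here and reached below by continuity. *)
have inner t : lo < t <= hi -> `|complex.Re (h t%:C) - Q.[t]| <= E.
  move=> /andP[lot thi].
  pose c := hal^-1 * (t - mid).
  have cE : c = (2 * t - lo - hi) / (hi - lo).
    by rewrite /c /hal /mid; field; rewrite subr_eq0 gt_eqF.
  have c1 : -1 < c by rewrite cE ltr_pdivlMr ?subr_gt0 //; lra.
  have c2 : c <= 1 by rewrite cE ler_pdivrMr ?subr_gt0 //; lra.
  have cI : c \in `[-1, 1] by rewrite in_itv /= c2 ltW.
  pose x0 := acos c.
  have cx : cos x0 = c by rewrite /x0 acosK.
  have x00 : 0 <= x0 by rewrite acos_ge0 // ltW.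
  have x0pi : x0 < pi by rewrite acos_ltpi // c1.
  have tE : t = mid + hal * cos x0.
    by rewrite cx /c mulrA divff ?gt_eqF // mul1r subrKC.
  have fx0 : f x0 = complex.Re (h t%:C) by rewrite /f /G /= joukowski_real -tE.
  have fx0N : f (- x0) = complex.Re (h t%:C).
    by rewrite -fx0 /f /G /= rmorphN joukowski_even.
  have QE : Q.[t] = (pi *+ 2)^-1 * (fourier_poly f p).[cos x0].
    by rewrite horner_comp !hornerE -/c cx.
  have x0I : - pi < x0 < pi by apply/andP; split => //; have := pi_gt0 R; lra.
  have x0NI : - pi < - x0 < pi by apply/andP; split; have := pi_gt0 R; lra.
  have := dirichlet_error s0 Gs Gb Gp x0I p.
  have := dirichlet_error s0 Gs Gb Gp x0NI p.
  rewrite -!/(f _) fx0 fx0N.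
  have := fourier_sum cf p x0.
  set I1 := segint _ _ _; set I2 := segint _ _ _ => I12 H2 H1.
  have -> : complex.Re (h t%:C) - Q.[t] =
    - ((pi *+ 2)^-1 / 2) * ((I1 - pi *+ 2 * complex.Re (h t%:C))
      + (I2 - pi *+ 2 * complex.Re (h t%:C))).
    have FE : (fourier_poly f p).[cos x0] = (I1 + I2) / 2.
      by rewrite I12; field.
    rewrite QE FE; have := lt0r_neq0 pi2; move: (pi *+ 2) => P P0.
    by field.
  have cpos : 0 < (pi *+ 2)^-1 / 2 :> R by rewrite divr_gt0 // invr_gt0.
  rewrite normrM normrN (gtr0_norm cpos).
  apply: le_trans (ler_wpM2l _ (ler_normD _ _)) _; first exact: ltW.
  apply: le_trans (ler_wpM2l _ (lerD H1 H2)) _; first exact: ltW.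
  rewrite le_eqVlt; apply/orP; left; apply/eqP; rewrite /E /approx_cst.
  have : 1 - expR (- s) != 0 by rewrite subr_eq0 gt_eqF // expR_lt1 oppr_lt0.
  have := lt0r_neq0 pi2; move: (pi *+ 2) (1 - expR (- s)) => P S P0 S0.
  by field; rewrite P0 S0.
move=> t /andP[lot thi]; move: lot; rewrite le_eqVlt => /predU1P[<-|lot]; last first.
  by apply: inner; rewrite lot.
rewrite leNgt; apply/negP => Elt.
have lolo : lo <= lo <= hi by rewrite lexx ltW.
have hc : cont_pt h lo%:C by apply: slope_cont; apply/slope_hol; exact: hh lolo (real_dist _).
(* A quarter of the supposed excess: the two continuity errors use up only half of it. *)
pose e := (`|complex.Re (h lo%:C) - Q.[lo]| - E) / 4.
have e0 : 0 < e by rewrite /e divr_gt0 // subr_gt0.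
have [r r0 Hr] := (cont_ptC h lo%:C).1 hc e e0.
have Qc : Q.[x] @[x --> lo] --> Q.[lo] by exact: continuous_horner.
have /cvgrPdist_le/(_ e e0)/nbhs_normP[r' r'0 Hr'] := Qc.
pose d := Num.min (r / 2) (Num.min (r' / 2) (hi - lo)).
have d0 : 0 < d by rewrite !lt_min !divr_gt0 // subr_gt0.
have : d <= d by []; rewrite {2}/d !le_min => /andP[d1 /andP[d2 d3]].
have tI : lo < lo + d <= hi by apply/andP; split; lra.
have k1 := inner _ tI.
have nd : normc ((lo + d)%:C - lo%:C) = d.
  rewrite -rmorphB /= addrAC subrr add0r expr0n addr0 sqrtr_sqr gtr0_norm //.
have := Hr (lo + d)%:C; rewrite nd; have -> : d < r by lra.
move=> /(_ isT) k2.
have k3 : `|complex.Re (h (lo + d)%:C) - complex.Re (h lo%:C)| <= e.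
  apply: le_trans k2; apply: le_trans (Re_le_normc _).
  by case: (h _) => a b; case: (h _) => a' b'.
have k4 : `|Q.[lo] - Q.[lo + d]| <= e.
  apply: Hr' => /=; rewrite opprD addrA subrr add0r normrN gtr0_norm //; lra.
have : `|complex.Re (h lo%:C) - Q.[lo]| <= e + E + e.
  have -> : complex.Re (h lo%:C) - Q.[lo] =
   - (complex.Re (h (lo + d)%:C) - complex.Re (h lo%:C))
   + (complex.Re (h (lo + d)%:C) - Q.[lo + d]) - (Q.[lo] - Q.[lo + d]) by ring.
  apply: le_trans (ler_normB _ _) _; apply: lerD => //.
  by apply: le_trans (ler_normD _ _) _; rewrite normrN lerD.
rewrite /e; lra.
Qed.

End holomorphic_approximation.

(** * The Hilbert space of gradients *)

Section row_measurability.
Context {R : realType} (d : nat).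
Local Notation E := 'rV[R]_d.

(** The sigma-algebra is generated by the coordinates, so an open set is written as the countable
    union of the cells with rational ends that it contains. *)
Lemma open_measurable_row (D : set E) : open D -> measurable D.
Proof.
move=> oD.
pose cube (p : {ffun 'I_d -> rat * rat}) : set E :=
  \bigcap_(j in [set: 'I_d]) ((fun x : E => x ord0 j) @^-1` `]ratr (p j).1, ratr (p j).2[%classic).
have mcube p : measurable (cube p).
  apply: fin_bigcap_measurable; first exact: finite_finset.
  move=> j _; rewrite -[X in measurable X]setTI.
  exact: measurable_row_coord.
pose F p : set E := if pselect (cube p `<=` D) then cube p else set0.
have -> : D = \bigcup_p F p.
  apply/seteqP; split=> [x Dx|x [p _]]; last first.
    by rewrite /F; case: pselect => // s /s.
  have /nbhs_ballP[e /= e0 eD] : nbhs x D by exact: open_nbhs_nbhs.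
  have qex j : exists q : rat * rat, x ord0 j - e < ratr q.1 < x ord0 j /\
      x ord0 j < ratr q.2 < x ord0 j + e.
    have /rat_in_itvoo[q1 h1] : x ord0 j - e < x ord0 j by rewrite ltrBlDr ltrDl.
    have /rat_in_itvoo[q2 h2] : x ord0 j < x ord0 j + e by rewrite ltrDl.
    by exists (q1, q2); move: h1 h2; rewrite !in_itv.
  have [q qP] := choice qex.
  exists [ffun j => q j] => //; rewrite /F; case: (pselect _) => [h|[]] /=.
    by move=> j _ /=; rewrite in_itv /= ffunE; have [/andP[_ h1] /andP[h2 _]] := qP j; rewrite h1 h2.
  move=> y yq; apply: eD; split => // i j; rewrite ord1 /ball /=.
  have := yq j I; rewrite /= in_itv /= ffunE => /andP[h1 h2].
  have [/andP[h3 h4] /andP[h5 h6]] := qP j.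
  by rewrite ltr_norml; apply/andP; split; lra.
apply: countable_bigcupT_measurable => [|p]; first exact: countableP.
by rewrite /F; case: (pselect _) => h; [exact: mcube|exact: measurable0].
Qed.

End row_measurability.

Section square_integrable.
Context {R : realType} (d : nat) (D : set 'rV[R]_d).
Hypothesis mD : measurable D.
Local Notation E := 'rV[R]_d.
Local Notation leb := (@lebesgue_row R d).
Implicit Types (f g : E -> R) (v w : E -> E) (c : R).

Lemma is_L2_integrable_sqr f : is_L2 D f ->
  leb.-integrable D (EFin \o (fun x => f x ^+ 2)).
Proof.
move=> [mf fi]; apply/integrableP; split.
  by apply/measurable_EFinP; exact: measurable_funX.
apply: le_lt_trans fi; rewrite le_eqVlt; apply/orP; left; apply/eqP.
by apply: eq_integral => x _ /=; rewrite ger0_norm // sqr_ge0.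
Qed.

Lemma is_L2_of_integrable_sqr f : measurable_fun D f ->
  leb.-integrable D (EFin \o (fun x => f x ^+ 2)) -> is_L2 D f.
Proof.
move=> mf /integrableP[_ fi]; split => //; apply: le_lt_trans fi.
rewrite le_eqVlt; apply/orP; left; apply/eqP.
by apply: eq_integral => x _ /=; rewrite ger0_norm // sqr_ge0.
Qed.

Lemma is_L2_integrableM f g : is_L2 D f -> is_L2 D g ->
  leb.-integrable D (EFin \o (fun x => f x * g x)).
Proof.
move=> Lf Lg; have If := is_L2_integrable_sqr Lf; have Ig := is_L2_integrable_sqr Lg.
have [mf _] := Lf; have [mg _] := Lg.
apply: (le_integrable mD) (integrableD mD If Ig).
  by apply/measurable_EFinP; exact: measurable_funM.
move=> x _ /=; rewrite lee_fin [leRHS]ger0_norm ?addr_ge0 ?sqr_ge0 //.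
rewrite ler_norml; apply/andP; split.
  have := sqr_ge0 (f x + g x); have := sqr_ge0 (f x); have := sqr_ge0 (g x).
  by rewrite sqrrD; lra.
have := sqr_ge0 (f x - g x); have := sqr_ge0 (f x); have := sqr_ge0 (g x).
by rewrite sqrrB; lra.
Qed.

Lemma is_L2D c f g : is_L2 D f -> is_L2 D g -> is_L2 D (fun x => c * f x + g x).
Proof.
move=> Lf Lg; have [mf _] := Lf; have [mg _] := Lg.
apply: is_L2_of_integrable_sqr.
  by apply: measurable_funD => //; apply: measurable_funM => //; exact: measurable_cst.
have I1 := integrableZl mD (c ^+ 2) (is_L2_integrable_sqr Lf).
have I2 := integrableZl mD (2 * c) (is_L2_integrableM Lf Lg).
have I3 := is_L2_integrable_sqr Lg.
apply: eq_integrable (integrableD mD (integrableD mD I1 I2) I3) => // x _ /=.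
by congr (_%:E); ring.
Qed.

Lemma is_L2_0 : is_L2 D (fun=> 0).
Proof.
split; first exact: measurable_cst.
under eq_integral do rewrite expr0n.
by rewrite integral0.
Qed.

Lemma is_L2_bounded (b : E -> R) c f : measurable_fun D b ->
  (forall x, D x -> `|b x| <= c) -> is_L2 D f -> is_L2 D (fun x => b x * f x).
Proof.
move=> mb bc Lf; have [mf _] := Lf.
apply: is_L2_of_integrable_sqr; first exact: measurable_funM.
apply: (le_integrable mD) (integrableZl mD (c ^+ 2) (is_L2_integrable_sqr Lf)).
  by apply/measurable_EFinP; apply: measurable_funX; exact: measurable_funM.
move=> x Dx /=; rewrite lee_fin.
have hA : 0 <= (b x * f x) ^+ 2 by exact: sqr_ge0.
have hB : 0 <= c ^+ 2 * f x ^+ 2 by apply: mulr_ge0; exact: sqr_ge0.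
rewrite (ger0_norm hA) (ger0_norm hB) exprMn.
rewrite ler_wpM2r ?sqr_ge0 // -[_ ^+ 2]real_normK ?num_real //.
have := bc x Dx; have := normr_ge0 (b x) => b0 h.
by rewrite ler_pXn2r // nnegrE // (le_trans b0).
Qed.

(** Functions are used instead of classes: [nrm] below is a seminorm on the submodule of these
    fields, which is all that the interpolation bounds require. *)
Definition L2v v := forall j, is_L2 D (fun x => v x ord0 j).

Lemma L2v0 : L2v 0.
Proof.
move=> j; have := is_L2_0; congr is_L2; apply/funext => x.
by rewrite [RHS]mxE.
Qed.

Lemma L2vD c v w : L2v v -> L2v w -> L2v (c *: v + w).
Proof.
move=> Lv Lw j; have := is_L2D c (Lv j) (Lw j); congr is_L2.
by apply/funext => x; rewrite !mxE.
Qed.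

Lemma L2v_bounded (b : E -> R) c v : measurable_fun D b ->
  (forall x, D x -> `|b x| <= c) -> L2v v -> L2v (fun x => b x *: v x).
Proof.
move=> mb bc Lv j; have := is_L2_bounded mb bc (Lv j); congr is_L2.
by apply/funext => x; rewrite !mxE.
Qed.

Definition inner v w : R := \int[leb]_(x in D) dotrv (v x) (w x).

Lemma dotrv_integrable v w : L2v v -> L2v w ->
  leb.-integrable D (EFin \o (fun x => dotrv (v x) (w x))).
Proof.
move=> Lv Lw; have := @integrable_sum _ _ R leb D mD _ (index_enum 'I_d) predT
  (fun j => EFin \o (fun x => v x ord0 j * w x ord0 j)).
move=> /(_ (fun j _ => is_L2_integrableM (Lv j) (Lw j))).
by apply: eq_integrable => // x _ /=; rewrite /dotrv sumEFin.
Qed.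

Lemma innerC v w : inner v w = inner w v.
Proof.
by apply: eq_Rintegral => x _; apply: eq_bigr => j _; rewrite mulrC.
Qed.

Lemma innerDl c v w u : L2v v -> L2v w -> L2v u ->
  inner (c *: v + w) u = c * inner v u + inner w u.
Proof.
move=> Lv Lw Lu; rewrite /inner -RintegralZl //; last exact: dotrv_integrable.
rewrite -RintegralD //.
- apply: eq_Rintegral => x _; rewrite /dotrv mulr_sumr -big_split /=.
  by apply: eq_bigr => j _; rewrite !mxE; ring.
- by have := integrableZl mD c (dotrv_integrable Lv Lu); apply: eq_integrable.
- exact: dotrv_integrable.
Qed.

Lemma dotrv_ge0 (x : E) : 0 <= dotrv x x.
Proof. by apply: sumr_ge0 => j _; rewrite -expr2 sqr_ge0. Qed.

Lemma inner_ge0 v : 0 <= inner v v.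
Proof. by apply: Rintegral_ge0 => x _; exact: dotrv_ge0. Qed.

Definition nrm v : R := Num.sqrt (inner v v).

Lemma nrm_ge0 v : 0 <= nrm v. Proof. exact: sqrtr_ge0. Qed.

Lemma nrm_sqr v : nrm v ^+ 2 = inner v v.
Proof. by rewrite sqr_sqrtr // inner_ge0. Qed.

Lemma inner_fin v w : L2v v -> L2v w ->
  (\int[leb]_(x in D) (dotrv (v x) (w x))%:E)%E = (inner v w)%:E.
Proof.
by move=> Lv Lw; rewrite /inner /Rintegral fineK // integrable_fin_num //; exact: dotrv_integrable.
Qed.

Lemma l2normE v : L2v v -> l2norm D v = (nrm v)%:E.
Proof.
move=> Lv; rewrite /l2norm inner_fin // poweR_EFin; congr (_%:E).
by rewrite powR12_sqrt // inner_ge0.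
Qed.

Lemma innerZl c v u : L2v v -> L2v u -> inner (c *: v) u = c * inner v u.
Proof.
move=> Lv Lu; have L0 := L2v0.
rewrite -[c *: v]addr0 innerDl //; have := innerDl 1 L0 L0 Lu.
by rewrite scaler0 addr0 mul1r => /(congr1 (fun t => t - inner 0 u)); rewrite subrr addrK => <-; rewrite addr0.
Qed.

Lemma innerDr c v w u : L2v v -> L2v w -> L2v u ->
  inner u (c *: v + w) = c * inner u v + inner u w.
Proof. by move=> *; rewrite innerC innerDl // !(innerC u). Qed.

Lemma cauchy_schwarz v w : L2v v -> L2v w -> `|inner v w| <= nrm v * nrm w.
Proof.
move=> Lv Lw; rewrite -[leRHS]ger0_norm ?mulr_ge0 ?nrm_ge0 //.
rewrite -ler_sqr ?nnegrE ?normr_ge0 // !real_normK ?num_real //.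
rewrite exprMn !nrm_sqr.
have q t : 0 <= t ^+ 2 * inner v v + 2 * t * inner v w + inner w w.
  have Lq : L2v (t *: v + w) by exact: L2vD.
  have := inner_ge0 (t *: v + w); rewrite innerDl // !innerDr // (innerC w v).
  by congr (_ <= _); ring.
have a0 := inner_ge0 v; have [a1|a1] := ltP 0 (inner v v); last first.
  have a2 : inner v v = 0 by apply/eqP; rewrite eq_le a1 a0.
  rewrite a2 mul0r; move: q; rewrite a2; set b := inner v w; set c := inner w w => q.
  have [->|b0] := eqVneq b 0; first by rewrite expr0n.
  (* The quadratic degenerates to an affine function of t, which takes the value - 1 at this t. *)
  have := q (- (c + 1) / (2 * b)); rewrite mulr0 add0r.
  have -> : 2 * (- (c + 1) / (2 * b)) * b = - (c + 1) by field.
  lra.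
have := q (- inner v w / inner v v).
set a := inner v v in a1 *; set b := inner v w; set c := inner w w.
have -> : (- b / a) ^+ 2 * a + 2 * (- b / a) * b + c = (a * c - b ^+ 2) / a.
  by field; rewrite gt_eqF.
by rewrite pmulr_lge0 ?invr_gt0 // subr_ge0.
Qed.

Lemma nrmD v w : L2v v -> L2v w -> nrm (v + w) <= nrm v + nrm w.
Proof.
move=> Lv Lw; rewrite -ler_sqr ?nnegrE ?addr_ge0 ?nrm_ge0 //.
rewrite sqrrD !nrm_sqr -{1 2}[v]scale1r.
have Lvw : L2v (1 *: v + w) by exact: L2vD.
rewrite innerDl // !innerDr // (innerC w v) !mul1r.
by have := cauchy_schwarz Lv Lw; have := ler_norm (inner v w); rewrite mulr2n; lra.
Qed.

Lemma nrmZ c v : L2v v -> nrm (c *: v) = `|c| * nrm v.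
Proof.
move=> Lv; have Lcv : L2v (c *: v) by rewrite -[c *: v]addr0; apply: L2vD => //; exact: L2v0.
rewrite /nrm innerZl // innerC innerZl // mulrA -expr2 sqrtrM ?sqr_ge0 //.
by rewrite sqrtr_sqr.
Qed.

Lemma inner_bounded_ge (b : E -> R) c m v : measurable_fun D b ->
  (forall x, D x -> `|b x| <= c) -> (forall x, D x -> m <= b x) -> L2v v ->
  m * inner v v <= inner (fun x => b x *: v x) v.
Proof.
move=> mb bc bm Lv; have Lbv := L2v_bounded mb bc Lv.
rewrite /inner -RintegralZl //; last exact: dotrv_integrable.
apply: le_Rintegral => //.
- by have := integrableZl mD m (dotrv_integrable Lv Lv); apply: eq_integrable.
- exact: dotrv_integrable.
- move=> x Dx; have -> : dotrv (b x *: v x) (v x) = b x * dotrv (v x) (v x).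
    by rewrite /dotrv mulr_sumr; apply: eq_bigr => j _; rewrite !mxE mulrA.
  by rewrite ler_wpM2r ?dotrv_ge0 // bm.
Qed.

Lemma nrm_bounded (b : E -> R) c v : measurable_fun D b -> 0 <= c ->
  (forall x, D x -> `|b x| <= c) -> L2v v -> nrm (fun x => b x *: v x) <= c * nrm v.
Proof.
move=> mb c0 bc Lv; have Lbv := L2v_bounded mb bc Lv.
rewrite -ler_sqr ?nnegrE ?mulr_ge0 ?nrm_ge0 // exprMn !nrm_sqr.
rewrite /inner -RintegralZl //; last exact: dotrv_integrable.
apply: le_Rintegral => //.
- exact: dotrv_integrable.
- by have := integrableZl mD (c ^+ 2) (dotrv_integrable Lv Lv); apply: eq_integrable.
- move=> x Dx; have -> : dotrv (b x *: v x) (b x *: v x) = (b x) ^+ 2 * dotrv (v x) (v x).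
    by rewrite /dotrv mulr_sumr; apply: eq_bigr => j _; rewrite !mxE; ring.
  rewrite ler_wpM2r ?dotrv_ge0 // -[leLHS]real_normK ?num_real //.
  by rewrite ler_pXn2r // ?nnegrE // bc.
Qed.

End square_integrable.

(** * Scalar functions obtained by testing gradients *)

Section complex_pairing.
Local Open Scope complex_scope.
Context {R : realType} (d : nat) (D : set 'rV[R]_d).
Hypothesis mD : measurable D.
Local Notation E := 'rV[R]_d.
Local Notation leb := (@lebesgue_row R d).
Local Notation C := R[i].
Local Notation normc := (@Normc.normc R).
Local Notation L2v := (L2v D).
Local Notation inner := (inner D).
Local Notation nrm := (nrm D).
Implicit Types (w : h1funC (R := R) d) (psi : E -> E).

Definition rgrad w : E -> E := nabla (re_h1 w).
Definition igrad w : E -> E := nabla (im_h1 w).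

Lemma rgradD w w' : rgrad (w + w') = rgrad w + rgrad w'.
Proof.
apply/funext => x; apply/rowP => j.
rewrite -[RHS]/((rgrad w x + rgrad w' x) ord0 j) [RHS]mxE /rgrad /nabla /= !mxE.
by case: (w.2 x ord0 j) => ? ?; case: (w'.2 x ord0 j) => ? ?.
Qed.

Lemma igradD w w' : igrad (w + w') = igrad w + igrad w'.
Proof.
apply/funext => x; apply/rowP => j.
rewrite -[RHS]/((igrad w x + igrad w' x) ord0 j) [RHS]mxE /igrad /nabla /= !mxE.
by case: (w.2 x ord0 j) => ? ?; case: (w'.2 x ord0 j) => ? ?.
Qed.

Lemma rgradZ (c : C) w : rgrad (c *: w) = complex.Re c *: rgrad w + (- complex.Im c) *: igrad w.
Proof.
apply/funext => x; apply/rowP => j.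
rewrite -[RHS]/((complex.Re c *: rgrad w x + - complex.Im c *: igrad w x) ord0 j).
rewrite /rgrad /igrad /nabla /= !mxE.
by case: c => a b; case: (w.2 x ord0 j) => p q /=; rewrite mulNr.
Qed.

Lemma igradZ (c : C) w : igrad (c *: w) = complex.Re c *: igrad w + complex.Im c *: rgrad w.
Proof.
apply/funext => x; apply/rowP => j.
rewrite -[RHS]/((complex.Re c *: igrad w x + complex.Im c *: rgrad w x) ord0 j).
rewrite /rgrad /igrad /nabla /= !mxE.
by case: c => a b; case: (w.2 x ord0 j) => p q /=.
Qed.

Definition L2C w := L2v (rgrad w) /\ L2v (igrad w).

Lemma L2vZ (c : R) (v : E -> E) : L2v v -> L2v (c *: v).
Proof. by move=> Lv; rewrite -[c *: v]addr0; apply: (L2vD mD) => //; exact: L2v0. Qed.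

Lemma L2vS (v w : E -> E) : L2v v -> L2v w -> L2v (v + w).
Proof. by move=> Lv Lw; rewrite -[v]scale1r; exact: (L2vD mD). Qed.

Lemma L2CD (c : C) w w' : L2C w -> L2C w' -> L2C (c *: w + w').
Proof.
move=> [r1 i1] [r2 i2]; split; rewrite ?rgradD ?igradD ?rgradZ ?igradZ;
  by apply: L2vS => //; apply: L2vS; exact: L2vZ.
Qed.

Lemma H10_L2v (w : h1fun d) : H10 D w -> L2v (nabla w).
Proof. by case. Qed.

Lemma H10C_L2C w : H10C D w -> L2C w.
Proof. by move=> [/H10_L2v ? /H10_L2v ?]. Qed.

(** The test field is real, so the pairing is complex linear in w and turns a derivative with values
    in the complexified space into a scalar derivative. *)
Definition pairing w psi : C := (inner (rgrad w) psi) +i* (inner (igrad w) psi).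

Lemma pairingD (c : C) w w' psi : L2C w -> L2C w' -> L2v psi ->
  pairing (c *: w + w') psi = c * pairing w psi + pairing w' psi.
Proof.
move=> [r1 i1] [r2 i2] Lp; rewrite /pairing rgradD igradD rgradZ igradZ.
have e1 (v v' : E -> E) : L2v v -> L2v v' -> inner (v + v') psi = inner v psi + inner v' psi.
  by move=> Lv Lv'; rewrite -{1}[v]scale1r (innerDl mD) // mul1r.
have Z := L2vZ.
rewrite !e1 //; try (by apply: L2vS; exact: L2vZ); try exact: L2vZ.
rewrite !(innerZl mD) //.
by case: c => a b; apply/eqP; rewrite eq_complex /=; apply/andP; split; apply/eqP; ring.
Qed.

Lemma normVC_L2C w : L2C w ->
  normVC D w = (Num.sqrt (inner (rgrad w) (rgrad w) + inner (igrad w) (igrad w)))%:E.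
Proof.
move=> [Lr Li]; rewrite /normVC.
have -> : (\int[leb]_(x in D) (\sum_j normc (w.2 x ord0 j) ^+ 2)%:E)%E =
   (inner (rgrad w) (rgrad w) + inner (igrad w) (igrad w))%:E.
  rewrite EFinD -(inner_fin mD Lr Lr) -(inner_fin mD Li Li) -integralD //;
    try exact: dotrv_integrable.
  apply: eq_integral => x _; rewrite -EFinD; congr (_%:E).
  rewrite /dotrv -big_split /=; apply: eq_bigr => j _; rewrite !mxE.
  case: (w.2 x ord0 j) => p q /=; rewrite sqr_sqrtr ?expr2 //.
  by rewrite addr_ge0 // -expr2 sqr_ge0.
rewrite poweR_EFin; congr (_%:E); rewrite powR12_sqrt //.
by rewrite addr_ge0 // inner_ge0.
Qed.

Lemma pairing_bound w psi (V : R) : L2C w -> L2v psi ->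
  (normVC D w <= V%:E)%E -> normc (pairing w psi) <= 2 * V * nrm psi.
Proof.
move=> Lw Lp; rewrite normVC_L2C // lee_fin; have [Lr Li] := Lw => h.
have hr : nrm (rgrad w) <= V.
  apply: le_trans h; rewrite ler_wsqrtr // lerDl; exact: inner_ge0.
have hi : nrm (igrad w) <= V.
  apply: le_trans h; rewrite ler_wsqrtr // lerDr; exact: inner_ge0.
apply: le_trans (normc_le _ _) _.
apply: le_trans (lerD (cauchy_schwarz mD Lr Lp) (cauchy_schwarz mD Li Lp)) _.
rewrite -mulrDl ler_wpM2r ?nrm_ge0 //; lra.
Qed.

Section extension.
Context {N : nat} (lo hi tau : 'I_N -> R) (u : 'rV[R]_N -> h1fun (R := R) d).
Hypothesis lohi : forall n, lo n < hi n.
Hypothesis tau_gt0 : forall n, 0 < tau n.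
Hypothesis u_H10 : forall y, box lo hi y -> H10 D (u y).

Definition complex_line (y : 'rV[R]_N) (n : 'I_N) (z : C) : 'rV[C]_N :=
  \row_k (if k == n then z else (y ord0 k)%:C).

Lemma complex_line_Sigma y n z t : box lo hi y -> lo n <= t <= hi n ->
  normc (z - t%:C) <= tau n -> Sigma lo hi tau (complex_line y n z).
Proof.
move=> yb tI zt k; rewrite mxE.
have inf_le (z' : C) t' : lo k <= t' <= hi k -> normc (z' - t'%:C) <= tau k ->
    inf [set normc (z' - t%:C) | t in `[lo k, hi k]%classic] <= tau k.
  move=> t'I; apply: le_trans; apply: ge_inf.
    by exists 0 => _ [t'' _ <-]; exact: normc_ge0.
  by exists t' => //=; rewrite in_itv.
case: eqP => [ekn|_]; first by apply: (inf_le _ t); rewrite ekn.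
apply: (inf_le _ (y ord0 k)) => //; rewrite subrr Normc.normc0 ltW //.
Qed.

(** Freezing all coordinates but one and pairing with psi yields a scalar function, holomorphic
    around the interval. M is chosen before y, n, psi and p, so the estimate is uniform and
    proportional to [nrm psi]. *)
Lemma line_approximation : bounded_holomorphic_extension D lo hi tau u ->
  exists2 M : R, 0 <= M & forall y n psi p, box lo hi y -> L2v psi ->
  exists2 Q : {poly R}, (size Q <= p)%N & forall t, lo n <= t <= hi n ->
    `|inner (nabla (u (upd y n t))) psi - Q.[t]| <=
    approx_cst (sigma_n lo hi tau n) * (M * nrm psi) * expR (- (p%:R * sigma_n lo hi tau n)).
Proof.
move=> [Om [U [oO SO [UH10 Uhol] [M UM] Uu]]].
exists (2 * `|M|); first by rewrite mulr_ge0.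
move=> y n psi p yb Lp; pose h z := pairing (U (complex_line y n z)) psi.
have hhol z t : lo n <= t <= hi n -> normc (z - t%:C) <= tau n -> hol_at h z.
  move=> tI zt; have zS := complex_line_Sigma yb tI zt; have zO := SO _ zS.
  have [G GH10 HG] := Uhol _ zO.
  apply/hol_atC; exists (pairing (G n) psi) => e e0.
  (* This divisor absorbs the factor 2 [nrm psi] of [pairing_bound]; the added 1 keeps it positive
     when psi has norm 0. *)
  have np1 : 0 < 2 * (nrm psi + 1) by rewrite mulr_gt0 // ltr_wpDl // nrm_ge0.
  have [r r0 Hr] := HG _ (divr_gt0 e0 np1).
  have [r' r'0 Hr'] := oO _ zO.
  exists (Num.min r r'); first by rewrite lt_min r0.
  move=> z'; rewrite lt_min => /andP[zr zr'].
  have disc (s : R) : 0 < s -> normc (z' - z) < s ->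
      cpolydisc (complex_line y n z) s (complex_line y n z').
    by move=> s0 zs k; rewrite !mxE; case: eqP => // _; rewrite subrr Normc.normc0.
  have z'O : Om (complex_line y n z') by apply: Hr'; exact: disc.
  have := Hr _ z'O (disc _ r0 zr).
  have -> : \sum_k (complex_line y n z' ord0 k - complex_line y n z ord0 k) *: G k =
      (z' - z) *: G n.
    rewrite (bigD1 n) //= !mxE eqxx big1 ?addr0 // => k kn.
    by rewrite !mxE (negPf kn) subrr scale0r.
  have -> : \sum_k normc (complex_line y n z' ord0 k - complex_line y n z ord0 k) =
      normc (z' - z).
    rewrite (bigD1 n) //= !mxE eqxx big1 ?addr0 // => k kn.
    by rewrite !mxE (negPf kn) subrr Normc.normc0.
  have LU z1 : Om (complex_line y n z1) -> L2C (U (complex_line y n z1)).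
    by move=> z1O; apply: H10C_L2C; exact: UH10.
  have LG : L2C (G n) by apply: H10C_L2C.
  set W := (U _ - U _ - _)%R.
  have WE : W = (- (z' - z)) *: G n + ((-1) *: U (complex_line y n z) + U (complex_line y n z')).
    by rewrite /W scaleNr scaleN1r addrC [- U _ + _]addrC.
  have L1 : L2C (-1 *: U (complex_line y n z) + U (complex_line y n z')).
    by apply: L2CD; exact: LU.
  have LW : L2C W by rewrite WE; apply: L2CD.
  move=> /(pairing_bound LW Lp).
  rewrite WE !pairingD //; try exact: LU.
  rewrite -/(h z) -/(h z').
  have -> : - (z' - z) * pairing (G n) psi + (-1 * h z + h z') =
    h z' - h z - pairing (G n) psi * (z' - z) by ring.
  move=> le1; apply: (le_trans le1).
  have -> : 2 * (e / (2 * (nrm psi + 1)) * normc (z' - z)) * nrm psi =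
     e * normc (z' - z) * (nrm psi / (nrm psi + 1)).
    by field; rewrite gt_eqF // ltr_wpDl // nrm_ge0.
  rewrite ler_piMr //; first by rewrite mulr_ge0 ?normc_ge0 // ltW.
  by rewrite ler_pdivrMr ?ltr_wpDl ?nrm_ge0 // mul1r lerDl.
have hbound z t : lo n <= t <= hi n -> normc (z - t%:C) <= tau n ->
    normc (h z) <= 2 * `|M| * nrm psi.
  move=> tI zt; have zS := complex_line_Sigma yb tI zt.
  apply: pairing_bound => //; first by apply: H10C_L2C; apply: UH10; exact: SO.
  by apply: le_trans (UM _ zS) _; rewrite lee_fin ler_norm.
have [Q sQ HQ] := polynomial_approximation p (lohi n) (tau_gt0 n) hhol hbound.
exists Q => // t tI; have := HQ t tI.
have yt : box lo hi (upd y n t).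
  by move=> k; rewrite mxE; case: eqP => // ->.
suff -> : complex.Re (h t%:C) = inner (nabla (u (upd y n t))) psi by [].
have := Uu _ yt; rewrite /=.
have -> : map_mx (real_complex R) (upd y n t) = complex_line y n t%:C.
  by apply/rowP => k; rewrite !mxE; case: eqP.
move=> [Ure _].
have zS : Sigma lo hi tau (complex_line y n t%:C).
  by apply: (complex_line_Sigma yb tI); rewrite subrr Normc.normc0 ltW.
have [LUr _] := H10C_L2C (UH10 _ (SO _ zS)).
have Lu := H10_L2v (u_H10 yt).
rewrite [LHS]/(inner (rgrad _) psi).
set v := rgrad _ in LUr *; set v' := nabla _ in Lu *.
have vv' : nabla (re_h1 (U (complex_line y n t%:C)) - u (upd y n t)) = (-1) *: v' + v.
  by rewrite scaleN1r addrC.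
have Ld : L2v (-1 *: v' + v) by exact: (L2vD mD).
(* The extension agrees with u only up to a field of norm 0, whose pairing with psi vanishes by the
   Cauchy-Schwarz inequality. *)
move: Ure; rewrite /normV vv' (l2normE mD Ld) => -[n0].
have := cauchy_schwarz mD Ld Lp; rewrite n0 mul0r normr_le0 (innerDl mD) // => /eqP.
by rewrite mulN1r addrC => /eqP; rewrite subr_eq0 => /eqP.
Qed.

End extension.
End complex_pairing.

(** * Index sets selected by the algorithm *)

Section downward_closed_sets.
Context {N : nat}.
Implicit Types (I : set (midx N)) (i j : midx N) (n k : 'I_N).

Definition idx_le j i := forall n, (j n <= i n)%N.

Lemma idx_le_pred j i n : idx_le j i -> (j n < i n)%N -> idx_le j (idx_pred i n).
Proof.
move=> ji jn k; rewrite ffunE; case: eqP => [->|_]; last by rewrite subn0.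
by rewrite leq_subRL ?(leq_ltn_trans _ jn) // addnC addn1.
Qed.

Lemma downward_closed_le I i j : downward_closed I -> I i -> posidx j ->
  idx_le j i -> I j.
Proof.
move=> dcI; have [m] := ubnP (\sum_n (i n - j n)); elim: m i => // m IH i.
rewrite ltnS => sm Ii jpos ji; case: (pselect (i = j)) => [<- //|ij].
have [n jn] : exists n, (j n < i n)%N.
  apply: contrapT => /forallNP H; apply: ij; apply/ffunP => n.
  by apply/eqP; rewrite eqn_leq ji andbT leqNgt; apply/negP; exact: H.
have in1 : (1 < i n)%N by rewrite (leq_ltn_trans (jpos n)).
apply: (IH (idx_pred i n)) => //; [|exact: dcI|exact: idx_le_pred].
apply: leq_trans sm.
rewrite (bigD1 n) //= [leqRHS](bigD1 n) //= idx_pred_same -addSn leq_add //.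
  by rewrite -ltnS; lia.
by apply: leq_sum => k kn; rewrite idx_pred_other.
Qed.

Lemma posidx_pred i n : posidx i -> (1 < i n)%N -> posidx (idx_pred i n).
Proof.
move=> ipos in1 k; rewrite ffunE; case: eqP => [->|_]; last by rewrite subn0.
by rewrite subn_gt0.
Qed.

Lemma idx_predC i n k : idx_pred (idx_pred i n) k = idx_pred (idx_pred i k) n.
Proof. by apply/ffunP => l; rewrite !ffunE -!subnDA addnC. Qed.

(** If j - e_n is not in I, the direction k that puts j in the margin differs from n, and j - e_k -
    e_n is in I; hence j - e_n is in the margin as well. The set serves as a competitor that bounds
    the completion. *)
Lemma margin_below_closed I i : downward_closed I ->
  downward_closed (I `|` [set j | margin I j /\ idx_le j i]).
Proof.
move=> dcI j n [Ij|[[jpos nIj [k jk Ijk]] ji]] jn; first by left; exact: dcI.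
case: (pselect (I (idx_pred j n))) => [?|nIjn]; [by left|right].
have kn : k != n by apply/eqP => kn; apply: nIjn; rewrite -kn.
split; last first.
  move=> l; apply: leq_trans (ji l); rewrite ffunE; exact: leq_subr.
split => //; first exact: posidx_pred.
exists k; first by rewrite idx_pred_other.
rewrite idx_predC; apply: dcI => //.
by rewrite idx_pred_other // eq_sym.
Qed.

Lemma completion_sub I i : downward_closed I -> margin I i ->
  completion I i `<=` [set j | margin I j /\ idx_le j i].
Proof.
move=> dcI Mi j; apply; split.
  by split; [move=> k []|exact: margin_below_closed].
by move=> k ->; split.
Qed.

Lemma completion_self I i : completion I i i.
Proof. by move=> A [_]; apply. Qed.

(** The completion is an intersection of admissible sets: for j in it, an index j - e_n outside I
    belongs to each of them, hence to the intersection. *)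
Lemma completion_closed I i : downward_closed I ->
  downward_closed (I `|` completion I i).
Proof.
move=> dcI j n [Ij|Aj] jn; first by left; exact: dcI.
case: (pselect (I (idx_pred j n))) => [?|nIjn]; [by left|right].
move=> A [[AM dcA] iA]; have AjA : A j by apply: Aj; split.
by have [] := dcA j n (or_intror AjA) jn.
Qed.

End downward_closed_sets.

Section run.
Context {R : realType} (d N : nat) (D : set 'rV[R]_d) (lo hi : 'I_N -> R)
  (a : 'rV[R]_N -> 'rV[R]_d -> R) (u : 'rV[R]_N -> h1fun (R := R) d).
Variable I : nat -> set (midx N).
Hypothesis runI : SC_run D lo hi a u I.
Implicit Types (i j : midx N) (n k : 'I_N) (l m : nat).

(** A margin index is a unit step away from I, and a completion consists of margin indices; so the
    largest coordinate grows by at most one per step. *)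
Record run_inv l : Prop := RunInv {
  run_closed : downward_closed (I l);
  run_pos : forall i, I l i -> posidx i;
  run_le : forall i n, I l i -> (i n <= l.+1)%N }.

Lemma margin_run_le l i n : run_inv l -> margin (I l) i -> (i n <= l.+2)%N.
Proof.
move=> inv [_ _ [k ik Iik]]; have := run_le inv n Iik; rewrite ffunE; lia.
Qed.

Lemma run_invariant l : run_inv l.
Proof.
have [I0 IS] := runI; elim: l => [|l IH].
  split; rewrite I0.
  - by move=> i n ->; rewrite ffunE.
  - by move=> i -> n; rewrite ffunE.
  - by move=> i n ->; rewrite ffunE.
have [i [Mi _ _] IE] := IS l; have dcl := run_closed IH.
have sub := completion_sub dcl Mi.
split; rewrite IE.
- exact: completion_closed.
- by move=> j [/(run_pos IH)//|/sub[[]]].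
- move=> j n [/(run_le IH n)|/sub[/(margin_run_le n IH)//]]; exact: leqW.
Qed.

Lemma run_subset l m : (l <= m)%N -> I l `<=` I m.
Proof.
have [_ IS] := runI; elim: m => [|m IH]; first by rewrite leqn0 => /eqP ->.
rewrite leq_eqVlt => /predU1P[->//|]; rewrite ltnS => /IH lm j /lm Ij.
by have [i _ ->] := IS m; left.
Qed.

Lemma cube_finite L (S : set (midx N)) : (forall i n, S i -> (i n <= L)%N) ->
  finite_set S /\ (#|` fset_set S| <= L.+1 ^ N)%N.
Proof.
move=> SL; pose g (f : {ffun 'I_N -> 'I_L.+1}) : midx N := [ffun n => nat_of_ord (f n)].
have Sg : S `<=` [set g f | f in [set: {ffun 'I_N -> 'I_L.+1}]].
  move=> i Si; exists [ffun n => inord (i n)] => //.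
  by apply/ffunP => n; rewrite !ffunE inordK // ltnS SL.
have finT : finite_set [set: {ffun 'I_N -> 'I_L.+1}] by exact: finite_finset.
have finG := finite_image g finT.
have finS : finite_set S by exact: sub_finite_set Sg finG.
split => //.
pose s := [seq g f | f <- enum {ffun 'I_N -> 'I_L.+1}].
have -> : (L.+1 ^ N = size s)%N by rewrite size_map -cardE card_ffun !card_ord.
apply: uniq_leq_size; first exact: fset_uniq.
move=> i; rewrite in_fset_set // => /set_mem /Sg [f _ <-].
by apply: map_f; rewrite mem_enum.
Qed.

Lemma run_finite l : finite_set (I l).
Proof.
have [//] := @cube_finite l.+1 (I l) (fun i n Ii => run_le (run_invariant l) n Ii).
Qed.

(** Every step adds at least one new index. Choosing one per step gives l + 1 distinct elements of
    I_l, whatever the sizes of the completions. *)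
Lemma run_enumeration : exists e : nat -> midx N,
  (forall l m, (m <= l)%N -> I l (e m)) /\ injective e.
Proof.
have [I0 IS] := runI.
have step l : exists i, I l.+1 i /\ ~ I l i.
  have [i [[_ nIi _] _ _] ->] := IS l; exists i; split => //.
  by right; exact: completion_self.
have [f fP] := choice step.
pose e m := if m is m'.+1 then f m' else idx_one N.
have Ie m : I m (e m) by case: m => [|m] /=; [rewrite I0|case: (fP m)].
have Il l m : (m <= l)%N -> I l (e m) by move=> ml; exact: run_subset ml _ (Ie m).
exists e; split=> // m m'; wlog mm' : m m' / (m < m')%N.
  move=> H em; have [mm'|m'm|//] := ltngtP m m'; first exact: H.
  by symmetry; apply: H.
case: m' mm' => // m'; rewrite ltnS => mm' em.
by have [_ []] := fP m'; rewrite -[f m']/(e m'.+1) -em; exact: Il.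
Qed.

Hypothesis N_gt0 : (0 < N)%N.

Lemma run_large_coordinate l : exists K n i,
  [/\ (l.+1 <= K ^ N)%N, I l i & i n = K].
Proof.
have n0 : 'I_N by case: N N_gt0 => // N' _; exact: ord0.
have [e [Ie einj]] := run_enumeration.
pose P (q : nat) := `[< exists n i, I l i /\ i n = q >].
have exP : exists q, P q.
  by exists (e 0%N n0); apply/asboolP; exists n0, (e 0%N); split => //; exact: Ie.
have ubP (q : nat) : P q -> (q <= l.+1)%N.
  by move=> /asboolP[n [i [Ii <-]]]; exact: (run_le (run_invariant l) n Ii).
have [K /asboolP[n [i [Ii iK]]] Kmax] := ex_maxnP exP ubP.
exists K, n, i; split => //.
have K0 : (0 < K)%N by rewrite -iK; exact: (run_pos (run_invariant l) Ii).
have KE : K = K.-1.+1 by rewrite prednK.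
(* Coordinates lie between 1 and K; shifting them by one embeds the l + 1 indices in a set with K ^
   N elements. *)
pose g (m : 'I_l.+1) : {ffun 'I_N -> 'I_K.-1.+1} := [ffun k => inord (e m k).-1].
have ek (m : 'I_l.+1) k : (0 < e m k <= K)%N.
  have Im : I l (e m) by apply: Ie; rewrite -ltnS.
  rewrite (run_pos (run_invariant l) Im) Kmax //; apply/asboolP.
  by exists k, (e m).
have ginj : injective g.
  move=> m m' gm; apply/val_inj/einj; apply/ffunP => k.
  have := congr1 (fun h : {ffun 'I_N -> 'I_K.-1.+1} => nat_of_ord (h k)) gm.
  have hm := ek m k; have hm' := ek m' k.
  have lt1 : ((e m k).-1 < K.-1.+1)%N by lia.
  have lt2 : ((e m' k).-1 < K.-1.+1)%N by lia.
  rewrite !ffunE !inordK // => /(congr1 succn).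
  by rewrite !prednK //; [case/andP: hm'|case/andP: hm].
by have := leq_card g ginj; rewrite card_ord card_ffun !card_ord -KE.
Qed.

(* K is the largest coordinate reached after l steps, and l' is the step at
   which K is first reached in direction n. *)
Lemma run_selection l : (0 < l)%N -> exists K n l' i,
  [/\ (l.+1 <= K ^ N)%N, (1 < K)%N, (l' < l)%N, selected D lo hi a u (I l') i &
    forall j, completion (I l') i j ->
      [/\ j n = K, I l' (idx_pred j n) &
          forall k, (1 < j k)%N -> I l' (idx_pred j k) -> k = n]].
Proof.
move=> l0; have [K [n [i0 [lK Ii0 i0K]]]] := run_large_coordinate l.
have K1 : (1 < K)%N.
  case: K lK {i0K} => [|[|//]]; first by rewrite exp0n.
  by rewrite exp1n; move: l0; lia.
have [I0 IS] := runI.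
pose P m := `[< exists i, I m i /\ (K <= i n)%N >].
have exP : exists m, P m.
  by exists l; apply/asboolP; exists i0; rewrite i0K.
have [m /asboolP[j0 [Ij0 Kj0]] mmin] := ex_minnP exP.
have ml : (m <= l)%N by apply: mmin; apply/asboolP; exists i0; rewrite i0K.
case: m Ij0 mmin ml => [|l'] Ij0 mmin ml.
  by move: Ij0 Kj0; rewrite I0 => ->; rewrite ffunE; move: K1; lia.
have small i : I l' i -> (i n < K)%N.
  move=> Ii; rewrite ltnNge; apply/negP => Ki.
  by have := mmin l'; rewrite ltnn => H; suff: false by []; apply: H; apply/asboolP; exists i.
have [i seli IE] := IS l'; exists K, n, l', i; split => //.
have [Mi _ _] := seli; have dcl := run_closed (run_invariant l').
have sub := completion_sub dcl Mi.
have Kin : (K <= i n)%N.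
  move: Ij0; rewrite IE => -[/small|/sub[_ /(_ n)]]; first by rewrite ltnNge Kj0.
  exact: leq_trans.
have [ipos nIi [k0 ik0 Iik0]] := Mi.
(* Otherwise the backward neighbour of i in direction k0 would lie in I_l' with n-th coordinate at
   least K, before K is reached. *)
have k0n : k0 = n.
  apply/eqP/negPn/negP => k0n; have := small _ Iik0.
  by rewrite idx_pred_other 1?eq_sym // ltnNge Kin.
rewrite k0n in ik0 Iik0.
have iK : i n = K.
  by have := small _ Iik0; rewrite idx_pred_same; move: Kin; lia.
move=> j Aj; have [[jpos nIj [k1 jk1 Ijk1]] ji] := sub j Aj.
(* If j_n < K, then j lies below i - e_n, which is in I_l', and downward closedness would put j
   there too. *)
have jK : j n = K.
  apply/eqP; rewrite eqn_leq -{1}iK ji /= leqNgt; apply/negP => jlt.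
  apply: nIj; apply: (downward_closed_le dcl Iik0 jpos).
  by apply: idx_le_pred => //; rewrite iK.
have only k : (1 < j k)%N -> I l' (idx_pred j k) -> k = n.
  move=> _ Ijk; apply/eqP/negPn/negP => kn; have := small _ Ijk.
  by rewrite idx_pred_other 1?eq_sym // jK ltnn.
split => //.
by have := only _ jk1 Ijk1 => k1n; rewrite k1n in Ijk1.
Qed.

End run.

(** * Growth of the exponents *)

Section growth.
Context {R : realType}.
Implicit Types (s : R) (c l K N : nat).

(** 2 ^ K is the N-th power of exp (K ln 2 / N), and x <= exp x. The lemma is applied with 2 N in
    place of N. *)
Lemma pow2_ge_pow N K : (0 < N)%N ->
  (ln 2 / N%:R) ^+ N * K%:R ^+ N <= 2 ^+ K :> R.
Proof.
move=> N0; have ln2 : 0 <= ln 2 :> R by rewrite ln_ge0 // ler1n.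
have N0' : 0 < N%:R :> R by rewrite ltr0n.
have -> : 2 ^+ K = expR (ln 2 / N%:R * K%:R) ^+ N :> R.
  rewrite -expRM_natr; have -> : ln 2 / N%:R * K%:R * N%:R = ln 2 * K%:R :> R.
    by field; rewrite gt_eqF.
  by rewrite expRM_natr lnK // posrE.
rewrite -exprMn; set x := ln 2 / N%:R * K%:R.
have x0 : 0 <= x by rewrite mulr_ge0 // divr_ge0 // ltW.
rewrite ler_pXn2r ?nnegrE ?expR_ge0 //.
by apply: le_trans (expR_ge1Dx x); rewrite lerDr.
Qed.

(** Factoring k ^ N - t ^ N >= 1 bounds k - t from below by 1 / (N k ^ (N - 1)). Then 1 - exp (- y)
    >= y / 2 for 0 <= y <= 1 turns this into a relative gap between the powers of 2. *)
Lemma powR2_gap N K (t : R) : (0 < N)%N -> 0 <= t -> t ^+ N + 1 <= K%:R ^+ N -> (0 < K)%N ->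
  2 ^+ K * (ln 2 / (2 * N%:R * K%:R ^+ N.-1)) <= 2 ^+ K - 2 `^ t.
Proof.
move=> N0 t0 tK K0; set k := K%:R.
have ln2 : 0 < ln 2 :> R by rewrite ln_gt0 // ltr1n.
have k1 : 1 <= k by rewrite /k ler1n.
have N1 : 1 <= N%:R :> R by rewrite ler1n.
have kN : 1 <= k ^+ N.-1 by rewrite exprn_ege1.
have D1 : 1 <= N%:R * k ^+ N.-1 by rewrite mulr_ege1.
have tk : t < k.
  rewrite ltNge; apply/negP => kt.
  have : k ^+ N <= t ^+ N by rewrite ler_pXn2r // nnegrE // (le_trans ler01).
  move: tK; rewrite -/k; lra.
have gap : 1 <= (k - t) * (N%:R * k ^+ N.-1).
  have : 1 <= k ^+ N - t ^+ N by move: tK; rewrite -/k; lra.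
  move=> /le_trans; apply; rewrite subrXX; have kt : 0 <= k - t by rewrite subr_ge0 ltW.
  rewrite ler_wpM2l //.
  have -> : N%:R * k ^+ N.-1 = \sum_(i < N) k ^+ N.-1.
    by rewrite sumr_const card_ord mulr_natl.
  apply: ler_sum => i _.
  have {2}-> : N.-1 = (N.-1 - i + i)%N by rewrite subnK // -ltnS prednK.
  rewrite exprD.
  have k0 : 0 <= k by lra.
  by rewrite ler_wpM2l ?exprn_ge0 // lerXn2r // ?nnegrE // ltW.
have -> : 2 `^ t = 2 ^+ K * expR (- ((k - t) * ln 2)).
  have e2 : 2 ^+ K = expR (ln 2 * k) :> R by rewrite /k expRM_natr lnK ?posrE.
  rewrite e2 -expRD /powR gt_eqF //.
  by congr expR; ring.
rewrite -[X in X - _]mulr1 -mulrBr ler_pM2l ?exprn_gt0 //.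
set x := (k - t) * ln 2; set D := N%:R * k ^+ N.-1 in D1 gap *.
have xge : ln 2 / D <= x by rewrite ler_pdivrMr ?(lt_le_trans ltr01) // /x; nra.
have ln2le : ln 2 <= 1 :> R.
  have := @le_ln1Dx R 1; rewrite (_ : 1 + 1 = 2) //; apply; lra.
set y := ln 2 / D in xge.
have D0 : 0 < D by lra.
have yD : y * D = ln 2 by rewrite /y; field; rewrite gt_eqF.
have y0 : 0 < y by rewrite divr_gt0.
have y1 : y <= 1 by nra.
have -> : ln 2 / (2 * N%:R * k ^+ N.-1) = y / 2.
  by rewrite /y /D; field; rewrite !gt_eqF //; lra.
have ey : expR (- x) <= expR (- y) by rewrite ler_expR lerN2.
have e0 : 0 < expR (- y) by exact: expR_gt0.
have e1 : expR (- y) * (1 + y) <= 1.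
  have := ler_wpM2l (ltW e0) (expR_ge1Dx y).
  by rewrite -expRD addNr expR0.
nra.
Qed.

(** With 2 ^ K >= c0 K ^ (2 N), the gap is at least of order K ^ (N + 1), whereas c (l + 3) is at
    most of order K ^ N because l < K ^ N. The difference can be positive only for K below a fixed
    threshold. *)
Lemma exponent_bound s N c : 0 < s -> (0 < N)%N ->
  exists B : R, forall l K (t : R), (l.+1 <= K ^ N)%N -> 0 <= t -> t ^+ N = l%:R ->
    (c * l.+3)%:R - s / 4 * (2 ^+ K - 2 `^ t) <= B.
Proof.
move=> s0 N0.
have ln2 : 0 < ln 2 :> R by rewrite ln_gt0 // ltr1n.
pose c0 := (ln 2 / (2 * N)%:R) ^+ (2 * N) : R.
have N0' : 0 < N%:R :> R by rewrite ltr0n.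
have c00 : 0 < c0 by rewrite exprn_gt0 // divr_gt0 // ltr0n muln_gt0.
pose A := s / 4 * (ln 2 / (2 * N%:R)) * c0.
have A0 : 0 < A.
  apply: mulr_gt0 => //; apply: mulr_gt0; first by rewrite divr_gt0.
  by apply: divr_gt0 => //; rewrite pmulr_rgt0.
(* The factor 3 comes from l + 3 <= 3 (l + 1) <= 3 K ^ N. *)
pose c3 : R := 3 * c%:R.
have c30 : 0 <= c3 by rewrite mulr_ge0.
exists (c3 * (c3 / A) ^+ N) => l K t lK t0 tl.
have K0 : (0 < K)%N by case: K lK => //; rewrite exp0n.
have k1 : 1 <= K%:R :> R by rewrite ler1n.
set k : R := K%:R in k1 *.
have tk : t ^+ N + 1 <= k ^+ N by rewrite tl natr1 -natrX ler_nat.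
have gap := powR2_gap N0 t0 tk K0.
have p2 := @pow2_ge_pow (2 * N) K; rewrite muln_gt0 N0 /= in p2.
have {}p2 := p2 isT.
have kN1 : 0 < k ^+ N.-1 by rewrite exprn_gt0 // (lt_le_trans ltr01).
have h1 : A * k ^+ N.+1 <= s / 4 * (2 ^+ K - 2 `^ t).
  have s4 : 0 < s / 4 by rewrite divr_gt0.
  set g := ln 2 / (2 * N%:R * k ^+ N.-1) in gap.
  have -> : A * k ^+ N.+1 = s / 4 * (c0 * k ^+ (2 * N) * g).
    have -> : k ^+ (2 * N) = k ^+ N.+1 * k ^+ N.-1.
      by rewrite -exprD; congr (_ ^+ _); clear - N0; lia.
    by rewrite /A /g; field; rewrite !gt_eqF.
  rewrite ler_pM2l //; apply: le_trans gap; apply: ler_wpM2r p2.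
  by apply: divr_ge0; [exact: ltW|apply: ltW; rewrite !mulr_gt0].
have h2 : (c * l.+3)%:R <= c3 * k ^+ N.
  rewrite /c3 natrM [3 * _]mulrC -mulrA ler_wpM2l //.
  rewrite -natrX -natrM ler_nat; clear - lK; lia.
have h3 : c3 * k ^+ N - A * k ^+ N.+1 <= c3 * (c3 / A) ^+ N.
  have k0 : 0 <= k by lra.
  have cA0 : 0 <= c3 / A by rewrite divr_ge0 // ltW.
  have kN0 : 0 < k ^+ N by rewrite exprn_gt0 //; lra.
  have kA0 : 0 <= A * k ^+ N.+1 by rewrite mulr_ge0 ?exprn_ge0 // ltW.
  have [kc|kc] := leP k (c3 / A).
    apply: (@le_trans _ _ (c3 * k ^+ N)); first lra.
    by rewrite ler_wpM2l // lerXn2r // ?nnegrE.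
  apply: (@le_trans _ _ 0); last by rewrite mulr_ge0 // exprn_ge0.
  rewrite exprS mulrA -mulrBl.
  have : c3 < A * k by move: kc; rewrite ltr_pdivrMr // mulrC.
  by nra.
lra.
Qed.

Lemma final_estimate s N c : 0 < s -> (0 < N)%N ->
  exists2 C : R, 0 < C & forall l K, (0 < l)%N -> (l.+1 <= K ^ N)%N -> (1 < K)%N ->
    2 ^+ (c * l.+3) * expR (- ((2 ^+ K / 4 - 1) * s)) <=
    C * l%:R ^+ 5 * (l%:R / N%:R) ^+ (4 * N) * 2 `^ (l%:R * (1 - N%:R^-1))
      * expR (- (s / 2) * levelR (l%:R `^ N%:R^-1)).
Proof.
move=> s0 N0; have [B HB] := exponent_bound c s0 N0.
have NR : 0 < N%:R :> R by rewrite ltr0n.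
(* The power of N cancels the denominator in (l / N) ^ (4 N). The factor exp (2 s) covers the term s
   coming from 2 ^ K / 4 - 1 and the term s / 2 coming from [lev] below. The prefactors that remain
   are at least 1. *)
exists (N%:R ^+ (4 * N) * expR (B + 2 * s)).
  by rewrite mulr_gt0 ?expR_gt0 // exprn_gt0.
move=> l K l0 lK K1; set t := l%:R `^ N%:R^-1.
have l1 : 1 <= l%:R :> R by rewrite ler1n.
have t0 : 0 <= t by exact: powR_ge0.
have tN : t ^+ N = l%:R.
  by rewrite -powR_mulrn // -powRrM mulVf ?gt_eqF // powRr1.
have t1 : 1 <= t.
  rewrite leNgt; apply/negP => t1.
  have : t ^+ N < 1 by rewrite exprn_ilt1 // -lt0n.
  by rewrite tN; lra.
have Bt := HB l K t lK t0 tN.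
have lev : levelR t <= 2 `^ t / 2 + 1.
  have e : 2 `^ (t - 1) = 2 `^ t / 2 :> R.
    by rewrite powRB ?powRr1 //; apply/implyP => _; rewrite pnatr_eq0.
  rewrite /levelR; case: ifP => tle; last by rewrite e.
  have -> : t = 1 by apply/eqP; rewrite eq_le tle.
  by rewrite powRr1 // divff // lerDl.
have twoe : 2 ^+ (c * l.+3) <= expR (c * l.+3)%:R :> R.
  rewrite -[(c * l.+3)%:R]mul1r expRM_natr lerXn2r ?nnegrE ?expR_ge0 //.
  by have := expR_ge1Dx (1 : R).
apply: (@le_trans _ _ (expR (B + 2 * s) * expR (- (s / 2) * levelR t))).
  apply: (@le_trans _ _ (expR (c * l.+3)%:R * expR (- ((2 ^+ K / 4 - 1) * s)))).
    by rewrite ler_wpM2r ?expR_ge0.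
  rewrite -!expRD ler_expR.
  have : s / 2 * levelR t <= s / 2 * (2 `^ t / 2 + 1).
    by rewrite ler_wpM2l // divr_ge0 // ltW.
  lra.
rewrite ler_wpM2r ?expR_ge0 //.
have h1 : 1 <= l%:R ^+ 5 :> R by rewrite exprn_ege1.
have h2 : N%:R ^+ (4 * N) * (l%:R / N%:R) ^+ (4 * N) = l%:R ^+ (4 * N) :> R.
  by rewrite -exprMn mulrC divfK ?gt_eqF.
have h3 : 1 <= l%:R ^+ (4 * N) :> R by rewrite exprn_ege1.
have h4 : 1 <= 2 `^ (l%:R * (1 - N%:R^-1)) :> R.
  rewrite -[leLHS](powRr0 2) ler_powR ?ler1n // mulr_ge0 //.
  by rewrite subr_ge0 invf_le1 // ler1n.
set e := expR (B + 2 * s); have e0 : 0 < e by exact: expR_gt0.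
have -> : N%:R ^+ (4 * N) * e * l%:R ^+ 5 * (l%:R / N%:R) ^+ (4 * N) * 2 `^ (l%:R * (1 - N%:R^-1))
  = e * (l%:R ^+ 5 * (N%:R ^+ (4 * N) * (l%:R / N%:R) ^+ (4 * N)) * 2 `^ (l%:R * (1 - N%:R^-1))) by ring.
rewrite h2; apply: ler_peMr; first exact: ltW.
by rewrite mulr_ege1 // mulr_ege1.
Qed.

End growth.

(** * Reliability and decay of the estimators *)

Section multiplication.
Context {R : realType} (d : nat).
Local Notation E := 'rV[R]_d.

Definition mulfun (b : E -> R) (w : E -> E) : E -> E := fun x => b x *: w x.

Lemma mulfun_is_linear b : linear (mulfun b).
Proof.
move=> c v w; apply/funext => x; rewrite /mulfun !fctE /=.
by rewrite scalerDr !scalerA mulrC.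
Qed.

HB.instance Definition _ b :=
  GRing.isLinear.Build R (E -> E) (E -> E) *:%R (mulfun b) (mulfun_is_linear b).

End multiplication.

Section galerkin.
Context {R : realType} (d N : nat) (D : set 'rV[R]_d).
Local Notation E := 'rV[R]_d.
Hypothesis mD : measurable D.
Variables (lo hi : 'I_N -> R) (lohi : forall n, lo n < hi n).
Variables (f : E -> R) (a0 : E -> R) (a : 'I_N -> E -> R).
Hypotheses (a0_meas : measurable_fun D a0) (a_meas : forall n, measurable_fun D (a n)).
Variables (amin amax : R).
Hypothesis amin_gt0 : 0 < amin.
Hypothesis a_bounds : forall y x, box lo hi y -> D x -> amin <= coef a0 a y x <= amax.
Variable u : 'rV[R]_N -> h1fun (R := R) d.
Hypothesis u_sol : is_solution D (box lo hi) (coef a0 a) f u.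
Local Notation V := (fun y => nabla (u y)).
Local Notation box := (box lo hi).
Local Notation L2v := (L2v D).
Local Notation inner := (inner D).
Local Notation nrm := (nrm D).
Local Notation sparse I := (@sparse_sum R N lo hi (E -> E) I).
Local Notation amul := (affmul (mulfun a0) (fun k => mulfun (a k))).
Local Notation surplus j := (@hsurplus R N lo hi j (E -> E)).
Implicit Types (y : 'rV[R]_N) (I : set (midx N)) (n k : 'I_N).

Lemma box_lo : box (\row_n lo n).
Proof. by move=> n; rewrite mxE lexx ltW. Qed.

Lemma gradient_L2v y : box y -> L2v (V y).
Proof. by move=> /u_sol[[_ ? _] _]. Qed.

Lemma coef_meas y : measurable_fun D (coef a0 a y).
Proof.
apply: measurable_funD => //; apply: measurable_sum => n.
by apply: measurable_funM => //; exact: measurable_cst.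
Qed.

Lemma coef_norm y x : box y -> D x -> `|coef a0 a y x| <= amax.
Proof.
move=> yb Dx; have /andP[h1 h2] := a_bounds yb Dx.
by rewrite ger0_norm // (le_trans (ltW amin_gt0)).
Qed.

Definition coef_bound : R := \sum_n `|amax - amin| / (hi n - lo n).

Lemma coef_bound_ge0 : 0 <= coef_bound.
Proof. by apply: sumr_ge0 => n _; rewrite divr_ge0 // subr_ge0 ltW. Qed.

(** The values of a at two corners of the box that differ only in coordinate k both lie between amin
    and amax, and their difference is a_k (hi_k - lo_k). *)
Lemma coef_component k x : D x -> `|a k x| <= coef_bound.
Proof.
move=> Dx; have hl : 0 < hi k - lo k by rewrite subr_gt0.
apply: (@le_trans _ _ (`|amax - amin| / (hi k - lo k))); last first.
  rewrite /coef_bound (bigD1 k) //= lerDl; apply: sumr_ge0 => n _.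
  by rewrite divr_ge0 // subr_ge0 ltW.
have b2 : box (upd (\row_n lo n) k (hi k)).
  by move=> n; rewrite updE; case: eqP => [->|_]; [rewrite lexx ltW|exact: box_lo].
have /andP[h1 h2] := a_bounds box_lo Dx; have /andP[h3 h4] := a_bounds b2 Dx.
have e : coef a0 a (upd (\row_n lo n) k (hi k)) x - coef a0 a (\row_n lo n) x =
    a k x * (hi k - lo k).
  rewrite /coef opprD addrACA subrr add0r -sumrB (bigD1 k) //= upd_same mxE -mulrBr.
  by rewrite big1 ?addr0 // => n nk; rewrite updE (negPf nk) subrr.
rewrite ler_pdivlMr // -(gtr0_norm hl) -normrM -e.
rewrite (le_trans _ (ler_norm _)) // ler_norml; apply/andP; split; lra.
Qed.

Lemma affmul_coef (v : 'rV[R]_N -> E -> E) y : amul v y = mulfun (coef a0 a y) (v y).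
Proof.
apply/funext => x; rewrite /affmul /mulfun /coef scalerDl.
rewrite -[LHS]/((a0 x *: v y x) + (\sum_k coordmul k (mulfun (a k) \o v)) y x).
congr (_ + _); rewrite !fct_sumE /= scaler_suml; apply: eq_bigr => k _.
by rewrite /coordmul /mulfun /= !fctE scalerA mulrC.
Qed.

Lemma sparse_app (W : lmodType R) I (v : 'rV[R]_N -> W) y :
  sparse_sum lo hi I v y = \sum_(i <- fset_set I) hsurplus lo hi i v y.
Proof. by rewrite /sparse_sum fct_sumE. Qed.

Lemma sparse_nabla I y : finite_set I ->
  nabla (sparse_interp lo hi I u y) = sparse I V y.
Proof.
move=> finI; rewrite sparse_interpE // sparse_app [RHS]sparse_app.
have nablaD (c : R) (v w : h1fun (R := R) d) : True -> True ->
  nabla (c *: v + w) = c *: nabla v + nabla w by [].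
have nabla_sum (r : seq (midx N)) (F : midx N -> h1fun (R := R) d) :
    nabla (\sum_(i <- r) F i) = \sum_(i <- r) nabla (F i).
  by elim: r => [|i r IH]; rewrite ?big_nil ?big_cons //= -IH.
rewrite nabla_sum; apply: eq_bigr => i _; rewrite !hsurplusE.
exact: (@tensor_lin R N lo hi (h1fun (R := R) d) (E -> E) lohi (fun=> True)
  Logic.I (fun _ _ _ _ _ => Logic.I) (@nabla R d) nablaD setT (enum 'I_N) i u
  (fun _ _ _ _ _ => Logic.I) (fun _ _ => Logic.I) y Logic.I).
Qed.

Lemma a_nabla_S_affmul I : finite_set I ->
  a_nabla_S lo hi (coef a0 a) u I = amul (sparse I V).
Proof.
move=> finI; apply/funext => y; rewrite affmul_coef /a_nabla_S.
by rewrite sparse_nabla.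
Qed.

(** Both sides equal the integral of f u(y'), in which y does not occur; the corner lo serves as a
    fixed reference. *)
Lemma galerkin y y' : box y -> box y' ->
  inner (mulfun (coef a0 a y) (V y)) (V y') =
  inner (mulfun (coef a0 a (\row_n lo n)) (V (\row_n lo n))) (V y').
Proof.
have cE z : inner (mulfun (coef a0 a z) (V z)) (V y') =
    fine (\int[@lebesgue_row R d]_(x in D) (coef a0 a z x * dotrv (V z x) (V y' x))%:E).
  congr fine; apply: eq_integral => x _; congr (_%:E).
  by rewrite /dotrv mulr_sumr; apply: eq_bigr => j _; rewrite mxE mulrA.
move=> yb y'b; have [H10y' _] := u_sol y'b.
rewrite !cE; have [_ ->//] := u_sol yb; have [_ ->//] := u_sol box_lo.
Qed.

Lemma amul_L2v y (w : E -> E) : box y -> L2v w -> L2v (mulfun (coef a0 a y) w).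
Proof.
move=> yb; apply: (L2v_bounded mD (c := amax)); first exact: coef_meas.
by move=> x; exact: coef_norm.
Qed.

Lemma closed_sparse (P : (E -> E) -> Prop) I (v : 'rV[R]_N -> E -> E) : P 0 ->
  (forall (c : R) v w, P v -> P w -> P (c *: v + w)) ->
  (forall y, box y -> P (v y)) -> forall y, box y -> P (sparse I v y).
Proof.
move=> P0 PD Pv y yb; rewrite sparse_app.
elim: (enum_fset _) => [|i s IH]; first by rewrite big_nil.
rewrite big_cons -[surplus i v y]scale1r; apply: (PD) => //.
exact: (tensor_submod lohi P0 PD (enum 'I_N) i (@box_stable R N lo hi) Pv yb).
Qed.

Lemma sparse_lin (L : (E -> E) -> R^o) I (v : 'rV[R]_N -> E -> E) :
  (forall (c : R) v w, L2v v -> L2v w -> L (c *: v + w) = c *: L v + L w) ->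
  (forall y, box y -> L2v (v y)) -> forall y, box y ->
  L (sparse I v y) = (sparse_sum lo hi I (L \o v)) y.
Proof.
move=> LD Lv y yb; rewrite !sparse_app.
have L20 : L2v 0 := L2v0 D.
have LDD (c : R) p q : L2v p -> L2v q -> L2v (c *: p + q) by exact: L2vD.
have Lt i : L2v (surplus i v y).
  exact: (tensor_submod lohi L20 LDD (enum 'I_N) i (@box_stable R N lo hi) Lv yb).
elim: (enum_fset _) => [|i s IH].
  rewrite !big_nil; apply: (submod_lin0 L20); exact: LD.
rewrite !big_cons -IH -{1}[surplus i v y]scale1r LD //; last first.
  elim: s {IH} => [|j s IH]; first by rewrite big_nil.
  by rewrite big_cons -[surplus j v y]scale1r; exact: LDD.
rewrite scale1r; congr (_ + _).
rewrite !hsurplusE.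
exact: (@tensor_lin R N lo hi (E -> E) R^o lohi L2v L20 LDD L LD box _ i _ (@box_stable R N lo hi) Lv _ yb).
Qed.

Lemma surplus_one_cst (W : lmodType R) (c : W) :
  @hsurplus R N lo hi (idx_one N) W (fun=> c) = fun=> c.
Proof.
rewrite hsurplusE; elim: (enum 'I_N) => //= n s ->.
rewrite ffunE dirsurplusE /= interp0 subr0 interp_exact //.
move=> y; exists (fun=> c) => t; by rewrite big_ord1 expr0 scale1r.
Qed.

(** A constant is its own surplus of index (1, ..., 1), as one node reproduces it, and S_I
    reproduces every surplus with index in I. *)
Lemma sparse_cst (W : lmodType R) (c : W) I : finite_set I -> I (idx_one N) ->
  sparse_sum lo hi I (fun=> c) = fun=> c.
Proof.
move=> finI I1; rewrite -[RHS](surplus_one_cst c).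
by rewrite -{1}(surplus_one_cst c); exact: sparse_surplus.
Qed.

(* By Galerkin orthogonality, a (u - S_I u) + r is orthogonal to the span of the
   snapshots of u, where r is the sum of the surpluses over the margin. *)
Lemma reliability I y : finite_set I -> downward_closed I ->
  (forall i, I i -> posidx i) -> I (idx_one N) -> box y ->
  nrm (V y - sparse I V y) <= amin^-1 *
    nrm (\sum_(j <- fset_set (margin I)) surplus j (amul (sparse I V)) y).
Proof.
move=> finI dcI Ipos I1 yb.
set r := (\sum_(j <- _) _)%R; set e := V y - sparse I V y.
have PD0 : L2v 0 := L2v0 D.
have PDD (c : R) v w : L2v v -> L2v w -> L2v (c *: v + w) by exact: L2vD.
have LS : forall y, box y -> L2v (sparse I V y).
  by apply: closed_sparse => //; exact: gradient_L2v.
have LaV y' : box y' -> L2v (amul V y').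
  by move=> yb'; rewrite affmul_coef; apply: amul_L2v => //; exact: gradient_L2v.
have LaS y' : box y' -> L2v (amul (sparse I V) y').
  by move=> yb'; rewrite affmul_coef; apply: amul_L2v => //; exact: LS.
have Lr : L2v r.
  rewrite /r; elim: (enum_fset _) => [|j s IH]; first by rewrite big_nil.
  rewrite big_cons -[surplus j _ y]scale1r; apply: (PDD) => //.
  exact: (tensor_submod lohi PD0 PDD (enum 'I_N) j (@box_stable R N lo hi) LaS yb).
have Le : L2v e.
  by rewrite /e addrC -scaleN1r; apply: (PDD); [exact: LS|exact: gradient_L2v].
have LSaV : L2v (sparse I (amul V) y) by apply: closed_sparse.
(* The product is split into its components in I and in the margin. Those in I agree with the
   components of a \nabla u, since they involve u only through indices in I. *)
have rE : amul (sparse I V) y = sparse I (amul V) y + r.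
  rewrite {1}(affmul_sparse_margin lohi _ _ V finI Ipos) sparse_affmul //.
  by rewrite -[LHS]/(sparse I (amul V) y + (\sum_(j <- fset_set (margin I)) surplus j (amul (sparse I V))) y) fct_sumE.
have Lae : L2v (mulfun (coef a0 a y) e) by exact: amul_L2v.
have aeE : mulfun (coef a0 a y) e = amul V y - sparse I (amul V) y - r.
  by rewrite -addrA -opprD -rE !affmul_coef -linearB.
have key y' : box y' -> inner (mulfun (coef a0 a y) e + r) (V y') = 0.
  move=> yb'; have LV := gradient_L2v yb'.
  rewrite aeE subrK addrC -scaleN1r innerDl //; last exact: LaV.
  have -> : inner (sparse I (amul V) y) (V y') = inner (amul V y) (V y').
    pose L (w : E -> E) : R^o := inner w (V y').
    have Llin (c : R) v w : L2v v -> L2v w -> L (c *: v + w) = c *: L v + L w.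
      by move=> Lv Lw; rewrite /L innerDl.
    rewrite -[LHS]/(L _) (@sparse_lin L) //.
    (* By Galerkin orthogonality the scalar function to be interpolated is constant on the box, and
       S_I reproduces constants. *)
    have -> : sparse_sum lo hi I (L \o amul V) y = sparse_sum lo hi I (fun=> L (amul V y)) y.
      rewrite !sparse_app; apply: eq_bigr => i _; rewrite !hsurplusE.
      apply: (tensor_eq_on lohi _ _ (@box_stable R N lo hi)) => // z zb.
      by rewrite /L /= !affmul_coef galerkin // [RHS]galerkin.
    by rewrite sparse_cst.
  by rewrite mulN1r addNr.
(* The error is a linear combination of values of [V] at points of the box, so it inherits the
   orthogonality from them. *)
pose P (w : E -> E) := L2v w /\ inner (mulfun (coef a0 a y) e + r) w = 0.
have Laer : L2v (mulfun (coef a0 a y) e + r).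
  by rewrite -[mulfun _ e]scale1r; exact: PDD.
have P0 : P 0.
  split => //; have := innerDr mD 1 PD0 PD0 Laer.
  by rewrite scaler0 addr0 mul1r => /(congr1 (fun t => t - inner (mulfun (coef a0 a y) e + r) 0)); rewrite subrr addrK.
have PD (c : R) v w : P v -> P w -> P (c *: v + w).
  move=> [Lv v0] [Lw w0]; split; first exact: PDD.
  by rewrite innerDr // v0 w0 mulr0 addr0.
have Pe : P e.
  rewrite /e addrC -scaleN1r; apply: (PD).
    apply: closed_sparse => // z zb; split; [exact: gradient_L2v|exact: key].
  split; [exact: gradient_L2v|exact: key].
have [_] := Pe; rewrite -[mulfun _ e]scale1r innerDl // mul1r => /eqP.
rewrite addr_eq0 => /eqP ier.
have ge := inner_bounded_ge mD (coef_meas y) (fun x Dx => coef_norm yb Dx)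
  (fun x Dx => proj1 (andP (a_bounds yb Dx))) Le.
have : amin * nrm e ^+ 2 <= nrm r * nrm e.
  rewrite nrm_sqr; apply: le_trans ge _; rewrite -[X in inner X]/(mulfun (coef a0 a y) e) ier.
  by apply: le_trans (cauchy_schwarz mD Lr Le); rewrite -normrN ler_norm.
have [e0|e0] := ltP 0 (nrm e).
  rewrite expr2 mulrA ler_pM2r // => h.
  by rewrite -ler_pdivrMl ?invr_gt0 // invrK.
move=> _; apply: le_trans e0 _; rewrite mulr_ge0 ?nrm_ge0 // invr_ge0 ltW //.
Qed.

End galerkin.

(** * Decay of the surplus in one direction *)

Section decay.
Context {R : realType} {N : nat} (lo hi : 'I_N -> R).
Hypothesis lohi : forall n, lo n < hi n.
Local Notation surplus_op n K :=
  (fun (W : lmodType R) (v : 'rV[R]_N -> W) =>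
     dirsurplus lo hi n K (coordmul n (interp lo hi n (level K.-1) v))).

Lemma poly_in_horner n m (Q : {poly R}) : (size Q <= m)%N ->
  poly_in n m (fun z : 'rV[R]_N => Q.[z ord0 n] : R^o).
Proof.
move=> sQ y; exists (fun l => Q`_l) => t.
rewrite upd_same (horner_coef_wide _ sQ); apply: eq_bigr => l _.
by rewrite mulrC.
Qed.

(** The operator annihilates Q: interpolation at level K - 1 reproduces Q, and since its size is
    strictly below the number of nodes, y_n Q is still reproduced at the levels K - 1 and K. There
    remains h - Q, with two stability constants and the bound Y on y_n. *)
Lemma scalar_decay n K (h : 'rV[R]_N -> R^o) (Q : {poly R}) (B Y : R)
    (y : 'rV[R]_N) :
  0 <= B -> (size Q < level K.-1)%N -> lo n <= y ord0 n <= hi n ->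
  (forall t, lo n <= t <= hi n -> `|t| <= Y) ->
  (forall t, lo n <= t <= hi n -> `|h (upd y n t) - Q.[t]| <= B) ->
  `|surplus_op n K _ h y| <= (4 * level K)%:R * (Y * ((2 * level K.-1)%:R * B)).
Proof.
move=> B0 sQ yn Yb hQ; set q : 'rV[R]_N -> R^o := fun z => Q.[z ord0 n].
have Y0 : 0 <= Y by rewrite (le_trans _ (Yb _ yn)).
have -> : surplus_op n K _ h = surplus_op n K _ (h - q).
  rewrite linearB linearB linearB /= [X in _ - X](_ : _ = 0) ?subr0 //.
  rewrite (interp_exact lohi (poly_in_horner n (ltnW sQ))).
  apply: (dirsurplus_exact lohi); apply: poly_in_mono (poly_in_coordmul (poly_in_horner n (leqnn _))).
  exact: sQ.
(* The approximation by Q is known only along direction n through y, so the stability bounds are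
   applied on this segment instead of the box. *)
pose Z : set 'rV[R]_N := [set z | exists2 t, lo n <= t <= hi n & z = upd y n t].
have stZ : stable_dir lo hi Z n.
  by move=> z s [t _ ->] sI; exists s; rewrite ?upd_upd.
have Zy : Z y by exists (y ord0 n); rewrite ?upd_id.
have Zn z : Z z -> lo n <= z ord0 n <= hi n by move=> [t tI ->]; rewrite upd_same.
have PT0 : (fun _ : R^o => True) 0 by [].
apply: (@dirsurplus_bound R N lo hi R^o lohi (fun=> True) _ _ (fun x => `|x|) _ _ _ Z) => //.
- by move=> v w _ _; exact: ler_normD.
- by move=> c v _; rewrite normrM.
- by rewrite mulr_ge0 // mulr_ge0.
move=> z Zz; rewrite /coordmul normrM ler_pM //; first exact/Yb/Zn.
apply: (@interp_bound R N lo hi R^o lohi (fun=> True) _ _ (fun x => `|x|) _ _ _ Z) => //.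
- by move=> v w _ _; exact: ler_normD.
- by move=> c v _; rewrite normrM.
- exact: Zn.
by move=> _ [t tI ->]; rewrite /q !fctE upd_same; exact: hQ.
Qed.

Lemma surplus_op_lin (W W' : lmodType R) (P : W -> Prop) (L : W -> W') n K
    (v : 'rV[R]_N -> W) y : P 0 ->
  (forall (c : R) w w', P w -> P w' -> P (c *: w + w')) ->
  (forall (c : R) w w', P w -> P w' -> L (c *: w + w') = c *: L w + L w') ->
  (forall y, box lo hi y -> P (v y)) -> box lo hi y ->
  P (surplus_op n K _ v y) /\ L (surplus_op n K _ v y) = surplus_op n K _ (L \o v) y.
Proof.
move=> P0 PD LD Pv yb; have st := @box_stable R N lo hi n.
have PI z : box lo hi z -> P (interp lo hi n (level K.-1) v z).
  exact: (interp_submod lohi P0 PD _ st Pv).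
have PC z : box lo hi z -> P (coordmul n (interp lo hi n (level K.-1) v) z).
  by move=> zb; rewrite -[coordmul _ _ _]addr0; apply: (PD) => //; exact: PI.
split; first exact: (dirsurplus_submod lohi P0 PD _ st PC yb).
rewrite (dirsurplus_lin lohi P0 PD LD _ st PC yb).
have e z : box lo hi z -> (L \o coordmul n (interp lo hi n (level K.-1) v)) z =
    coordmul n (interp lo hi n (level K.-1) (L \o v)) z.
  move=> zb; rewrite /= /coordmul -(interp_lin lohi P0 PD LD _ st Pv zb).
  rewrite -[_ *: _]addr0 LD //; last exact: PI.
  by rewrite (submod_lin0 P0 LD) addr0.
by rewrite /dirsurplus !(interp_eq_on lohi _ st e yb).
Qed.

(* Testing against the surplus itself reduces the bound to scalar functions. *)
Lemma gradient_decay d (D : set 'rV[R]_d) n K (V : 'rV[R]_N -> 'rV[R]_d -> 'rV[R]_d)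
    p (eps Y : R) y : measurable D -> 0 <= eps -> (p < level K.-1)%N ->
  (forall t, lo n <= t <= hi n -> `|t| <= Y) ->
  (forall y, box lo hi y -> L2v D (V y)) ->
  (forall y psi, box lo hi y -> L2v D psi ->
    exists2 Q : {poly R}, (size Q <= p)%N & forall t, lo n <= t <= hi n ->
      `|inner D (V (upd y n t)) psi - Q.[t]| <= eps * nrm D psi) ->
  box lo hi y ->
  L2v D (surplus_op n K _ V y) /\
  nrm D (surplus_op n K _ V y) <=
    (4 * level K)%:R * (Y * ((2 * level K.-1)%:R * eps)).
Proof.
move=> mD eps0 pK Yb LV VQ yb; have Y0 : 0 <= Y by rewrite (le_trans _ (Yb _ (yb n))).
have PD (c : R) v w : L2v D v -> L2v D w -> L2v D (c *: v + w) by exact: L2vD.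
set w := (surplus_op n K _ V y).
have Lw : L2v D w.
  have LD (c : R) (v v' : 'rV[R]_d -> 'rV[R]_d) :
      L2v D v -> L2v D v' -> (0 : R^o) = c *: (0 : R^o) + 0.
    by rewrite scaler0 addr0.
  by have [] := @surplus_op_lin _ R^o (L2v D) (fun=> 0) n K V y (L2v0 D) PD LD LV yb.
split => //.
have LD (c : R) v v' : L2v D v -> L2v D v' ->
    (inner D (c *: v + v') w : R^o) = c *: (inner D v w : R^o) + inner D v' w.
  by move=> Lv Lv'; rewrite innerDl.
have [_ wE] := @surplus_op_lin _ R^o (L2v D) (fun v => inner D v w) n K V y (L2v0 D) PD LD LV yb.
have [Q sQ HQ] := VQ y w yb Lw.
have B0 : 0 <= eps * nrm D w by rewrite mulr_ge0 // nrm_ge0.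
have := @scalar_decay n K ((fun v => inner D v w : R^o) \o V) Q _ Y y B0
  (leq_ltn_trans sQ pK) (yb n) Yb HQ.
rewrite -wE -nrm_sqr ger0_norm ?sqr_ge0 //.
have [w0|w0 _] := ltP 0 (nrm D w); last first.
  by apply: le_trans w0 _; rewrite mulr_ge0 // mulr_ge0 // mulr_ge0.
by rewrite expr2 !mulrA ler_pM2r.
Qed.

End decay.

(** * Work, profit and the selected index *)

Section work.
Context {N : nat}.
Implicit Types (j : midx N).

Lemma work_gt0 j : posidx j -> (0 < work j)%N.
Proof.
move=> jpos; apply: prodn_gt0 => n; rewrite subn_gt0.
rewrite -{2}(prednK (jpos n)); exact: level_lt.
Qed.

Lemma work_le j q : (forall n, (j n <= q)%N) -> (work j <= 2 ^ (q * N))%N.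
Proof.
move=> jq; rewrite mulnC expnM.
have -> : ((2 ^ N) ^ q = \prod_(n < N) 2 ^ q)%N.
  by rewrite prod_nat_const card_ord -!expnM mulnC.
apply: leq_prod => n _; rewrite (leq_trans (leq_subr _ _)) //.
by rewrite (leq_trans (level_le_exp _)) // leq_exp2l.
Qed.

End work.

Section profit.
Context {R : realType} (d N : nat) (D : set 'rV[R]_d) (lo hi : 'I_N -> R)
  (a : 'rV[R]_N -> 'rV[R]_d -> R) (u : 'rV[R]_N -> h1fun (R := R) d).
Hypothesis lohi : forall n, lo n < hi n.
Local Notation zeta := (zeta D lo hi a u).
Local Notation profit := (profit D lo hi a u).
Implicit Types (I A : set (midx N)) (i j : midx N).

Lemma zeta_ge0 I j : (0 <= zeta I j)%E.
Proof.
have yb : box lo hi (\row_n lo n) by move=> n; rewrite mxE lexx ltW.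
apply: le_trans (ereal_sup_ubound _); last by exists (\row_n lo n).
exact: poweR_ge0.
Qed.

Lemma sum_le_size (T : eqType) (s : seq T) (F : T -> R) (B : R) :
  (forall x, x \in s -> F x <= B) -> \sum_(x <- s) F x <= (size s)%:R * B.
Proof.
move=> FB; rewrite big_seq_cond (le_trans (ler_sum _ (G := fun=> B) _)) //.
  by move=> x /andP[/FB].
by rewrite -big_seq_cond big_const_seq count_predT iter_addr addr0 mulr_natl.
Qed.

Lemma total_work_bounds A q : finite_set A -> A !=set0 ->
  (forall j, A j -> posidx j) -> (forall j n, A j -> (j n <= q)%N) ->
  1 <= \sum_(j \in A) ((work j)%:R : R) <= (q.+1 ^ N * 2 ^ (q * N))%:R.
Proof.
move=> finA [j0 Aj0] Apos Aq; rewrite fsbig_finite //=.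
have [_ cA] := cube_finite Aq; apply/andP; split.
  rewrite (big_fsetD1 j0) /=; last by rewrite in_fset_set //; exact: mem_set.
  rewrite -[leLHS]addr0 lerD ?sumr_ge0 //.
  by rewrite ler1n work_gt0 //; exact: Apos.
apply: (le_trans (sum_le_size (B := (2 ^ (q * N))%:R) _)) => [j|].
  rewrite in_fset_set // => /set_mem Aj; rewrite ler_nat; apply: work_le => n.
  exact: Aq.
by rewrite -natrM ler_nat leq_mul2r cA orbT.
Qed.

(** An estimator is at most the sum over its own completion, which is its profit times its total
    work; maximality replaces the profit by that of i. As total works are at least 1, the latter is
    at most the number of indices times e. *)
Lemma selected_zeta I i q (e : R) : finite_set I -> downward_closed I ->
  selected D lo hi a u I i -> 0 <= e ->
  (forall j, completion I i j -> (zeta I j <= e%:E)%E) ->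
  (forall j n, margin I j -> (j n <= q)%N) ->
  forall j, margin I j ->
  (zeta I j <= ((q.+1 ^ N)%:R * e * (q.+1 ^ N * 2 ^ (q * N))%:R)%:E)%E.
Proof.
move=> finI dcI [Mi maxi _] e0 ze Mq j Mj.
have CM k k' : margin I k -> completion I k k' -> margin I k'.
  by move=> Mk /(completion_sub dcI Mk)[].
have finC k : margin I k -> finite_set (completion I k).
  by move=> Mk; apply: sub_finite_set (finite_margin finI) => k'; exact: CM.
have bounds k : margin I k ->
    1 <= \sum_(j \in completion I k) ((work j)%:R : R) <= (q.+1 ^ N * 2 ^ (q * N))%:R.
  move=> Mk; apply: total_work_bounds; first exact: finC.
  - by exists k; exact: completion_self.
  - by move=> k' /(CM k k' Mk)[].
  - by move=> k' n /(CM k k' Mk) /Mq.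
have pi : (profit I i <= ((q.+1 ^ N)%:R * e)%:E)%E.
  have /andP[w1 _] := bounds i Mi; rewrite /Defs.profit.
  have [_ cC] := cube_finite (fun k' n Ck' => Mq k' n (CM i k' Mi Ck')).
  apply: (@le_trans _ _ (\sum_(k \in completion I i) zeta I k)%E).
    rewrite -[leRHS]mule1 lee_wpmul2l //.
      by apply: fsume_ge0 => k _; exact: zeta_ge0.
    by rewrite lee_fin invf_le1 // (lt_le_trans ltr01).
  rewrite fsbig_finite //=; last exact: finC.
  have -> : (\sum_(k <- fset_set (completion I i)) zeta I k =
      (\sum_(k <- fset_set (completion I i)) fine (zeta I k))%:E)%E.
    rewrite -sumEFin big_seq [RHS]big_seq; apply: eq_bigr => k.
    rewrite in_fset_set; last exact: finC.
    move=> /set_mem /ze zk; rewrite fineK // ge0_fin_numE ?zeta_ge0 //.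
    exact: le_lt_trans zk (ltry _).
  rewrite lee_fin; apply: (le_trans (sum_le_size (B := e) _)) => [k|].
    rewrite in_fset_set; last exact: finC.
    move=> /set_mem /ze zk; rewrite -lee_fin fineK // ge0_fin_numE ?zeta_ge0 //.
    exact: le_lt_trans zk (ltry _).
  by rewrite ler_wpM2r // ler_nat.
have /andP[w1 w2] := bounds j Mj; set S := \sum_(k \in _) _ in w1 w2.
have S0 : 0 < S by rewrite (lt_le_trans ltr01).
apply: (@le_trans _ _ (\sum_(k \in completion I j) zeta I k)%E).
  rewrite fsbig_finite //=; last exact: finC.
  rewrite (big_fsetD1 j) /=; last first.
    by rewrite in_fset_set; [apply: mem_set; exact: completion_self|exact: finC].
  rewrite -[leLHS]adde0 leeD // sume_ge0 // => k _; exact: zeta_ge0.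
have -> : (\sum_(k \in completion I j) zeta I k = profit I j * S%:E)%E.
  by rewrite /Defs.profit -/S -muleA -EFinM mulVf ?gt_eqF // mule1.
apply: (@le_trans _ _ (((q.+1 ^ N)%:R * e)%:E * S%:E)%E).
  rewrite lee_wpmul2r //; first by rewrite lee_fin ltW.
  exact: (le_trans (maxi _ Mj) pi).
by rewrite -EFinM lee_fin ler_wpM2l // mulr_ge0.
Qed.

End profit.

(** * Bounds for the estimators and for the error *)

Section estimators.
Context {R : realType} (d N : nat) (D : set 'rV[R]_d).
Local Notation E := 'rV[R]_d.
Hypothesis mD : measurable D.
Variables (lo hi : 'I_N -> R) (lohi : forall n, lo n < hi n).
Variables (f : E -> R) (a0 : E -> R) (a : 'I_N -> E -> R).
Hypotheses (a0_meas : measurable_fun D a0) (a_meas : forall n, measurable_fun D (a n)).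
Variables (amin amax : R).
Hypothesis amin_gt0 : 0 < amin.
Hypothesis a_bounds : forall y x, box lo hi y -> D x -> amin <= coef a0 a y x <= amax.
Variable u : 'rV[R]_N -> h1fun (R := R) d.
Hypothesis u_sol : is_solution D (box lo hi) (coef a0 a) f u.
Local Notation V := (fun y => nabla (u y)).
Local Notation box := (box lo hi).
Local Notation L2v := (L2v D).
Local Notation nrm := (nrm D).
Local Notation sparse I := (@sparse_sum R N lo hi (E -> E) I).
Local Notation amul := (affmul (mulfun a0) (fun k => mulfun (a k))).
Local Notation surplus j := (@hsurplus R N lo hi j (E -> E)).
Local Notation zeta := (zeta D lo hi (coef a0 a) u).
Local Notation others k := (rem k (enum 'I_N)).
Implicit Types (y : 'rV[R]_N) (I J : set (midx N)) (n k : 'I_N) (i j : midx N).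

Let PD (c : R) (v w : E -> E) : L2v v -> L2v w -> L2v (c *: v + w).
Proof. exact: L2vD. Qed.

Lemma nrm_sum_le (T : eqType) (s : seq T) (F : T -> E -> E) (B : R) :
  (forall x, L2v (F x)) -> (forall x, x \in s -> nrm (F x) <= B) ->
  L2v (\sum_(x <- s) F x) /\ nrm (\sum_(x <- s) F x) <= (size s)%:R * B.
Proof.
move=> LF FB; have L s' : L2v (\sum_(x <- s') F x).
  elim: s' => [|x s' IH]; first by rewrite big_nil; exact: L2v0.
  by rewrite big_cons -[F x]scale1r; exact: PD.
split=> //; apply: le_trans (sum_le_size FB).
elim: s {FB} => [|x s IH].
  by rewrite !big_nil -(scale0r (0 : E -> E)) nrmZ ?normr0 ?mul0r //; exact: L2v0.
by rewrite !big_cons (le_trans (nrmD mD (LF x) (L s))) // lerD2l.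
Qed.

Lemma surplus_L2v j (v : 'rV[R]_N -> E -> E) y : (forall y, box y -> L2v (v y)) ->
  box y -> L2v (surplus j v y).
Proof.
move=> Lv yb.
exact: (tensor_submod lohi (L2v0 D) PD (enum 'I_N) j (@box_stable R N lo hi) Lv yb).
Qed.

Lemma nrm_tensor_le s i q (v : 'rV[R]_N -> E -> E) (B : R) y :
  0 <= B -> (size s <= N)%N -> (forall n, (i n <= q)%N) ->
  (forall y, box y -> L2v (v y)) -> (forall y, box y -> nrm (v y) <= B) ->
  box y -> nrm (tensor lo hi s i v y) <= (2 ^ ((q + 2) * N))%:R * B.
Proof.
move=> B0 sN iq Lv vB yb.
apply: le_trans (tensor_bound lohi (L2v0 D) PD (nrm_ge0 D) (nrmD mD) (nrmZ mD)
  s B0 iq Lv vB yb) _.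
by rewrite ler_wpM2r // ler_nat leq_exp2l // leq_mul.
Qed.

Lemma sparse_L2v I (v : 'rV[R]_N -> E -> E) y : (forall y, box y -> L2v (v y)) ->
  box y -> L2v (sparse I v y).
Proof. by move=> Lv; exact: (closed_sparse lohi I (L2v0 D) PD Lv). Qed.

Lemma amul_sparse_L2v I y : box y -> L2v (amul (sparse I V) y).
Proof.
move=> yb; rewrite affmul_coef.
apply: (amul_L2v mD a0_meas a_meas amin_gt0 a_bounds yb).
exact: (sparse_L2v I (gradient_L2v u_sol) yb).
Qed.

Lemma zeta_le I j (B : R) : finite_set I ->
  (zeta I j <= B%:E)%E <->
  forall y, box y -> nrm (surplus j (amul (sparse I V)) y) <= B.
Proof.
move=> finI; have e y : box y ->
    l2norm D (hsurplus lo hi j (a_nabla_S lo hi (coef a0 a) u I) y) =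
    (nrm (surplus j (amul (sparse I V)) y))%:E.
  move=> yb; rewrite (a_nabla_S_affmul lohi a0 a u finI) l2normE //.
  by apply: surplus_L2v => // z; exact: amul_sparse_L2v.
split=> [zB y yb|yB].
  rewrite -lee_fin -e //; apply: le_trans zB; apply: ereal_sup_ubound.
  by exists y.
by apply: ge_ereal_sup => _ [y yb <-]; rewrite e // lee_fin yB.
Qed.

(** The directions other than n contribute only stability constants, and multiplication by a_n the
    factor [coef_bound]; the smallness B comes from direction n alone. *)
Lemma zeta_directional I j n q (B : R) : finite_set I -> posidx j -> ~ I j ->
  (1 < j n)%N -> I (idx_pred j n) ->
  (forall k, (1 < j k)%N -> I (idx_pred j k) -> k = n) ->
  (forall k, (j k <= q)%N) -> 0 <= B ->
  (forall y, box y ->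
    let w := dirsurplus lo hi n (j n) (coordmul n (interp lo hi n (level (j n).-1) V)) y in
    L2v w /\ nrm w <= B) ->
  (zeta I j <= (coef_bound lo hi amin amax * ((2 ^ ((q + 2) * N))%:R * B))%:E)%E.
Proof.
move=> finI jpos nIj jn Ijn uniqn jq B0 wB; apply/(zeta_le j _ finI) => y yb.
rewrite (surplus_affmul_margin lohi _ _ V finI jpos nIj jn Ijn uniqn) /=.
rewrite hsurplus_coordmul_pred //; set w := dirsurplus _ _ _ _ _.
have Lw z : box z -> L2v (w z) by move=> /wB[].
have L : L2v (tensor lo hi (others n) j w y).
  exact: (tensor_submod lohi (L2v0 D) PD _ j (@box_stable R N lo hi) Lw yb).
have cb0 := coef_bound_ge0 lohi amin amax.
apply: le_trans (nrm_bounded mD (a_meas n) cb0 _ L) _.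
  by move=> x Dx; exact: (coef_component lohi a_bounds).
rewrite ler_wpM2l //; apply: nrm_tensor_le => //; last by move=> z /wB[].
by rewrite size_rem ?mem_enum // -cardE card_ord leq_pred.
Qed.

Lemma estimated_error I q (Z : R) y : finite_set I -> downward_closed I ->
  (forall i, I i -> posidx i) -> I (idx_one N) ->
  (forall j n, margin I j -> (j n <= q)%N) ->
  (forall j, margin I j -> (zeta I j <= Z%:E)%E) -> 0 <= Z -> box y ->
  nrm (V y - sparse I V y) <= amin^-1 * ((q.+1 ^ N)%:R * Z).
Proof.
move=> finI dcI Ipos I1 Mq zZ Z0 yb.
apply: (le_trans (reliability mD lohi a0_meas a_meas amin_gt0 a_bounds u_sol finI dcI Ipos I1 yb)).
rewrite ler_wpM2l ?invr_ge0 //; first exact: ltW.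
have [_ cM] := cube_finite Mq; have finM := finite_margin finI.
have LF j : L2v (surplus j (amul (sparse I V)) y).
  by apply: surplus_L2v => // z; exact: amul_sparse_L2v.
have FZ j : j \in fset_set (margin I) -> nrm (surplus j (amul (sparse I V)) y) <= Z.
  by rewrite in_fset_set // => /set_mem /zZ /(zeta_le j Z finI); exact.
have [_ h] := nrm_sum_le LF FZ.
by apply: le_trans h _; rewrite ler_wpM2r // ler_nat.
Qed.

(** S_J reproduces S_I v, so v - S_J v is the image of v - S_I v under the identity minus S_J, whose
    norm is bounded by counting indices. *)
Lemma projected_error I J q (v : 'rV[R]_N -> E -> E) (B : R) y :
  finite_set I -> finite_set J -> I `<=` J ->
  (forall j n, J j -> (j n <= q)%N) -> 0 <= B -> (forall y, box y -> L2v (v y)) ->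
  (forall y, box y -> nrm (v y - sparse I v y) <= B) -> box y ->
  nrm (v y - sparse J v y) <= (1 + (q.+1 ^ N * 2 ^ ((q + 2) * N))%:R) * B.
Proof.
move=> finI finJ IJ Jq B0 Lv VB yb.
pose e : 'rV[R]_N -> E -> E := fun z => v z - sparse I v z.
have Le z : box z -> L2v (e z).
  move=> zb; rewrite /e addrC -scaleN1r.
  by apply: PD; [exact: sparse_L2v|exact: Lv].
have sE : sparse J e y = sparse J v y - sparse I v y.
  have -> : e = v - sparse I v by [].
  by rewrite linearB /= sparse_sparse.
have -> : v y - sparse J v y = (-1) *: sparse J e y + e y.
  rewrite sE /e scaleN1r; move: (v y) (sparse J v y) (sparse I v y) => p s t.
  by rewrite opprB [RHS]addrC addrA subrK.
have [_ cJ] := cube_finite Jq.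
have LF j : L2v (surplus j e y) by exact: surplus_L2v.
have [LS hS] : L2v (sparse J e y) /\
    nrm (sparse J e y) <= (q.+1 ^ N * 2 ^ ((q + 2) * N))%:R * B.
  rewrite sparse_app; have FB j : j \in fset_set J ->
      nrm (surplus j e y) <= (2 ^ ((q + 2) * N))%:R * B.
    rewrite in_fset_set // => /set_mem Jj; rewrite hsurplusE.
    by apply: nrm_tensor_le => //; [rewrite -cardE card_ord|move=> n; exact: Jq].
  have [L h] := nrm_sum_le LF FB; split => //; apply: le_trans h _.
  by rewrite mulrA -natrM ler_wpM2r // ler_nat leq_mul2r cJ orbT.
have LNS : L2v ((-1) *: sparse J e y).
  by rewrite -[_ *: _]addr0; apply: PD => //; exact: L2v0.
apply: (le_trans (nrmD mD LNS (Le y yb))).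
by rewrite nrmZ // normrN1 mul1r addrC mulrDl mul1r lerD //; exact: VB.
Qed.

End estimators.

Lemma sigma_min_bounds {R : realType} (N : nat) (lo hi tau : 'I_N -> R) :
  (0 < N)%N -> (forall n, lo n < hi n) -> (forall n, 0 < tau n) ->
  0 < sigma_min lo hi tau /\
  forall n, sigma_min lo hi tau <= sigma_n lo hi tau n.
Proof.
move=> N0 lohi tau0; have n0 : 'I_N := Ordinal N0.
have s0 n : 0 < sigma_n lo hi tau n by have [] := bernstein_sinh (lohi n) (tau0 n).
split=> [|n]; last first.
  by apply: ge_inf; [exists 0 => _ [k _ <-]; exact: ltW|exists n].
have [k _ kmin] := arg_minP (sigma_n lo hi tau) (P := predT) (i0 := n0) isT.
apply: lt_le_trans (s0 k) _; apply: lb_le_inf; first by exists (sigma_n lo hi tau k), k.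
by move=> _ [n _ <-]; exact: kmin.
Qed.

(** With T = 2 ^ (l + 3) and t = T ^ N, each of the seven cardinalities, works and stability
    constants is at most t. Three factors T come from the interpolation in direction n, and one from
    1 + t^2 <= T t^2; hence the exponent 7 N + 4. *)
Lemma estimator_factors {R : realType} (N l : nat) (c : R) : (0 < N)%N -> 0 <= c ->
  (1 + (l.+2 ^ N * 2 ^ ((l.+1 + 2) * N))%:R) *
    (c * ((l.+2 ^ N)%:R * ((l.+2 ^ N)%:R * ((2 ^ ((l.+1 + 2) * N))%:R * 2 ^+ (l.+3 * 3)) *
       (l.+2 ^ N * 2 ^ (l.+1 * N))%:R)))
  <= c * 2 ^+ ((7 * N + 4) * l.+3).
Proof.
move=> N0 c0; set q := l.+1; set T : R := 2 ^+ l.+3; pose t := T ^+ N.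
have T2 : 2 <= T by rewrite /T exprS ler_peMr // exprn_ege1 // ler1n.
have T0 : 0 <= T by apply: le_trans T2.
have t1 : 1 <= t by rewrite exprn_ege1 // (le_trans _ T2) // ler1n.
have t0 : 0 <= t by apply: le_trans t1.
have tE : (2 ^ ((q + 2) * N))%:R = t by rewrite /t /T -exprM natrX addn2.
set n1 : R := (l.+2 ^ N)%:R; have n10 : 0 <= n1 by [].
have n1t : n1 <= t.
  rewrite -tE ler_nat expnM leq_exp2r // (leq_trans _ (ltn_expl _ _)) // addn2.
  exact: leqW.
set w : R := (2 ^ (q * N))%:R; have w0 : 0 <= w by [].
have wt : w <= t by rewrite -tE ler_nat leq_exp2l // leq_mul2r leq_addr orbT.
have -> : 2 ^+ ((7 * N + 4) * l.+3) = T ^+ 4 * t ^+ 7.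
  by rewrite /t /T -!exprM -exprD; congr (_ ^+ _); lia.
rewrite !natrM -/n1 -/w tE exprM -/T.
apply: (@le_trans _ _ ((T * t * t) * (c * (t * (t * (t * T ^+ 3) * (t * t)))))); last first.
  by rewrite le_eqVlt; apply/orP; left; apply/eqP; ring.
have : 0 <= T ^+ 3 by rewrite exprn_ge0.
move: (T ^+ 3) => T3 T30.
apply: ler_pM.
- by rewrite addr_ge0 // mulr_ge0.
- by rewrite !mulr_ge0.
- apply: (@le_trans _ _ (1 + t * t)); first by rewrite lerD2l ler_pM.
  have tt1 : 1 <= t * t by rewrite -[1]mulr1 ler_pM.
  rewrite -mulrA (le_trans (_ : _ <= 2 * (t * t))) //.
    by rewrite mulrDl mul1r lerD2r.
  by rewrite ler_wpM2r // mulr_ge0.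
- rewrite ler_wpM2l // ler_pM ?mulr_ge0 // ler_pM ?mulr_ge0 // ler_pM ?mulr_ge0 //.
Qed.

(** For K >= 3 the right side is 2 ^ K / 4 itself. The loss of 1 accounts for K = 2, where level 1 =
    1 does not follow the power formula. *)
Lemma level_pred_ge {R : realType} K : (1 < K)%N ->
  2 ^+ K / 4 - 1 <= (level K.-1).-1%:R :> R.
Proof.
case: K => [|[|[|K]]] // _; first by rewrite /level /=; lra.
have -> : (level K.+3.-1).-1 = (2 ^ K.+1)%N by rewrite /level /= addn1.
rewrite natrX 2!exprS; set t := 2 ^+ K.+1; lra.
Qed.

Lemma level_product_le {R : realType} K l : (K <= l.+1)%N ->
  (4 * level K * (2 * level K.-1))%:R <= 2 ^+ (l.+3 * 3) :> R.
Proof.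
move=> Kl; rewrite -natrX ler_nat.
have h k : (k <= K)%N -> (level k <= 2 ^ l.+1)%N.
  move=> kK; rewrite (leq_trans (level_le_exp _)) // leq_exp2l //.
  exact: leq_trans Kl.
apply: (@leq_trans (4 * 2 ^ l.+1 * (2 * 2 ^ l.+1))).
  by rewrite leq_mul // leq_mul // h // leq_pred.
by rewrite -[4%N]/(2 ^ 2)%N -!expnD -expnS -expnD leq_exp2l //; lia.
Qed.

Theorem theorem2p19 (R : realType) (d N : nat) (d_ge2 : (2 <= d)%N)
    (N_gt0 : (0 < N)%N)
    (D : set 'rV[R]_d) (D_lip : lipschitz_domain D)
    (lo hi : 'I_N -> R) (lo_lt_hi : forall n, lo n < hi n)
    (f : 'rV[R]_d -> R) (f_L2 : is_L2 D f)
    (a0 : 'rV[R]_d -> R) (a : 'I_N -> 'rV[R]_d -> R)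
    (a0_meas : measurable_fun D a0) (a_meas : forall n, measurable_fun D (a n))
    (amin amax : R) (amin_gt0 : 0 < amin)
    (a_bounds : forall y x, box lo hi y -> D x ->
      amin <= coef a0 a y x <= amax)
    (Tinit : set (set 'rV[R]_d)) (Tinit_mesh : mesh D Tinit)
    (a_grad : forall y T, box lo hi y -> Tinit T ->
      exists2 g, weak_gradient T^° (coef a0 a y) g & is_Linf T^° g)
    (u : 'rV[R]_N -> h1fun d)
    (u_sol : is_solution D (box lo hi) (coef a0 a) f u)
    (tau : 'I_N -> R) (tau_gt0 : forall n, 0 < tau n)
    (u_ext : bounded_holomorphic_extension D lo hi tau u)
    (I : nat -> set (midx N)) (I_run : SC_run D lo hi (coef a0 a) u I) :
  exists2 C : R, 0 < C & forall l : nat, (0 < l)%N ->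
    (sup_norm lo hi (fun y => normV D (u y - sparse_interp lo hi (I l) u y)%R) <=
     (C * l%:R ^+ 5 * (l%:R / N%:R) ^+ (4 * N)
        * 2 `^ (l%:R * (1 - N%:R^-1))
        * expR (- (sigma_min lo hi tau / 2) * levelR (l%:R `^ N%:R^-1)))%R%:E)%E.
Proof.
have [_ oD _ _ _] := D_lip; have mD := open_measurable_row oD.
have [s0 smin] := sigma_min_bounds N_gt0 lo_lt_hi tau_gt0.
have [M M0 HM] := line_approximation mD lo_lt_hi tau_gt0 (fun y yb => proj1 (u_sol y yb)) u_ext.
set s := sigma_min lo hi tau in s0 smin *.
have s0n n : 0 < sigma_n lo hi tau n by exact: lt_le_trans (smin n).
(* Sums over the directions, here and in [Y], give constants that do not depend on the direction n
   found for a given l. *)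
pose A := \sum_n approx_cst (sigma_n lo hi tau n).
have A_ge n : approx_cst (sigma_n lo hi tau n) <= A.
  rewrite /A (bigD1 n) //= lerDl sumr_ge0 // => k _.
  exact: le_trans ler01 (approx_cst_ge1 (s0n k)).
have A0 : 0 <= A.
  by apply: sumr_ge0 => k _; exact: le_trans ler01 (approx_cst_ge1 (s0n k)).
pose Y := \sum_n (`|lo n| + `|hi n|).
have Y0 : 0 <= Y by apply: sumr_ge0 => n _; rewrite addr_ge0.
have Y_ge n t : lo n <= t <= hi n -> `|t| <= Y.
  move=> /andP[t1 t2]; rewrite /Y (bigD1 n) //=.
  apply: (@le_trans _ _ (`|lo n| + `|hi n|)); last first.
    by rewrite lerDl sumr_ge0 // => k _; rewrite addr_ge0.
  rewrite ler_norml; apply/andP; split.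
    rewrite lerNl (le_trans (_ : _ <= - lo n)) ?lerN2 //.
    by rewrite (le_trans (ler_norm _)) // normrN lerDl.
  by rewrite (le_trans t2) // (le_trans (ler_norm _)) // lerDr.
set cb := coef_bound lo hi amin amax; have cb0 : 0 <= cb by exact: coef_bound_ge0.
have [C C0 HC] := @final_estimate R s N (7 * N + 4) s0 N_gt0.
pose G := amin^-1 * cb * (Y * (A * M)).
have ai0 : 0 <= amin^-1 by rewrite invr_ge0 ltW.
have G0 : 0 <= G by rewrite !mulr_ge0.
(* The added 1 keeps the constant positive even if [G] vanishes. *)
exists ((G + 1) * C) => [|l l0]; first by rewrite mulr_gt0 // ltr_wpDl.
have [K [n [l' [i [lK K1 l'l sel HA]]]]] := run_selection I_run N_gt0 l0.
have inv := run_invariant I_run l'; have invl := run_invariant I_run l.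
have [Mi _ _] := sel.
have finI := run_finite I_run l'; have finIl := run_finite I_run l.
(* Step l' precedes l, so the coordinates in its margin are at most l' + 2 <= l + 1; the same bound
   holds in I_l. *)
have Mq j k : margin (I l') j -> (j k <= l.+1)%N.
  by move=> /(margin_run_le k inv) h; apply: leq_trans h _; rewrite ltnS.
have KL : (K <= l.+1)%N.
  by have [<- _ _] := HA i (@completion_self N (I l') i); exact: Mq.
pose x := expR (- ((2 ^+ K / 4 - 1) * s)).
have x0 : 0 <= x by exact: expR_ge0.
pose B := 2 ^+ (l.+3 * 3) * (Y * (A * M) * x).
have YAM0 : 0 <= Y * (A * M) by exact: mulr_ge0 Y0 (mulr_ge0 A0 M0).
have B0 : 0 <= B := mulr_ge0 (exprn_ge0 _ (ler0n _ 2)) (mulr_ge0 YAM0 x0).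
have LV y : box lo hi y -> L2v D (nabla (u y)) := fun yb => gradient_L2v u_sol yb.
have wB y : box lo hi y -> let w := dirsurplus lo hi n K
    (coordmul n (interp lo hi n (level K.-1) (fun y => nabla (u y)))) y in
    L2v D w /\ nrm D w <= B.
  move=> yb; have lev0 : (0 < level K.-1)%N.
    by rewrite (leq_trans _ (level_le (_ : 1 <= K.-1)%N)) // -ltnS prednK // ltnW.
  (* One less than the number of nodes leaves room for the factor y_n. *)
  pose p := (level K.-1).-1; pose eps := A * M * expR (- (p%:R * s)).
  have AM0 : 0 <= A * M := mulr_ge0 A0 M0.
  have eps0 : 0 <= eps := mulr_ge0 AM0 (expR_ge0 _).
  have pK : (p < level K.-1)%N by rewrite /p prednK.
  have epsx : eps <= A * M * x.
    apply: ler_wpM2l => //; rewrite ler_expR lerN2 ler_wpM2r ?(ltW s0) //.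
    exact: level_pred_ge.
  have VQ z psi : box lo hi z -> L2v D psi ->
      exists2 Q : {poly R}, (size Q <= p)%N & forall t, lo n <= t <= hi n ->
      `|inner D (nabla (u (upd z n t))) psi - Q.[t]| <= eps * nrm D psi.
    move=> zb Lpsi; have [Q sQ HQ] := HM z n psi p zb Lpsi.
    exists Q => // t tI; apply: le_trans (HQ t tI) _; rewrite mulrA.
    have psi0 := nrm_ge0 D psi; rewrite -mulrA [_ * expR _]mulrC mulrA.
    apply: ler_wpM2r => //; apply: ler_pM; rewrite ?expR_ge0 //.
    - exact: mulr_ge0 (le_trans ler01 (approx_cst_ge1 (s0n n))) M0.
    - exact: ler_wpM2r.
    by rewrite ler_expR lerN2 ler_wpM2l.
  have [Lw hw] := gradient_decay lo_lt_hi mD eps0 pK (Y_ge n) LV VQ yb.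
  split=> //; apply: le_trans hw _.
  apply: (@le_trans _ _ ((4 * level K * (2 * level K.-1))%:R * (Y * (A * M * x)))).
    rewrite [in leRHS](natrM _ (4 * level K)) -[leRHS]mulrA; apply: ler_wpM2l => //.
    by rewrite mulrCA; apply: ler_wpM2l => //; exact: ler_wpM2l.
  rewrite /B -[Y * (A * M) * x]mulrA; apply: ler_wpM2r.
    exact: mulr_ge0 Y0 (mulr_ge0 AM0 x0).
  exact: level_product_le.
pose e := cb * ((2 ^ ((l.+1 + 2) * N))%:R * B).
have e0 : 0 <= e := mulr_ge0 cb0 (mulr_ge0 (ler0n _ _) B0).
have Ae j : completion (I l') i j -> (zeta D lo hi (coef a0 a) u (I l') j <= e%:E)%E.
  move=> Aj; have [jn Ijn uniq_n] := HA j Aj.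
  have [Mj _] := completion_sub (run_closed inv) Mi Aj.
  have [jpos nIj _] := Mj.
  apply: (zeta_directional mD lo_lt_hi a0_meas a_meas amin_gt0 a_bounds u_sol
    finI jpos nIj _ Ijn uniq_n _ B0); rewrite ?jn //.
  by move=> k; exact: Mq.
have zZ := selected_zeta lo_lt_hi finI (run_closed inv) sel e0 Ae Mq.
set Z := (_ * _ * _)%R in zZ.
have Z0 : 0 <= Z := mulr_ge0 (mulr_ge0 (ler0n _ _) e0) (ler0n _ _).
have I1 : I l' (idx_one N).
  by apply: (run_subset I_run (leq0n l')); have [-> _] := I_run.
have err y : box lo hi y -> _ := fun yb => estimated_error mD lo_lt_hi a0_meas a_meas
  amin_gt0 a_bounds u_sol finI (run_closed inv) (run_pos inv) I1 Mq zZ Z0 yb.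
have E0 : 0 <= amin^-1 * ((l.+2 ^ N)%:R * Z) := mulr_ge0 ai0 (mulr_ge0 (ler0n _ _) Z0).
have sub : I l' `<=` I l by apply: (run_subset I_run); exact: ltnW.
apply: ge_ereal_sup => _ [y yb <-].
have -> : normV D (u y - sparse_interp lo hi (I l) u y) =
    (nrm D (nabla (u y) - sparse_sum lo hi (I l) (fun z => nabla (u z)) y))%:E.
  rewrite -(sparse_nabla lo_lt_hi u y finIl) -l2normE //.
  rewrite (sparse_nabla lo_lt_hi u y finIl) addrC -scaleN1r; apply: (L2vD mD).
    exact: (sparse_L2v mD lo_lt_hi (I l) LV yb).
  exact: LV.
rewrite lee_fin.
apply: (le_trans (projected_error mD lo_lt_hi finI finIl sub
  (fun j k Ij => run_le invl k Ij) E0 LV err yb)).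
apply: (@le_trans _ _ (G * x * 2 ^+ ((7 * N + 4) * l.+3))).
  apply: le_trans (estimator_factors l N_gt0 _); last by rewrite mulr_ge0.
  rewrite le_eqVlt; apply/orP; left; apply/eqP.
  rewrite /Z /e /B /G -/cb; ring.
rewrite -!(mulrA (G + 1)) -mulrA [x * _]mulrC.
apply: ler_pM => //; last exact: HC.
  by rewrite mulr_ge0 // exprn_ge0.
by rewrite lerDl.
Qed.
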